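(* Let $\mathbb{K}$ be a field and let $G$ be a compact graph of type $1$ or type $2$. For every integer $1\le i\le\mathfrak{t}(G)-1$, let $\mathcal{N}_i(G)=\bigcup_H\mathcal{N}_H$, the union being over all compact induced subgraphs $H$ of $G$ that contain exactly $i+1$ minimal cycles. Then for every such $i$ and every monomial $\alpha$ in $\mathbb{K}[G]$, $$\beta_{i,\alpha}(\mathbb{K}[G])=\begin{cases}1,&\alpha\in\mathcal{N}_i(G),\\0,&\text{otherwise.}\end{cases}$$ In particular, $\beta_{i,j}(\mathbb{K}[G])$ is equal to the cardinality of the set $\{\alpha\in\mathcal{N}_i(G)\mid|\deg(\alpha)|=2j\}$.
   Context: For a simple graph $G$ (finite, no loops or multiple edges) with vertex set $V(G)$ and edge set $E(G)$, the edge ring $\mathbb{K}[G]$ is the subalgebra of $\mathbb{K}[x: x\in V(G)]$ generated by the monomials $x_e=xy$ for $e=\{x,y\}\in E(G)$. Let $\mathbb{K}[E(G)]$ be the polynomial ring with one variable for each edge; $\mathbb{K}[G]$ is a $\mathbb{K}[E(G)]$-module via $e\mapsto x_e$. Everything is $\mathbb{Z}_{\ge0}^{V(G)}$-graded, the variable $e=\{x,y\}$ having the multidegree of $xy$. For a multigraded module $M$, $\beta_{i,h}(M)=\dim_{\mathbb{K}}\mathrm{Tor}_i^{\mathbb{K}[E(G)]}(M,\mathbb{K})_h$; $\beta_{i,j}(M)$ (with $j$ an integer) is the graded Betti number for the standard grading in which every edge variable has degree $1$. A monomial $X^h=\prod_x x^{h(x)}$ is identified with its multidegree $h$, $|\deg(X^h)|=\sum_xh(x)$,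 and $\mathbb{Z}^{V(H)}$ is regarded as a subset of $\mathbb{Z}^{V(G)}$ for an induced subgraph $H$. A simple graph satisfies the odd cycle condition if any two odd cycles either have a common vertex or are connected by an edge. A compact graph is a connected simple graph in which every vertex has degree at least $2$, which contains no even cycle, satisfies the odd cycle condition, and is not itself an odd cycle. A vertex of a compact graph is big if its degree is greater than $2$; a compact graph is of type $r$ if it has exactly $r$ big vertices. A minimal cycle is an induced cycle; $\mathfrak{t}(G)$ is the number of minimal cycles of $G$. For a simple graph $H$ with $p=\mathrm{pdim}(\mathbb{K}[H])$ (over $\mathbb{K}[E(H)]$), the top support is $\mathcal{N}_H=\{X^h:\beta_{p,h}(\mathbb{K}[H])\neq0\}$. *)

(* Defs.v *)
From HB Require Import structures.
From mathcomp Require Import all_boot all_order all_algebra.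
From mathcomp Require Import mpoly.
From Stdlib Require Import ClassicalEpsilon.

Set Implicit Arguments.
Unset Strict Implicit.
Unset Printing Implicit Defensive.

Import Order.TTheory GRing.Theory Num.Theory.
Local Open Scope ring_scope.

Record sgraph := SGraph {
  vertex :> finType;
  adj : rel vertex;
  adj_sym : ssrbool.symmetric adj;
  adj_irr : irreflexive adj }.

Section Graphs.

Variable G : sgraph.

Definition edges : {set {set G}} :=
  [set A : {set G} | [exists x, exists y, adj x y && (A == [set x; y])]].

Definition degree (x : G) : nat := #|[set y | adj x y]|.

Definition connected : Prop :=
  (0 < #|G|)%N /\ forall x y : G, connect (@adj G) x y.

(* A cycle is given by the cyclic list of its distinct vertices. *)
Definition is_cycle (c : seq G) : bool :=
  (2 < size c)%N && ucycleb (@adj G) c.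

Definition odd_cycle (c : seq G) : bool := is_cycle c && odd (size c).

Definition odd_cycle_condition : Prop :=
  forall c d : seq G, odd_cycle c -> odd_cycle d ->
    exists x, exists y, [/\ x \in c, y \in d & (x == y) || adj x y].

(* [c] passes through every vertex, since it has #|G| distinct entries. *)
Definition is_cycle_graph : bool :=
  [exists c : #|G|.-tuple G, is_cycle c &&
    [forall x, forall y, adj x y == (y == next c x) || (x == next c y)]].

Record compact : Prop := Compact {
  compact_connected : connected;
  compact_degree : forall x : G, (2 <= degree x)%N;
  compact_no_even_cycle : forall c : seq G, is_cycle c -> odd (size c);
  compact_odd_cycle_condition : odd_cycle_condition;
  compact_not_odd_cycle : ~ (is_cycle_graph /\ odd #|G|) }.

Definition compact_type (r : nat) : Prop :=
  compact /\ #|[set x : G | (2 < degree x)%N]| = r.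

Section Induced.

Variable W : {set G}.

Definition induced_adj : rel {x : G | x \in W} :=
  fun x y => adj (val x) (val y).

Lemma induced_adj_sym : ssrbool.symmetric induced_adj.
Proof. by move=> x y; apply: adj_sym. Qed.

Lemma induced_adj_irr : irreflexive induced_adj.
Proof. by move=> x; apply: adj_irr. Qed.

Definition induced : sgraph := SGraph induced_adj_sym induced_adj_irr.

End Induced.

End Graphs.

(* An induced cycle is determined by its set of vertices. *)
Definition num_minimal_cycles (G : sgraph) : nat :=
  #|[set W : {set G} | is_cycle_graph (induced W)]|.

Section EdgeRing.

Variables (K : fieldType) (G : sgraph).

(* The variables of K[V(G)] and K[E(G)] are numbered by [enum_val]. *)
Local Notation KV := {mpoly K[#|G|]}.
Local Notation KE := {mpoly K[#|edges G|]}.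

Definition vmonomial (h : {ffun G -> nat}) : KV :=
  'X_[ [multinom h (enum_val i) | i < #|G|] ].

Definition edge_monomial (i : 'I_#|edges G|) : KV :=
  \prod_(x in (enum_val i : {set G})) 'X_(enum_rank x).

Definition edge_map (q : KE) : KV :=
  comp_mpoly [tuple edge_monomial i | i < #|edges G|] q.

(* The subalgebra generated by the [edge_monomial]s. *)
Definition edge_ring (p : KV) : Prop := exists q : KE, p = edge_map q.

(* Gradings of K[E(G)] and K[G] are given by the degrees of the edge variables;
   K[G]_d is then the image of K[E(G)]_d. *)

Definition multidegree (i : 'I_#|edges G|) : {ffun G -> nat} :=
  [ffun x => (x \in (enum_val i : {set G})) : nat].

Definition standard_degree (i : 'I_#|edges G|) : int := 1.

Section Resolutions.

Variables (D : nmodType) (w : 'I_#|edges G| -> D).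

Definition mono_degree (m : 'X_{1..#|edges G|}) : D :=
  \sum_(i < #|edges G|) w i *+ m i.

(* Homogeneity is expressed additively since [D] may have no subtraction:
   [q] has degree [d' - d]. *)
Definition homog_between (d d' : D) (q : KE) : Prop :=
  forall m, m \in msupp q -> d + mono_degree m = d'.

Definition edge_ring_homog (d : D) (p : KV) : Prop :=
  exists q : KE, homog_between 0 d q /\ p = edge_map q.

(* A sequence of graded free modules F_i of rank [rk i], whose j-th basis vector
   has degree [gdeg i j], with maps F_(i+1) -> F_i acting on row vectors, and
   the images in K[V(G)] of the basis vectors of F_0. *)
Record free_seq := FreeSeq {
  rk : nat -> nat;
  gdeg : forall i, 'I_(rk i) -> D;
  bd : forall i, 'M[KE]_(rk i.+1, rk i);
  aug : 'I_(rk 0) -> KV }.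

(* K[V(G)] is a K[E(G)]-module through [edge_map]. *)
Definition aug_map (F : free_seq) (v : 'rV[KE]_(rk F 0)) : KV :=
  \sum_j edge_map (v 0 j) * aug j.

Record resolution (F : free_seq) : Prop := Resolution {
  res_bd_homog : forall i j k,
    homog_between (@gdeg F i k) (@gdeg F i.+1 j) (bd F i j k);
  res_aug_homog : forall j, edge_ring_homog (@gdeg F 0 j) (@aug F j);
  res_aug_onto : forall p, edge_ring p <-> exists v, p = @aug_map F v;
  res_exact0 : forall v : 'rV[KE]_(rk F 0),
    aug_map v = 0 <-> exists u : 'rV[KE]_(rk F 1), v = u *m bd F 0;
  res_exact : forall i (v : 'rV[KE]_(rk F i.+1)),
    v *m bd F i = 0 <-> exists u : 'rV[KE]_(rk F i.+2), v = u *m bd F i.+1 }.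

(* The complex F (x) K, where K is the quotient of K[E(G)] by the variables:
   taking the quotient amounts to extracting constant coefficients. *)
Definition bd_tensor (F : free_seq) i : 'M[K]_(rk F i.+1, rk F i) :=
  map_mx (mcoeff 0%MM) (bd F i).

(* The degree [h] components of F_i (x) K, and of the cycles and boundaries
   therein, as row spaces. *)
Definition degree_part (F : free_seq) i (h : D) : 'M[K]_(rk F i) :=
  diag_mx (\row_j (@gdeg F i j == h)%:R).

Definition tor_cycles (F : free_seq) i (h : D) : 'M[K]_(rk F i) :=
  match i with
  | 0%N => degree_part F 0 h
  | i'.+1 => (degree_part F i'.+1 h :&: kermx (bd_tensor F i'))%MS
  end.

Definition tor_boundaries (F : free_seq) i (h : D) : 'M[K]_(rk F i.+1, rk F i) :=
  degree_part F i.+1 h *m bd_tensor F i.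

(* dim_K H_i(F (x) K)_h; boundaries are cycles when F is a resolution. *)
Definition tor_dim (F : free_seq) i (h : D) : nat :=
  (\rank (tor_cycles F i h) - \rank (tor_boundaries F i h))%N.

(* dim_K Tor_i(K[G], K)_h. The value [tor_dim F i h] does not depend on the
   graded free resolution F of K[G]. *)
Definition betti (i : nat) (h : D) : nat :=
  epsilon (inhabits 0%N)
    (fun n => exists F : free_seq, resolution F /\ n = tor_dim F i h).

Definition resolution_of_length_le (p : nat) : Prop :=
  exists F : free_seq, resolution F /\ forall i, (p < i)%N -> rk F i = 0%N.

End Resolutions.

(* In the category of multigraded modules over K[E(G)] the finitely generated
   projectives are free. *)
Definition is_pdim (p : nat) : Prop :=
  resolution_of_length_le multidegree p /\
  forall q, resolution_of_length_le multidegree q -> (p <= q)%N.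

(* Monomials X^h are represented by their exponents h. *)
Definition top_support (h : {ffun G -> nat}) : Prop :=
  exists p, is_pdim p /\ betti multidegree p h <> 0%N.

End EdgeRing.

Arguments multidegree : clear implicits.
Arguments standard_degree : clear implicits.
Arguments betti K G [D] w i h.
Arguments vmonomial K [G] h.

Definition extend (G : sgraph) (W : {set G}) (h : {ffun induced W -> nat}) :
  {ffun G -> nat} :=
  [ffun x => if insub x is Some y then h (y : {z : G | z \in W}) else 0%N].

Definition support_set (K : fieldType) (G : sgraph) (i : nat)
    (a : {ffun G -> nat}) : Prop :=
  exists W : {set G},
    [/\ compact (induced W), num_minimal_cycles (induced W) = i.+1 &
        exists h : {ffun induced W -> nat},
          top_support K h /\ a = extend h].

Definition total_degree (G : sgraph) (a : {ffun G -> nat}) : nat :=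
  (\sum_x a x)%N.

Definition has_cardinality (T : eqType) (P : T -> Prop) (n : nat) : Prop :=
  exists s : seq T, [/\ uniq s, size s = n & forall x, x \in s <-> P x].

(* Main.v *)
(* Removing the big vertices of G leaves paths, the arms; an arm together with the
   big vertices next to it is the vertex set of a minimal cycle. Colour the edges of
   each arm k alternately with two colours, let X_k and Y_k be the products of the
   two colour classes and e the edge joining the big vertices (1 if there is only
   one). Then X_k Y_l = X_l Y_k e^(v_l - v_k) in K[G] for v_k <= v_l, where v_k is
   the number of edges from the arm k to the second big vertex, and these relations
   generate the toric ideal. Thus K[G] behaves like the quotient by the 2 x 2 minors
   of the matrix with rows (e^(v_k) X_k) and (Y_k), and rescaling the basis of the
   Eagon-Northcott complex of this matrix gives a minimal resolution. Its basis in
   homological degree i > 0 is indexed by the sets T of i + 1 cycles and the numbers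
   0 < a <= i; the basis vector has the degree of the product of the X_k for the
   first a elements of T and of the Y_k for the others. These degrees are pairwise
   distinct, and those for a given T make up the top of the resolution of the induced
   subgraph on the union of the cycles in T. The unions of at least two cycles are
   precisely the compact induced subgraphs of G. *)

Require Import Defs.
From mathcomp Require Import all_boot all_order all_algebra.
From mathcomp Require Import mpoly.
From mathcomp Require Import zify.
From Stdlib Require Import ClassicalEpsilon.

Set Implicit Arguments.
Unset Strict Implicit.
Unset Printing Implicit Defensive.

Import Order.TTheory GRing.Theory Num.Theory.
Local Open Scope ring_scope.

(** * Graded resolutions of the edge ring *)

(** Since [betti] is a choice among the values of all resolutions, it becomes computable only after
    the comparison theorem for graded resolutions. That theorem is proved for degrees in any
    commutative monoid, so that the multigrading and the standard grading are treated at once.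
    Rescaling by powers of e shows that the composite of two differentials vanishes, because a power
    of e can be cancelled in a domain. It does not carry exactness over from the Eagon-Northcott
    complex: a boundary multiplied by a power of e need not be divisible by it as a boundary.
    Exactness is therefore read off from leading terms. The columns are sorted by v_k, so that all
    exponents of e in the rescaled differential are nonnegative. The toric relations come from
    integer labellings of the edges with sum 0 at every vertex. Such a labelling alternates along
    each arm and so amounts to one integer c_k per arm; the equations at the big vertices give that
    the c_k have sum 0. An induced subgraph is never analysed afresh: it inherits the colouring, the
    columns and their order from G through an embedding, which is the identity for G itself. *)

Lemma mpoly_monomial_ind (n : nat) (R : nzRingType) (P : {mpoly R[n]} -> Prop) :
  P 0 -> (forall p q, P p -> P q -> P (p + q)) ->
  (forall c m, P (c *: 'X_[m])) -> forall p, P p.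
Proof.
move=> P0 PD PX p; rewrite [p]mpolyE.
by elim/big_ind: _ => // m _; apply: PX.
Qed.

Lemma mcoeff_sum (n : nat) (R : nzRingType) (I : Type) (r : seq I) (P : pred I)
    (F : I -> {mpoly R[n]}) m :
  (\sum_(i <- r | P i) F i)@_m = \sum_(i <- r | P i) (F i)@_m.
Proof. exact: raddf_sum. Qed.

Section Homogeneous.

Variables (K : fieldType) (G : sgraph) (D : nmodType) (w : 'I_#|edges G| -> D).

Local Notation KE := {mpoly K[#|edges G|]}.
Local Notation deg := (mono_degree w).
Local Notation hom := (homog_between w).

Lemma mono_degree0 : deg 0%MM = 0.
Proof. by rewrite /mono_degree big1 // => i _; rewrite mnm0E mulr0n. Qed.

Lemma mono_degreeD m1 m2 : deg (m1 + m2)%MM = deg m1 + deg m2.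
Proof.
by rewrite /mono_degree -big_split; apply: eq_bigr => i _; rewrite mnmDE mulrnDr.
Qed.

Lemma homog0 d d' : hom d d' (0 : KE).
Proof. by move=> m; rewrite msupp0. Qed.

Lemma homogD d d' (p q : KE) : hom d d' p -> hom d d' q -> hom d d' (p + q).
Proof.
by move=> hp hq m /msuppD_le; rewrite mem_cat => /orP[/hp|/hq].
Qed.

Lemma homogN d d' (p : KE) : hom d d' p -> hom d d' (- p).
Proof. by move=> hp m; rewrite (perm_mem (msuppN p)) => /hp. Qed.

Lemma homog_sum d d' (I : Type) (r : seq I) (P : pred I) (F : I -> KE) :
  (forall i, P i -> hom d d' (F i)) -> hom d d' (\sum_(i <- r | P i) F i).
Proof.
move=> h; elim/big_ind: _ => [|p q|i /h] //; [exact: homog0 | exact: homogD].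
Qed.

Lemma homogM d1 d2 d3 (p q : KE) : hom d1 d2 p -> hom d2 d3 q ->
  hom d1 d3 (p * q).
Proof.
move=> hp hq m /msuppM_le /allpairsP[[m1 m2] /= [/hp h1 /hq h2 ->]].
by rewrite mono_degreeD addrA h1.
Qed.

Lemma homog1 d : hom d d (1 : KE).
Proof. by move=> m; rewrite msupp1 inE => /eqP->; rewrite mono_degree0 addr0. Qed.

Lemma homogZX d c m : hom d (d + deg m) (c *: 'X_[m] : KE).
Proof. by move=> m' /msuppZ_le; rewrite msuppX inE => /eqP->. Qed.

(** Truncation to the terms of degree d' - d; it turns an arbitrary lift into a homogeneous one. *)
Definition homog_part (d d' : D) (q : KE) : KE :=
  \sum_(m <- msupp q) q@_m *: (if d + deg m == d' then 'X_[m] else 0).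

Lemma mcoeff_homog_part d d' q m :
  (homog_part d d' q)@_m = if d + deg m == d' then q@_m else 0.
Proof.
rewrite /homog_part mcoeff_sum /=.
under eq_bigr => m1 _.
  rewrite (_ : mcoeff _ _ = q@_m1 * (m1 == m)%:R * (d + deg m == d')%:R); last first.
    rewrite mcoeffZ; have [<-|nm] := eqVneq m1 m.
      by case: ifP => _; rewrite ?mcoeffX ?mcoeff0 ?eqxx /= ?mulr1 ?mulr0.
    by case: ifP => _; rewrite ?mcoeffX ?mcoeff0 ?(negPf nm) /= ?mulr0 ?mul0r.
  over.
rewrite -mulr_suml.
have -> : \sum_(m1 <- msupp q) q@_m1 * (m1 == m)%:R = q@_m.
  rewrite [in RHS](mpolyE q) mcoeff_sum; apply: eq_bigr => m1 _.
  by rewrite mcoeffZ mcoeffX.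
by case: ifP => _; rewrite ?mulr1 ?mulr0.
Qed.

Lemma homog_part_homog d d' q : hom d d' (homog_part d d' q).
Proof.
move=> m; rewrite mcoeff_msupp mcoeff_homog_part.
by case: (d + _ =P d') => // _; rewrite eqxx.
Qed.

Lemma homog_part_id d d' q : hom d d' q -> homog_part d d' q = q.
Proof.
move=> hq; apply/mpolyP => m; rewrite mcoeff_homog_part.
have [/hq->|/memN_msupp_eq0->] := boolP (m \in msupp q); rewrite ?eqxx //.
by rewrite if_same.
Qed.

Lemma homog_partD d d' p q :
  homog_part d d' (p + q) = homog_part d d' p + homog_part d d' q.
Proof.
apply/mpolyP => m; rewrite !(mcoeff_homog_part, mcoeffD).
by case: ifP; rewrite ?addr0.
Qed.

Lemma homog_part0 d d' : homog_part d d' 0 = 0.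
Proof. by apply/mpolyP => m; rewrite mcoeff_homog_part mcoeff0 if_same. Qed.

Lemma homog_partB d d' p q :
  homog_part d d' (p - q) = homog_part d d' p - homog_part d d' q.
Proof.
apply/mpolyP => m; rewrite !(mcoeff_homog_part, mcoeffB).
by case: ifP; rewrite ?subr0.
Qed.

Lemma homog_part_sum d d' (I : Type) (r : seq I) (F : I -> KE) :
  homog_part d d' (\sum_(i <- r) F i) = \sum_(i <- r) homog_part d d' (F i).
Proof.
by apply: (big_morph (homog_part d d')); [exact: homog_partD | exact: homog_part0].
Qed.

Lemma homog_partZX d d' c m :
  homog_part d d' (c *: 'X_[m]) = if d + deg m == d' then c *: 'X_[m] else 0.
Proof.
apply/mpolyP => m'; rewrite mcoeff_homog_part mcoeffZ mcoeffX.
have [->|nm] := eqVneq m m'; first by case: ifP; rewrite ?mcoeff0 // mcoeffZ mcoeffX eqxx.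
by rewrite mulr0 if_same; case: ifP; rewrite ?mcoeff0 // mcoeffZ mcoeffX (negPf nm) mulr0.
Qed.

(** Every term m' of [q] satisfies d1 + deg m' = d2, so the condition on a product m m' relative to
    d1 is the condition on m relative to d2. Only the monoid laws of [D] enter. *)
Lemma homog_partM d1 d2 d3 (p q : KE) : hom d1 d2 q ->
  homog_part d1 d3 (p * q) = homog_part d2 d3 p * q.
Proof.
move=> hq; elim/mpoly_monomial_ind: p => [|p p' IH IH'|c m].
- by rewrite mul0r !homog_part0 mul0r.
- by rewrite mulrDl !homog_partD IH IH' mulrDl.
rewrite [q]mpolyE mulr_sumr homog_part_sum mulr_sumr !big_seq; apply: eq_bigr => m' /hq <-.
rewrite -scalerAl -scalerAr scalerA -mpolyXD !homog_partZX mono_degreeD.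
rewrite (addrC (deg m)) addrA; case: ifP; rewrite ?mul0r // => _.
by rewrite -scalerAl -scalerAr scalerA mpolyXD.
Qed.

Lemma mcoeff0_homog d d' (q : KE) : hom d d' q -> q@_0%MM != 0 -> d = d'.
Proof. by move=> hq; rewrite -mcoeff_msupp => /hq; rewrite mono_degree0 addr0. Qed.

Definition homog_mx m n (g' : 'I_m -> D) (g : 'I_n -> D) (M : 'M[KE]_(m, n)) :=
  forall j k, hom (g k) (g' j) (M j k).

Lemma homog_mxM m n p (g1 : 'I_m -> D) (g2 : 'I_n -> D) (g3 : 'I_p -> D) M N :
  homog_mx g1 g2 M -> homog_mx g2 g3 N -> homog_mx g1 g3 (M *m N).
Proof.
by move=> hM hN j k; rewrite mxE; apply: homog_sum => l _; rewrite mulrC; apply: homogM.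
Qed.

Lemma homog_mxB m n (g1 : 'I_m -> D) (g2 : 'I_n -> D) M N :
  homog_mx g1 g2 M -> homog_mx g1 g2 N -> homog_mx g1 g2 (M - N).
Proof. by move=> hM hN j k; rewrite !mxE; apply: homogD => //; apply: homogN. Qed.

Lemma homog_mx1 m (g : 'I_m -> D) : homog_mx g g 1%:M.
Proof.
move=> j k; rewrite mxE; case: eqVneq => [->|_]; [exact: homog1 | exact: homog0].
Qed.

(** Truncating the entries of any lift to the expected degrees leaves a lift, as multiplication by
    the homogeneous [N] commutes with truncation. *)
Lemma homog_mx_lift m n p (g1 : 'I_m -> D) (g2 : 'I_n -> D) (g3 : 'I_p -> D)
    (M : 'M[KE]_(m, p)) (N : 'M[KE]_(n, p)) :
  homog_mx g1 g3 M -> homog_mx g2 g3 N ->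
  (forall j, exists u : 'rV_n, row j M = u *m N) ->
  exists U : 'M_(m, n), homog_mx g1 g2 U /\ U *m N = M.
Proof.
move=> hM hN /fin_all_exists[u hu].
exists (\matrix_(j, k) homog_part (g2 k) (g1 j) (u j 0 k)); split.
  by move=> j k; rewrite mxE; apply: homog_part_homog.
apply/matrixP => j l; have := congr1 (fun v : 'rV_p => v 0 l) (hu j).
rewrite !mxE => hjl; rewrite -(homog_part_id (hM j l)) hjl homog_part_sum.
by apply: eq_bigr => k _; rewrite mxE (homog_partM _ _ (hN k l)).
Qed.

Lemma mcoeff0_mx m n p (M : 'M[KE]_(m, n)) (N : 'M[KE]_(n, p)) :
  map_mx (mcoeff 0%MM) (M *m N) = map_mx (mcoeff 0%MM) M *m map_mx (mcoeff 0%MM) N.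
Proof. exact: (map_mxM (mcoeff 0%MM : {rmorphism KE -> K})). Qed.

(** A nonzero constant coefficient forces the degrees of source and target to agree, so a
    homogeneous matrix modulo the variables respects degree components. *)
Lemma degree_part_comm (F F' : free_seq K G D) i i' (M : 'M[KE]_(rk F i, rk F' i')) h :
  homog_mx (@gdeg _ _ _ F i) (@gdeg _ _ _ F' i') M ->
  degree_part F i h *m map_mx (mcoeff 0%MM) M =
  map_mx (mcoeff 0%MM) M *m degree_part F' i' h.
Proof.
move=> hM; apply/matrixP => j k; rewrite mul_diag_mx mul_mx_diag !mxE.
have [->|/(mcoeff0_homog (hM j k))->] := eqVneq ((M j k)@_0%MM) 0; last exact: mulrC.
by rewrite mul0r mulr0.
Qed.

End Homogeneous.

(** * The edge map on monomials *)

Section EdgeMap.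

Variables (K : fieldType) (G : sgraph).

Local Notation KE := {mpoly K[#|edges G|]}.
Local Notation mdegree := (mono_degree (multidegree G)).

Lemma edge_mapM (p q : KE) : edge_map (p * q) = edge_map p * edge_map q.
Proof. exact: rmorphM. Qed.

Lemma edge_map1 : edge_map (1 : KE) = 1.
Proof. exact: rmorph1. Qed.

Lemma edge_map0 : edge_map (0 : KE) = 0.
Proof. exact: raddf0. Qed.

Lemma edge_map_sum (I : Type) (r : seq I) (F : I -> KE) :
  edge_map (\sum_(i <- r) F i) = \sum_(i <- r) edge_map (F i).
Proof. exact: raddf_sum. Qed.

Lemma edge_mapB (p q : KE) : edge_map (p - q) = edge_map p - edge_map q.
Proof. exact: raddfB. Qed.

Lemma edge_mapZ c (p : KE) : edge_map (c *: p) = c *: edge_map p.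
Proof. exact: linearZ. Qed.

Lemma natmulE (m n : nat) : m *+ n = (m * n)%N.
Proof. by elim: n => [|n IH]; rewrite ?muln0 // mulrS IH mulnS. Qed.

Lemma mdegreeE (m : 'X_{1..#|edges G|}) x :
  mdegree m x = (\sum_(i < #|edges G|) (x \in (enum_val i : {set G})) * m i)%N.
Proof.
rewrite /mono_degree sum_ffunE; apply: eq_bigr => i _.
by rewrite ffunMnE ffunE natmulE.
Qed.

Definition vertex_exponent (h : {ffun G -> nat}) : 'X_{1..#|G|} :=
  [multinom h (enum_val i) | i < #|G|].

Lemma vertex_exponent_inj : injective vertex_exponent.
Proof.
move=> h h' /mnmP hh'; apply/ffunP => x; have := hh' (enum_rank x).
by rewrite !mnmE enum_rankK.
Qed.

Lemma edge_mapX (m : 'X_{1..#|edges G|}) :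
  edge_map ('X_[m] : KE) = 'X_[vertex_exponent (mdegree m)].
Proof.
rewrite /edge_map comp_mpolyX.
under eq_bigr => i _ do rewrite tnth_mktuple /edge_monomial mprodXE.
rewrite mprodXnE; congr mpolyX; apply/mnmP => j.
rewrite mnm_sumE mnmE mdegreeE; apply: eq_bigr => i _.
rewrite mulmnE mnm_sumE; congr (_ * _)%N.
under eq_bigr => x _ do rewrite mnm1E (can2_eq (@enum_rankK _) (@enum_valK _)).
have [jA|/negP jA] := boolP (enum_val j \in _); last first.
  by rewrite big1 // => x xA; apply/eqP; rewrite eqb0; apply/eqP => xj; rewrite -xj in jA.
by rewrite (bigD1 (enum_val j)) //= eqxx big1 // => x /andP[_ /negPf->].
Qed.

Lemma mcoeff_edge_map (q : KE) M :
  (edge_map q)@_M = \sum_(m <- msupp q) q@_m * (vertex_exponent (mdegree m) == M)%:R.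
Proof.
rewrite {1}[q]mpolyE edge_map_sum mcoeff_sum; apply: eq_bigr => m _.
by rewrite edge_mapZ edge_mapX mcoeffZ mcoeffX.
Qed.

End EdgeMap.

(** * Comparison of graded resolutions *)

Section Comparison.

Variables (K : fieldType) (G : sgraph) (D : nmodType) (w : 'I_#|edges G| -> D).

(* Holds for both gradings of the statement; it makes the kernel of [edge_map]
   homogeneous. *)
Hypothesis w_multidegree : forall m m' : 'X_{1..#|edges G|},
  mono_degree (multidegree G) m = mono_degree (multidegree G) m' ->
  mono_degree w m = mono_degree w m'.

Local Notation KE := {mpoly K[#|edges G|]}.

Lemma aug_mapB (F : free_seq K G D) (v v' : 'rV_(rk F 0)) :
  aug_map (v - v') = aug_map v - aug_map v'.
Proof.
rewrite /aug_map -sumrB; apply: eq_bigr => j _.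
by rewrite !mxE edge_mapB mulrBl.
Qed.

Lemma aug_map_mul (F : free_seq K G D) m (u : 'rV_m) (M : 'M_(m, rk F 0)) :
  aug_map (u *m M) = \sum_j edge_map (u 0 j) * aug_map (row j M).
Proof.
rewrite /aug_map; under eq_bigr => k _ do rewrite mxE edge_map_sum mulr_suml.
rewrite exchange_big; apply: eq_bigr => j _ /=; rewrite mulr_sumr.
by apply: eq_bigr => k _; rewrite edge_mapM !mxE mulrA.
Qed.

Lemma res_bd_comp (F : free_seq K G D) i : resolution w F ->
  bd F i.+1 *m bd F i = 0.
Proof.
move=> rF; apply/row_matrixP => j; rewrite row_mul row0.
by apply/(res_exact rF); exists (delta_mx 0 j); rewrite rowE.
Qed.

Lemma res_aug_bd (F : free_seq K G D) j : resolution w F ->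
  aug_map (row j (bd F 0)) = 0.
Proof.
by move=> rF; apply/(res_exact0 rF); exists (delta_mx 0 j); rewrite rowE.
Qed.

Lemma res_lift (F : free_seq K G D) i m (g : 'I_m -> D)
    (M : 'M[KE]_(m, rk F i.+1)) : resolution w F ->
  homog_mx w g (@gdeg _ _ _ F i.+1) M -> M *m bd F i = 0 ->
  exists U, homog_mx w g (@gdeg _ _ _ F i.+2) U /\ U *m bd F i.+1 = M.
Proof.
move=> rF hM M0; apply: homog_mx_lift => // [|j]; first exact: (res_bd_homog rF).
by apply/(res_exact rF); rewrite -row_mul M0 row0.
Qed.

Lemma res_lift0 (F : free_seq K G D) m (g : 'I_m -> D)
    (M : 'M[KE]_(m, rk F 0)) : resolution w F ->
  homog_mx w g (@gdeg _ _ _ F 0) M -> (forall j, aug_map (row j M) = 0) ->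
  exists U, homog_mx w g (@gdeg _ _ _ F 1) U /\ U *m bd F 0 = M.
Proof.
move=> rF hM M0; apply: homog_mx_lift => // [|j]; first exact: (res_bd_homog rF).
exact/(res_exact0 rF).
Qed.

(** The coefficient of a monomial in [edge_map q] collects the terms of [q] of one multidegree.
    These share their [w]-degree, so truncation keeps or discards all of them. *)
Lemma edge_map_homog_part d d' (q : KE) : edge_map q = 0 ->
  edge_map (homog_part w d d' q) = 0.
Proof.
move=> q0; apply/mpolyP => M; rewrite mcoeff0.
rewrite /homog_part edge_map_sum mcoeff_sum.
have E m : (edge_map (q@_m *: (if d + mono_degree w m == d' then 'X_[m] else 0)))@_M =
    q@_m * (vertex_exponent (mono_degree (multidegree G) m) == M)%:R *
    (d + mono_degree w m == d')%:R.
  rewrite edge_mapZ mcoeffZ; case: ifP => _; last by rewrite edge_map0 mcoeff0 !mulr0.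
  by rewrite edge_mapX mcoeffX mulr1.
under eq_bigr => m _ do rewrite E.
have [/hasP[m0 _ /eqP m0M]|/hasPn noM] := boolP (has (fun m =>
    vertex_exponent (mono_degree (multidegree G) m) == M) (msupp q)).
  rewrite (eq_bigr (fun m => q@_m *
      (vertex_exponent (mono_degree (multidegree G) m) == M)%:R *
      (d + mono_degree w m0 == d')%:R)); last first.
    move=> m _; have [mM|] := eqVneq; last by rewrite mulr0 !mul0r.
    by rewrite (w_multidegree (m' := m0)) //; apply: vertex_exponent_inj; rewrite mM.
  by rewrite -mulr_suml -mcoeff_edge_map q0 mcoeff0 mul0r.
by rewrite big_seq big1 // => m /noM/negPf->; rewrite mulr0 mul0r.
Qed.

Section ChainMaps.

Variables (F F' : free_seq K G D).
Hypotheses (rF : resolution w F) (rF' : resolution w F').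

Definition chain_map_spec i (M : 'M[KE]_(rk F i, rk F' i)) :=
  homog_mx w (@gdeg _ _ _ F i) (@gdeg _ _ _ F' i) M.

(** The existence of a lift at one stage depends on the properties of the preceding one. The maps
    are therefore chosen by [epsilon], and the properties are established afterwards by
    induction. *)
Fixpoint comparison_map i : 'M[KE]_(rk F i, rk F' i) :=
  match i with
  | 0%N => epsilon (inhabits 0) (fun M => chain_map_spec M /\
      forall j, aug_map (row j M) = aug j)
  | i'.+1 => epsilon (inhabits 0) (fun M => chain_map_spec M /\
      M *m bd F' i' = bd F i' *m comparison_map i')
  end.

(** Homogeneity in K[G] is only available through preimages in K[E(G)], so the truncation takes
    place there: two preimages of [aug j] differ by an element of the kernel of [edge_map], and this
    kernel is homogeneous. *)
Lemma comparison_map0P : chain_map_spec (comparison_map 0) /\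
  forall j, aug_map (row j (comparison_map 0)) = aug j.
Proof.
apply: (epsilon_spec (inhabits 0) (fun M => chain_map_spec M /\
  forall j, aug_map (row j M) = aug j)).
have aug_lift j : exists u : 'rV_(rk F' 0),
    (forall k, homog_between w (@gdeg _ _ _ F' 0 k) (@gdeg _ _ _ F 0 j) (u 0 k)) /\
    aug_map u = @aug _ _ _ F j.
  have [p [hp aug_p]] := res_aug_homog rF j.
  have [|v hv] := (res_aug_onto rF' (@aug _ _ _ F j)).1; first by exists p.
  have /fin_all_exists[q hq] (k : 'I_(rk F' 0)) := res_aug_homog rF' k.
  exists (\row_k homog_part w (@gdeg _ _ _ F' 0 k) (@gdeg _ _ _ F 0 j) (v 0 k)).
  split=> [k|]; first by rewrite mxE; apply: homog_part_homog.
  have /(edge_map_homog_part 0 (@gdeg _ _ _ F 0 j)) :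
      edge_map (p - \sum_k v 0 k * q k) = 0.
    rewrite edge_mapB -aug_p hv edge_map_sum; apply/eqP; rewrite subr_eq0.
    by apply/eqP/eq_bigr => k _; rewrite edge_mapM (hq k).2.
  rewrite homog_partB homog_part_sum (homog_part_id hp) edge_mapB -aug_p => /eqP.
  rewrite subr_eq0 => /eqP->; rewrite edge_map_sum; apply: eq_bigr => k _.
  by rewrite (homog_partM _ _ (hq k).1) mxE edge_mapM (hq k).2.
have [u hu] := fin_all_exists aug_lift.
exists (\matrix_j u j); split=> [j k|j]; last by rewrite rowK (hu j).2.
by rewrite mxE; exact: (hu j).1.
Qed.

Lemma comparison_mapP i :
  chain_map_spec (comparison_map i.+1) /\
  comparison_map i.+1 *m bd F' i = bd F i *m comparison_map i.
Proof.
elim: i => [|i [IHh IHc]]; apply: (epsilon_spec (inhabits 0) (fun M =>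
    chain_map_spec M /\ M *m bd F' _ = bd F _ *m comparison_map _)).
  have [h0 a0] := comparison_map0P.
  apply: res_lift0 => // [|j].
    by apply: homog_mxM h0; apply: (res_bd_homog rF).
  rewrite row_mul aug_map_mul -[RHS](res_aug_bd j rF).
  by apply: eq_bigr => k _; rewrite a0.
apply: res_lift => //; first by apply: homog_mxM IHh; apply: (res_bd_homog rF).
by rewrite -mulmxA IHc mulmxA (res_bd_comp _ rF) mul0mx.
Qed.

End ChainMaps.

Section NullHomotopy.

Variable F : free_seq K G D.
Hypothesis rF : resolution w F.
Variable theta : forall i, 'M[KE]_(rk F i).
Hypothesis theta_homog : forall i,
  homog_mx w (@gdeg _ _ _ F i) (@gdeg _ _ _ F i) (theta i).
Hypothesis theta_aug : forall j, aug_map (row j (theta 0)) = 0.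
Hypothesis theta_bd : forall i, theta i.+1 *m bd F i = bd F i *m theta i.

Local Notation homotopy_spec i := (fun S : 'M[KE]_(rk F i, rk F i.+1) =>
  homog_mx w (@gdeg _ _ _ F i) (@gdeg _ _ _ F i.+1) S).

(** The uniqueness half of the comparison theorem, to be applied to the difference [theta] between a
    composite of two comparison maps and the identity. *)
Fixpoint null_homotopy i : 'M[KE]_(rk F i, rk F i.+1) :=
  match i with
  | 0%N => epsilon (inhabits 0) (fun S => homotopy_spec 0 S /\
      S *m bd F 0 = theta 0)
  | i'.+1 => epsilon (inhabits 0) (fun S => homotopy_spec i'.+1 S /\
      S *m bd F i'.+1 = theta i'.+1 - bd F i' *m null_homotopy i')
  end.

Lemma null_homotopy0P : homotopy_spec 0 (null_homotopy 0) /\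
  null_homotopy 0 *m bd F 0 = theta 0.
Proof.
apply: (epsilon_spec (inhabits 0) (fun S => homotopy_spec 0 S /\
  S *m bd F 0 = theta 0)).
exact: res_lift0.
Qed.

Lemma null_homotopyP i : homotopy_spec i.+1 (null_homotopy i.+1) /\
  null_homotopy i.+1 *m bd F i.+1 = theta i.+1 - bd F i *m null_homotopy i.
Proof.
elim: i => [|i [IHh IHc]]; apply: (epsilon_spec (inhabits 0) (fun S =>
    homotopy_spec _ S /\ S *m bd F _ = theta _ - bd F _ *m null_homotopy _)).
  have [h0 c0] := null_homotopy0P.
  apply: res_lift => //; last by rewrite mulmxBl -mulmxA c0 theta_bd subrr.
  by apply: homog_mxB => //; apply: homog_mxM h0; apply: (res_bd_homog rF).
apply: res_lift => //.
  by apply: homog_mxB => //; apply: homog_mxM IHh; apply: (res_bd_homog rF).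
by rewrite mulmxBl -mulmxA IHc mulmxBr mulmxA (res_bd_comp _ rF) mul0mx subr0
  theta_bd subrr.
Qed.

End NullHomotopy.

Local Notation c0 := (map_mx (mcoeff 0%MM)).

Lemma bd_tensor_comp (F : free_seq K G D) i : resolution w F ->
  bd_tensor F i.+1 *m bd_tensor F i = 0.
Proof. by move=> rF; rewrite /bd_tensor -mcoeff0_mx (res_bd_comp _ rF) map_mx0. Qed.

Lemma degree_part_bd (F : free_seq K G D) i h : resolution w F ->
  degree_part F i.+1 h *m bd_tensor F i = bd_tensor F i *m degree_part F i h.
Proof. by move=> rF; apply: degree_part_comm; apply: (res_bd_homog rF). Qed.

Lemma tor_boundaries_sub (F : free_seq K G D) i h : resolution w F ->
  (tor_boundaries F i h <= tor_cycles F i h)%MS.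
Proof.
move=> rF; have sd : (tor_boundaries F i h <= degree_part F i h)%MS.
  by rewrite /tor_boundaries degree_part_bd // submxMl.
case: i sd => [|i] sd //=; rewrite sub_capmx sd /=.
by apply/sub_kermxP; rewrite -mulmxA bd_tensor_comp // mulmx0.
Qed.

Lemma degree_part_idem (F : free_seq K G D) i h :
  degree_part F i h *m degree_part F i h = degree_part F i h.
Proof.
apply/matrixP => j k; rewrite mul_diag_mx !mxE.
by case: (_ == h); rewrite ?mul1r ?mul0r // mul0rn.
Qed.

Lemma degree_part_fix (F : free_seq K G D) i h m (M : 'M[K]_(m, rk F i)) :
  (M <= degree_part F i h)%MS -> M *m degree_part F i h = M.
Proof. by case/submxP => N ->; rewrite -mulmxA degree_part_idem. Qed.

Lemma tor_cycles_degree (F : free_seq K G D) i h :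
  (tor_cycles F i h <= degree_part F i h)%MS.
Proof. by case: i => [|i] //=; apply: capmxSl. Qed.

(* The comparison map induces an injection on homology, its composite with the
   comparison map in the other direction being homotopic to the identity. *)
Lemma tor_dim_le (F F' : free_seq K G D) i h : resolution w F -> resolution w F' ->
  (tor_dim F i h <= tor_dim F' i h)%N.
Proof.
move=> rF rF'.
pose f := comparison_map F F'; pose f' := comparison_map F' F.
have fh j : homog_mx w (@gdeg _ _ _ F j) (@gdeg _ _ _ F' j) (f j).
  by case: j => [|j]; [case: (comparison_map0P rF rF') | case: (comparison_mapP rF rF' j)].
have f'h j : homog_mx w (@gdeg _ _ _ F' j) (@gdeg _ _ _ F j) (f' j).
  by case: j => [|j]; [case: (comparison_map0P rF' rF) | case: (comparison_mapP rF' rF j)].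
have fc j : f j.+1 *m bd F' j = bd F j *m f j by case: (comparison_mapP rF rF' j).
have f'c j : f' j.+1 *m bd F j = bd F' j *m f' j by case: (comparison_mapP rF' rF j).
pose theta j : 'M[KE]_(rk F j) := f j *m f' j - 1%:M.
have th j : homog_mx w (@gdeg _ _ _ F j) (@gdeg _ _ _ F j) (theta j).
  by apply: homog_mxB; [apply: homog_mxM | apply: homog_mx1].
have ta j : aug_map (row j (theta 0)) = 0.
  have [_ a1] := comparison_map0P rF rF'; have [_ a2] := comparison_map0P rF' rF.
  rewrite linearB /= aug_mapB row_mul aug_map_mul; apply/eqP; rewrite subr_eq0.
  have -> : aug_map (row j (1%:M : 'M[KE]_(rk F 0))) = @aug _ _ _ F j.
    rewrite /aug_map (bigD1 j) //= !mxE eqxx edge_map1 mul1r big1 ?addr0 // => k /negPf kj.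
    by rewrite !mxE eq_sym kj edge_map0 mul0r.
  by rewrite -a1; apply/eqP/eq_bigr => k _; rewrite a2.
have tb j : theta j.+1 *m bd F j = bd F j *m theta j.
  by rewrite mulmxBl mulmxBr mul1mx mulmx1 -mulmxA f'c mulmxA fc -mulmxA.
have [S [Sh Sc]] : exists S : forall j, 'M[KE]_(rk F j, rk F j.+1),
    homog_mx w (@gdeg _ _ _ F i) (@gdeg _ _ _ F i.+1) (S i) /\
    forall v : 'rV_(rk F i), (v <= tor_cycles F i h)%MS ->
      v *m c0 (theta i) = v *m c0 (S i) *m bd_tensor F i.
  exists (null_homotopy theta); case: (i) => [|j].
    have [? e] := null_homotopy0P rF th ta; split=> // v _.
    by rewrite -e mcoeff0_mx mulmxA.
  have [? e] := null_homotopyP rF th ta tb j; split=> // v.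
  move: (null_homotopy theta j.+1) (null_homotopy theta j) e => S1 S0 e.
  rewrite /= sub_capmx => /andP[_ /sub_kermxP v0].
  have -> : theta j.+1 = S1 *m bd F j.+1 + bd F j *m S0.
    by rewrite e subrK.
  by rewrite map_mxD !mcoeff0_mx mulmxDr !mulmxA v0 mul0mx addr0.
have fZ : (tor_cycles F i h *m c0 (f i) <= tor_cycles F' i h)%MS.
  have sd : (tor_cycles F i h *m c0 (f i) <= degree_part F' i h)%MS.
    rewrite -[tor_cycles F i h](degree_part_fix (tor_cycles_degree F i h)) -mulmxA.
    by rewrite (degree_part_comm h (fh i)) mulmxA submxMl.
  case: (i) (f) fc sd => [|j] g gc sd //=; rewrite sub_capmx sd /=.
  apply/sub_kermxP; rewrite -mulmxA /bd_tensor -mcoeff0_mx gc mcoeff0_mx mulmxA.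
  have /sub_kermxP : (tor_cycles F j.+1 h <= kermx (bd_tensor F j))%MS by apply: capmxSr.
  by move->; rewrite mul0mx.
(* A cycle whose image under [f] bounds in [F'] already bounds in [F]. It is the difference of its
   images under f f' and under [theta]; the first bounds since f' is a chain map, the second by the
   homotopy. *)
have kerB : (tor_cycles F i h :&: kermx (c0 (f i) *m cokermx (tor_boundaries F' i h))
    <= tor_boundaries F i h)%MS.
  apply/rV_subP => v; rewrite sub_capmx => /andP[vZ /sub_kermxP].
  rewrite mulmxA => /eqP; rewrite -submxE => /submxP[u vf].
  have -> : v = v *m c0 (f i *m f' i) - v *m c0 (theta i).
    rewrite /theta map_mxB (map_mx1 (mcoeff 0%MM : {rmorphism KE -> K})) mulmxBr mulmx1.
    by rewrite opprB addrC subrK.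
  rewrite Sc // mcoeff0_mx mulmxA vf addmx_sub // ?eqmx_opp.
    rewrite /tor_boundaries -!mulmxA -mcoeff0_mx -f'c mcoeff0_mx.
    by rewrite (mulmxA (degree_part _ _ _)) (degree_part_comm h (f'h i.+1)) -!mulmxA mulmxA submxMl.
  rewrite -(degree_part_fix (submx_trans vZ (tor_cycles_degree F i h))).
  by rewrite -(mulmxA v) (degree_part_comm h Sh) -!mulmxA mulmxA submxMl.
(* Rank and nullity of both cycle spaces modulo the boundaries of [F']; [fZ] compares the images and
   [kerB] bounds the kernel. *)
have /esym eZ := mxrank_mul_ker (tor_cycles F i h) (c0 (f i) *m cokermx (tor_boundaries F' i h)).
have /esym eZ' := mxrank_mul_ker (tor_cycles F' i h) (cokermx (tor_boundaries F' i h)).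
have B'le : (tor_boundaries F' i h <= tor_cycles F' i h :&: kermx (cokermx (tor_boundaries F' i h)))%MS.
  by rewrite sub_capmx tor_boundaries_sub //=; apply/sub_kermxP; rewrite mulmx_coker.
have le1 := mxrankS kerB; have le2 := mxrankS B'le.
have le3 : (\rank (tor_cycles F i h *m (c0 (f i) *m cokermx (tor_boundaries F' i h))) <=
    \rank (tor_cycles F' i h *m cokermx (tor_boundaries F' i h)))%N.
  by rewrite mulmxA mxrankS // submxMr.
rewrite /tor_dim; move: le1 le2 le3 eZ eZ'; lia.
Qed.

Lemma tor_dim_resolution (F F' : free_seq K G D) i h :
  resolution w F -> resolution w F' -> tor_dim F i h = tor_dim F' i h.
Proof. by move=> rF rF'; apply/eqP; rewrite eqn_leq !tor_dim_le. Qed.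

(** The value picked by [epsilon] comes from some resolution, hence from every one. *)
Lemma bettiE (F : free_seq K G D) i h : resolution w F -> betti K G w i h = tor_dim F i h.
Proof.
move=> rF; rewrite /betti.
case: (epsilon_spec (inhabits 0%N)
  (fun n => exists F : free_seq K G D, resolution w F /\ n = tor_dim F i h)).
  by exists (tor_dim F i h), F.
by move=> F' [rF' ->]; apply: tor_dim_resolution.
Qed.

(** All differentials vanish modulo the variables, so what remains is the rank of a diagonal 0-1
    matrix, which counts the basis vectors of degree [h]. *)
Lemma tor_dim_minimal (F : free_seq K G D) i h : resolution w F ->
  (forall i j k, (bd F i j k)@_0%MM = 0) ->
  tor_dim F i h = #|[set j | @gdeg _ _ _ F i j == h]|.
Proof.
move=> rF bd0.
have T0 j : bd_tensor F j = 0 by apply/matrixP => k l; rewrite !mxE bd0.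
rewrite /tor_dim /tor_boundaries T0 mulmx0 mxrank0 subn0.
have -> : \rank (tor_cycles F i h) = \rank (degree_part F i h).
  case: i => [|i] //=; apply/eqP; rewrite eqn_leq !mxrankS ?capmxSl //.
  by rewrite sub_capmx submx_refl; apply/sub_kermxP; rewrite T0 mulmx0.
rewrite /degree_part; set S := [set j | _]; set A := diag_mx _.
(* [B] is the inclusion of the coordinates in [S]; the rank follows from B B^T = 1 and A = B^T B. *)
pose B : 'M[K]_(#|S|, rk F i) := \matrix_(k, j) (enum_val k == j)%:R.
have BB : B *m B^T = 1%:M.
  apply/matrixP => k l; rewrite !mxE (bigD1 (enum_val k)) //= !mxE eqxx mul1r.
  rewrite (inj_eq enum_val_inj) eq_sym big1 ?addr0 // => j /negPf jk.
  by rewrite !mxE eq_sym jk mul0r.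
have AB : A = B^T *m B.
  apply/matrixP => j l; rewrite !mxE; have [jS|jS] := boolP (gdeg j == h).
    have jS' : j \in S by rewrite inE.
    rewrite (bigD1 (enum_rank_in jS' j)) //= !mxE enum_rankK_in // eqxx mul1r.
    rewrite big1 ?addr0 // => k; rewrite !mxE => nk.
    case: eqP => [kj|_]; last by rewrite mul0r.
    by case/eqP: nk; apply: enum_val_inj; rewrite enum_rankK_in.
  rewrite mul0rn big1 // => k _; rewrite !mxE; case: eqP => [kj|_]; last by rewrite mul0r.
  by have := enum_valP k; rewrite kj inE (negPf jS).
apply/eqP; rewrite eqn_leq; apply/andP; split.
  by rewrite AB; apply: leq_trans (mxrankM_maxl _ _) (rank_leq_col _).
have -> : #|S| = \rank (B *m A *m B^T) by rewrite AB mulmxA BB mul1mx BB mxrank1.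
by apply: leq_trans (mxrankM_maxl _ _) (mxrankM_maxr _ _).
Qed.

End Comparison.

(** * Exactness from leading terms *)

Section LeadingTerms.

Variables (K : fieldType) (n p q : nat) (M : 'M[{mpoly K[n]}]_(p, q)).
Variables (rho : 'I_q -> 'X_{1..n} -> nat).
Variables (lead : 'I_p -> 'X_{1..n} -> 'I_q -> 'X_{1..n} -> Prop).

(* [lead j m k m'] means that ['X_[m'] *: delta_mx 0 k] is the leading term, up to
   a scalar, of ['X_[m] *: row j M]; terms are compared by [rho]. *)
Hypothesis lead_coeff : forall j m k m', lead j m k m' -> ('X_[m] * M j k)@_m' != 0.

Hypothesis lead_max : forall j m k m', lead j m k m' ->
  forall l m'', ('X_[m] * M j l)@_m'' != 0 ->
  (l, m'') = (k, m') \/ (rho l m'' < rho k m')%N.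

Definition supported r (V : 'I_r -> 'X_{1..n} -> bool) (v : 'rV[{mpoly K[n]}]_r) :=
  forall k m, (v 0 k)@_m != 0 -> V k m.

(** Division with remainder: a term outside [V] is the leading term of a monomial multiple of some
    row, and subtracting a scalar times this multiple leaves only terms of smaller [rho]. *)
Lemma reduce_nonleading (V : 'I_q -> 'X_{1..n} -> bool) :
  (forall k m, ~~ V k m -> exists j m', lead j m' k m) ->
  forall v : 'rV_q, exists u, supported V (v - u *m M).
Proof.
move=> leadV; pose red (v : 'rV[{mpoly K[n]}]_q) := exists u, supported V (v - u *m M).
have redD v v' : red v -> red v' -> red (v + v').
  move=> [u hu] [u' hu']; exists (u + u') => k m.
  rewrite mulmxDl opprD addrACA mxE mcoeffD.
  have [h|/negbNE/eqP->] := boolP (((v - u *m M) 0 k)@_m != 0).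
    by move=> _; apply: hu h.
  by rewrite add0r; apply: hu'.
have red0 : red 0 by exists 0 => k m; rewrite mul0mx subr0 mxE mcoeff0 eqxx.
have redZ c v : red v -> red (c%:MP *: v).
  move=> [u hu]; exists (c%:MP *: u) => k m.
  rewrite -scalemxAl -scalerBr mxE mcoeffCM mulf_eq0 negb_or => /andP[_].
  exact: hu.
have redS I (s : seq I) (P : pred I) (F : I -> 'rV_q) :
    (forall i, P i -> red (F i)) -> red (\sum_(i <- s | P i) F i).
  by move=> h; elim/big_ind: _.
have red_terms (v : 'rV[{mpoly K[n]}]_q) :
    (forall k m, (v 0 k)@_m != 0 -> red ('X_[m] *: delta_mx 0 k)) -> red v.
  move=> h; rewrite [v]row_sum_delta; apply: (redS) => k _.
  rewrite [v 0 k]mpolyE scaler_suml big_seq; apply: redS => m.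
  rewrite mcoeff_msupp => /h hm.
  by rewrite -mul_mpolyC -scalerA; apply: redZ.
suff redX : forall N k m, (rho k m < N)%N -> red ('X_[m] *: delta_mx 0 k).
  by move=> v; apply: red_terms => k m _; apply: redX (ltnSn _).
elim=> // N IH k m; rewrite ltnS => leN.
have [Vkm|/leadV[j [m' ld]]] := boolP (V k m).
  exists 0 => k' m''; rewrite mul0mx subr0 !mxE eqxx /=.
  case: (k' =P k) => [->|_]; last by rewrite mulr0 mcoeff0 eqxx.
  by rewrite mulr1 mcoeffX; case: (m =P m'') => [<-|_] //; rewrite eqxx.
pose c := ('X_[m'] * M j k)@_m; pose z := 'X_[m'] *: row j M.
have redz : red z.
  exists ('X_[m'] *: delta_mx 0 j) => k' m''.
  by rewrite -scalemxAl -rowE subrr mxE mcoeff0 eqxx.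
have c0 : c != 0 := lead_coeff ld.
have redr : red (z - c%:MP *: ('X_[m] *: delta_mx 0 k)).
  apply: red_terms => l m'' nz; apply: IH; apply: leq_trans leN.
  move: nz; rewrite !mxE eqxx /= mcoeffB mcoeffCM => nz.
  have [zl|zl] := eqVneq (('X_[m'] * M j l)@_m'') 0.
    move: nz; rewrite zl sub0r oppr_eq0; case: (l =P k) => [lk|_]; last first.
      by rewrite mulr0 mcoeff0 mulr0 eqxx.
    rewrite mulr1 mcoeffX; case: (m =P m'') => [mm|_]; last by rewrite mulr0 eqxx.
    by rewrite -mm lk in zl; rewrite /c zl mul0r eqxx.
  have [[lk mm]|//] := lead_max ld zl.
  by move: nz; rewrite lk mm eqxx mulr1 mcoeffX eqxx mulr1 subrr eqxx.
(* The multiple [z] is reduced to 0 by itself and its lower terms are reduced by induction; the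
   leading term is the difference. *)
have := redD _ _ redz (redZ (-1) _ redr).
have -> : z + (-1)%:MP *: (z - c%:MP *: ('X_[m] *: delta_mx 0 k)) =
    c%:MP *: ('X_[m] *: delta_mx 0 k).
  by rewrite mpolyCN mpolyC1 scaleN1r opprB addrC subrK.
move/(redZ c^-1).
by rewrite [X in red X]scalerA -mpolyCM (mulVf c0) mpolyC1 scale1r.
Qed.

Lemma lead_unique j m k m' k1 m1 : lead j m k m' -> lead j m k1 m1 -> (k, m') = (k1, m1).
Proof.
move=> ld ld1; case: (lead_max ld (lead_coeff ld1)) => // lt1.
by case: (lead_max ld1 (lead_coeff ld)) => // lt2; move: (ltn_trans lt1 lt2); rewrite ltnn.
Qed.

Lemma exists_max_lead (s : seq ('I_p * 'X_{1..n})) : (0 < size s)%N ->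
  (forall x, x \in s -> exists k m', lead x.1 x.2 k m') ->
  exists2 x, x \in s & exists k m', lead x.1 x.2 k m' /\
    forall y, y \in s -> forall l m'', lead y.1 y.2 l m'' -> (rho l m'' <= rho k m')%N.
Proof.
elim: s => // x [|x' s] IH _ ldS.
  have [k [m' ld]] := ldS x (mem_head _ _); exists x; rewrite ?mem_head //.
  exists k, m'; split=> // y; rewrite inE => /eqP-> l m'' /(lead_unique ld).
  by case=> <- <-.
have [y ys] := ldS x (mem_head _ _).
have ldS' z (zs : z \in x' :: s) : exists k m', lead z.1 z.2 k m'.
  by apply: ldS; rewrite inE zs orbT.
have [z zs [k [m' [ld mx]]]] := IH isT ldS'.
case: ys => m1 ldx; have [le|lt] := leqP (rho y m1) (rho k m').
  exists z; first by rewrite in_cons zs orbT.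
  exists k, m'; split=> // a.
  rewrite in_cons => /orP[/eqP->|]; last exact: mx.
  by move=> l m'' /(lead_unique ldx)[<- <-].
exists x; rewrite ?mem_head //; exists y, m1; split=> // a.
rewrite in_cons => /orP[/eqP->|/mx h]; first by move=> l m'' /(lead_unique ldx)[<- <-].
by move=> l m'' /h/leq_trans; apply; apply: ltnW.
Qed.

(** A maximal leading term among the terms of [v] cannot cancel: any other contribution at its place
    comes from a term with the same leading term, excluded by injectivity, or with a larger one,
    excluded by maximality. Equal values of [rho] at different places do no harm. *)
Lemma nonleading_injective (V : 'I_p -> 'X_{1..n} -> bool) :
  (forall j m, V j m -> exists k m', lead j m k m') ->
  (forall j m j1 m1 k m', V j m -> V j1 m1 -> lead j m k m' -> lead j1 m1 k m' ->
    (j, m) = (j1, m1)) ->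
  forall v : 'rV_p, supported V v -> v *m M = 0 -> v = 0.
Proof.
move=> leadV lead_inj v Vv vM0.
pose s := [seq (j, m) | j <- enum 'I_p, m <- msupp (v 0 j)].
have sP x : x \in s -> exists k m', lead x.1 x.2 k m'.
  case/allpairsPdep => j [m [_ mv ->]]; apply: leadV; apply: Vv.
  by rewrite -mcoeff_msupp.
have sV x : x \in s -> V x.1 x.2.
  case/allpairsPdep => j [m [_ mv ->]]; apply: Vv.
  by rewrite -mcoeff_msupp.
have inS j m : ((v 0 j)@_m != 0) = ((j, m) \in s).
  apply/idP/allpairsPdep => [|[j' [m' [_ mv [-> ->]]]]].
    by rewrite -mcoeff_msupp => mv; exists j, m; rewrite mem_enum.
  by rewrite -mcoeff_msupp.
have [s0|s_gt0] := posnP (size s).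
  apply/rowP => j; rewrite mxE; apply/mpolyP => m; rewrite mcoeff0.
  by apply/eqP/negbNE; rewrite inS (size0nil s0).
have [x xs [k [m' [ld mx]]]] := exists_max_lead s_gt0 sP.
have E j : (v 0 j * M j k)@_m' =
    \sum_(m <- msupp (v 0 j)) (v 0 j)@_m * ('X_[m] * M j k)@_m'.
  rewrite {1}[v 0 j]mpolyE mulr_suml mcoeff_sum; apply: eq_bigr => m _.
  by rewrite -scalerAl mcoeffZ.
have only y : y \in s -> y <> x -> ('X_[y.2] * M y.1 k)@_m' = 0.
  move=> ys yx; apply/eqP/negbNE/negP => nz.
  have [l [m'' ldy]] := sP y ys.
  have [[kl mm]|lt] := lead_max ldy nz; last by have := mx y ys l m'' ldy; rewrite leqNgt lt.
  rewrite -kl -mm in ldy; apply: yx.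
  by have := lead_inj _ _ _ _ _ _ (sV y ys) (sV x xs) ldy ld; rewrite -!surjective_pairing.
have := congr1 (fun z : 'rV_q => (z 0 k)@_m') vM0.
rewrite /= !mxE mcoeff0 mcoeff_sum => /eqP; rewrite (bigD1 x.1) //= [X in _ + X]big1.
  rewrite addr0 E (bigD1_seq x.2) ?msupp_uniq //=; last first.
    by rewrite mcoeff_msupp inS -surjective_pairing.
  rewrite big_seq_cond big1 ?addr0; last first.
    move=> m /andP[mv mx2]; rewrite (only (x.1, m)) ?mulr0 //.
      by rewrite -inS -mcoeff_msupp.
    by move=> xm; rewrite -xm eqxx in mx2.
  rewrite mulf_eq0 (negPf (lead_coeff ld)) orbF => nz.
  by have := xs; rewrite [x]surjective_pairing -inS nz.
move=> j jx; rewrite E big_seq big1 // => m mv.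
rewrite (only (j, m)) ?mulr0 //; first by rewrite -inS -mcoeff_msupp.
by move=> xm; rewrite -xm eqxx in jx.
Qed.

End LeadingTerms.

(** * The scroll complex *)

Section Positions.

Variable t : nat.
Implicit Types (T : {set 'I_t}) (j k l : 'I_t).

Definition pos T k : nat := #|[set j in T | (j < k)%N]|.

Lemma posD1 T k j : k \in T ->
  pos (T :\ k) j = (pos T j - (k < j))%N.
Proof.
move=> kT; rewrite /pos; have [kj|jk] := ltnP k j.
  rewrite [in RHS](cardsD1 k) inE kT kj /= add1n subn1 /=.
  by apply: eq_card => l; rewrite !inE andbA.
rewrite subn0; apply: eq_card => l; rewrite !inE.
by have [->|] := eqVneq l k; rewrite ?ltnNge ?jk ?andbF.
Qed.

Lemma pos_ltn T j k : j \in T -> (j < k)%N -> (pos T j < pos T k)%N.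
Proof.
move=> jT jk; apply: proper_card; rewrite properE; apply/andP; split.
  apply/subsetP => l; rewrite !inE => /andP[-> /=] lj; exact: ltn_trans lj jk.
by apply/subsetPn; exists j; rewrite !inE jT ?jk ?ltnn.
Qed.

Lemma pos_lt T k : k \in T -> (pos T k < #|T|)%N.
Proof.
move=> kT; apply: proper_card; rewrite properE; apply/andP; split.
  by apply/subsetP => l; rewrite !inE => /andP[].
by apply/subsetPn; exists k; rewrite ?inE // ltnn andbF.
Qed.

Lemma pos_inj T : {in T &, injective (pos T)}.
Proof.
move=> j k jT kT e; apply: val_inj; case: (ltngtP (val j) (val k)) => // h.
  by have := pos_ltn jT h; rewrite e ltnn.
by have := pos_ltn kT h; rewrite e ltnn.
Qed.

Lemma pos_surj T a : (a < #|T|)%N -> exists2 k, k \in T & pos T k = a.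
Proof.
move=> aT; pose f (k : 'I_t) := inord (pos T k) : 'I_#|T|.-1.+1.
have card_pred : #|T|.-1.+1 = #|T| by rewrite prednK // (leq_ltn_trans _ aT).
have f_inj : {in T &, injective f}.
  move=> j k jT kT /(congr1 val); rewrite /= !inordK ?card_pred ?pos_lt // => e.
  exact: (pos_inj jT kT).
have : f @: T = setT.
  by apply/eqP; rewrite eqEcard subsetT cardsT card_ord (card_in_imset f_inj) card_pred leqnn.
move/setP/(_ (inord a)); rewrite inE => /imsetP[k kT /(congr1 val)].
by rewrite /= !inordK ?card_pred ?pos_lt // => e; exists k.
Qed.

Lemma pos_min T k : k \in T -> (forall j, j \in T -> (k <= j)%N) -> pos T k = 0%N.
Proof.
move=> kT kmin; apply/eqP; rewrite cards_eq0; apply/eqP/setP => j; rewrite !inE.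
by apply/negbTE/negP => /andP[/kmin]; rewrite leqNgt => /negPf->.
Qed.

Lemma pos_max T k : k \in T -> (forall j, j \in T -> (j <= k)%N) -> pos T k = #|T|.-1.
Proof.
move=> kT kmax; rewrite (cardsD1 k) kT /=; apply: eq_card => j; rewrite !inE.
have [->|jk] := eqVneq j k; first by rewrite ltnn andbF.
by case jT: (j \in T); rewrite ?andbF //= ltn_neqAle kmax // andbT.
Qed.

Lemma pos_le T j k : j \in T -> (j <= k)%N -> (pos T j <= pos T k)%N.
Proof.
move=> jT; rewrite leq_eqVlt => /orP[/eqP/val_inj-> //|jk].
exact/ltnW/pos_ltn.
Qed.

Lemma upper_pivot T a k : k \in T -> (0 < a <= pos T k)%N ->
  exists j, [/\ j \in T, (j < k)%N & pos T j = a.-1].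
Proof.
move=> kT /andP[a0 ak]; have [|j jT ja] := @pos_surj T a.-1.
  by have := pos_lt kT; lia.
exists j; split=> //; rewrite ltnNge; apply/negP => /(pos_le kT).
by rewrite ja; lia.
Qed.

Lemma lower_pivot T a k : k \in T -> (pos T k < a < #|T|)%N ->
  exists j, [/\ j \in T, (k < j)%N & pos T j = a].
Proof.
move=> kT /andP[ka aT]; have [j jT ja] := pos_surj aT.
exists j; split=> //; rewrite ltnNge; apply/negP => /(pos_le jT).
by rewrite ja; lia.
Qed.

Section Select.

Variables (R : Type) (idx : R) (op : Monoid.com_law idx) (F : bool -> 'I_t -> R).

(** Lead monomials and weights are both of this shape; keeping [op] abstract lets the same deletion
    rules serve both. *)
Definition select T a := \big[op/idx]_(k in T) F (pos T k < a)%N k.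

Lemma select_lower T a k : k \in T -> (pos T k < a)%N ->
  select T a = op (F true k) (select (T :\ k) a.-1).
Proof.
move=> kT ka; rewrite /select (bigD1 k) //= ka; congr (op _ _).
apply: eq_big => j; first by rewrite !inE andbC.
move=> /andP[jT jk]; congr (F _ _); rewrite posD1 //.
have [kj|jk'] := ltnP k j; first by have := pos_ltn kT kj; lia.
have ltjk : (j < k)%N by rewrite ltn_neqAle jk'  -val_eqE in jk *; rewrite jk.
by have := pos_ltn jT ltjk; lia.
Qed.

Lemma select_upper T a k : k \in T -> (a <= pos T k)%N ->
  select T a = op (F false k) (select (T :\ k) a).
Proof.
move=> kT ka; rewrite /select (bigD1 k) //= ltnNge ka; congr (op _ _).
apply: eq_big => j; first by rewrite !inE andbC.
move=> /andP[jT jk]; congr (F _ _); rewrite posD1 //.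
have [kj|jk'] := ltnP k j; first by have := pos_ltn kT kj; lia.
by rewrite subn0.
Qed.

(* Deleting [k] beyond the first [a] columns moves the last of these columns,
   [j], out of them. *)
Lemma select_del_upper T a k j : k \in T -> j \in T -> (0 < a <= pos T k)%N ->
    (j < k)%N -> pos T j = a.-1 -> exists c,
  select T a = op (op c (F true j)) (F false k) /\
  select (T :\ k) a.-1 = op c (F false j).
Proof.
move=> kT jT /andP[a0 ak] jk ja; exists (select (T :\ j :\ k) a.-1); split.
  rewrite (@select_lower T a j) //; last by lia.
  rewrite (@select_upper (T :\ j) a.-1 k); first last.
  - by rewrite posD1 // jk; lia.
  - by rewrite !inE kT andbT; apply: contraTneq jk => ->; rewrite ltnn.
  by rewrite [RHS]Monoid.mulmAC /= [RHS]Monoid.mulmC /= [op (F false k) _]Monoid.mulmC.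
have nkj : (k < j)%N = false by rewrite ltnNge ltnW.
rewrite (@select_upper (T :\ k) a.-1 j); first last.
- by rewrite posD1 // nkj; lia.
- by rewrite !inE jT andbT; apply: contraTneq jk => ->; rewrite ltnn.
rewrite Monoid.mulmC /=; congr (op (select _ _) _).
by rewrite !setDDl setUC.
Qed.

(** The mirror case: deleting [k] among the first [a] columns, with [a] unchanged, moves the first
    of the other columns, [j], in among them. *)
Lemma select_del_lower T a k j : k \in T -> j \in T -> (pos T k < a < #|T|)%N ->
    (k < j)%N -> pos T j = a -> exists c,
  select T a = op (op c (F true k)) (F false j) /\
  select (T :\ k) a = op c (F true j).
Proof.
move=> kT jT /andP[ak aT] kj ja.
have jTk : j \in T :\ k.
  by rewrite !inE jT andbT; apply: contraTneq kj => ->; rewrite ltnn.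
exists (select (T :\ k :\ j) a.-1); split.
  rewrite (@select_lower T a k) // (@select_upper (T :\ k) a.-1 j) //; last first.
    by rewrite posD1 // kj; lia.
  by rewrite [RHS]Monoid.mulmAC /= [RHS]Monoid.mulmC /= [op (F false j) _]Monoid.mulmC.
rewrite (@select_lower (T :\ k) a j) //; last by rewrite posD1 // kj; lia.
by rewrite Monoid.mulmC.
Qed.

End Select.

End Positions.

(** The swap of k and l matches the terms with k < l with those with k > l. Comparing the sum with
    its own negative would not suffice in characteristic 2. *)
Lemma sum_antisym (V : zmodType) (t : nat) (T : {set 'I_t}) (P : rel 'I_t)
    (g : 'I_t -> 'I_t -> V) :
  (forall k l, P k l = P l k) ->
  (forall k l, k \in T -> l \in T -> k != l -> P k l -> g k l = - g l k) ->
  \sum_(k in T) \sum_(l in T :\ k | P k l) g k l = 0.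
Proof.
move=> Psym gas; rewrite pair_big_dep /=.
rewrite (bigID (fun p : 'I_t * 'I_t => (p.1 < p.2)%N)) /=.
rewrite [X in _ + X](reindex_inj (h := fun p : 'I_t * 'I_t => (p.2, p.1))); last first.
  by move=> [a b] [c d] [-> ->].
rewrite -[X in X + _]opprK -sumrN addrC; apply/eqP; rewrite subr_eq0; apply/eqP.
apply: eq_big => [[k l]|[k l]] /=.
  rewrite !inE Psym -!val_eqE -leqNgt; case: ltngtP => // h;
    by rewrite /= ?andbF ?andbT //; do !case: (_ \in _).
by rewrite !inE => /andP[/and3P[lT /andP[kl kT] Plk] _]; rewrite gas // eq_sym.
Qed.

Section ScrollComplex.

Variables (K : fieldType) (n t : nat) (C : {set 'I_t}).
Variables (kappa : 'I_n -> option ('I_t * bool)) (v : 'I_t -> nat).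
Hypothesis v_mono : forall k l : 'I_t, (k < l)%N -> (v k <= v l)%N.

Local Notation KE := {mpoly K[n]}.
Implicit Types (T : {set 'I_t}) (j k l : 'I_t) (a : nat).

Definition colm (b : bool) k : 'X_{1..n} := [multinom (kappa i == Some (k, b) : nat) | i < n].
Local Notation xm := (colm true).
Local Notation ym := (colm false).
Definition em : 'X_{1..n} := [multinom (kappa i == None : nat) | i < n].

Definition lead_monomial (T : {set 'I_t}) a : 'X_{1..n} := select mnm_add colm T a.

(** The exponent of e in the product of the matrix entries e^(v k) X_k, for the first [a] columns of
    [T], and Y_k, for the others. Dividing the Eagon-Northcott basis vector by this power of e
    leaves a basis vector with the degree of [lead_monomial]. *)
Definition weight (T : {set 'I_t}) a : nat :=
  select addn (fun b k => if b then v k else 0%N) T a.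

Lemma weight_lower T a k : k \in T -> (pos T k < a)%N ->
  weight T a = (v k + weight (T :\ k) a.-1)%N.
Proof. exact: select_lower. Qed.

Lemma weight_upper T a k : k \in T -> (a <= pos T k)%N ->
  weight T a = weight (T :\ k) a.
Proof. exact: select_upper. Qed.

Lemma weightX_upper T a k j : k \in T -> j \in T -> (0 < a <= pos T k)%N ->
  (j < k)%N -> pos T j = a.-1 -> weight T a = (v j + weight (T :\ k) a.-1)%N.
Proof.
move=> kT jT ak jk ja; have [c [E1 E2]] := select_del_upper addn
  (fun b k => if b then v k else 0%N) kT jT ak jk ja.
by rewrite /weight E1 E2 /= !addn0 addnC.
Qed.

Lemma weightY_lower T a k j : k \in T -> j \in T -> (pos T k < a < #|T|)%N ->
  (k < j)%N -> pos T j = a -> (weight T a + v j = weight (T :\ k) a + v k)%N.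
Proof.
move=> kT jT ak jk ja; have [c [E1 E2]] := select_del_lower addn
  (fun b k => if b then v k else 0%N) kT jT ak jk ja.
by rewrite /weight E1 E2 /= addn0 addnAC.
Qed.

(** Together with [weightY_le] this makes the truncated subtractions in [xcoef] and [ycoef] exact.
    If [k] is not among the first [a] columns, its deletion pushes out an earlier column, whose [v]
    is at most [v k]: here the sorting of the columns is used. *)
Lemma weightX_le T a k : k \in T -> (0 < a)%N ->
  (weight T a <= v k + weight (T :\ k) a.-1)%N.
Proof.
move=> kT a0; have [ak|ka] := leqP a (pos T k); last by rewrite (weight_lower kT).
have [|j [jT jk ja]] := upper_pivot (a := a) kT; first by rewrite a0.
by rewrite (weightX_upper kT jT) ?a0 // leq_add2r v_mono.
Qed.

Lemma weightY_le T a k : k \in T -> (a < #|T|)%N -> (weight T a <= weight (T :\ k) a)%N.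
Proof.
move=> kT aT; have [ak|ka] := leqP a (pos T k); first by rewrite (weight_upper kT).
have [|j [jT kj ja]] := lower_pivot (a := a) kT; first by rewrite ka.
have := weightY_lower (a := a) kT jT; rewrite ka aT => /(_ isT kj ja).
by have := v_mono kj; lia.
Qed.

(** The entries e^(v k) X_k and Y_k of the matrix, multiplied by the power of e that passes from the
    weight of the source to that of the target. *)
Definition xcoef (T : {set 'I_t}) k a := (xm k + em *+ (v k + weight (T :\ k) a.-1 - weight T a))%MM.
Definition ycoef (T : {set 'I_t}) k a := (ym k + em *+ (weight (T :\ k) a - weight T a))%MM.

Lemma xcoef_lower T a k : k \in T -> (pos T k < a)%N -> xcoef T k a = xm k.
Proof. by move=> kT ka; rewrite /xcoef (weight_lower kT ka) subnn mulm0n addm0. Qed.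

Lemma ycoef_upper T a k : k \in T -> (a <= pos T k)%N -> ycoef T k a = ym k.
Proof. by move=> kT ka; rewrite /ycoef (weight_upper kT ka) subnn mulm0n addm0. Qed.

Section Degrees.

Variables (D : nmodType) (deg : 'X_{1..n} -> D).
Hypothesis degD : forall m m', deg (m + m')%MM = deg m + deg m'.
Hypothesis deg_minor : forall k l, k \in C -> l \in C -> (k < l)%N ->
  deg (xm k) + deg (ym l) = deg (xm l) + deg (ym k) + deg (em *+ (v l - v k))%MM.

(** If [k] is among the first [a] columns, this is a factorisation of the lead monomial. Otherwise
    the deletion also changes the colour of the pivot [j], which [deg_minor] for j < k compensates
    by a power of e. *)
Lemma deg_xcoef T k a : T \subset C -> k \in T -> (0 < a)%N ->
  deg (lead_monomial T a) = deg (xcoef T k a) + deg (lead_monomial (T :\ k) a.-1).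
Proof.
move=> TC kT a0; have [ak|ka] := leqP a (pos T k); last first.
  by rewrite xcoef_lower // /lead_monomial (select_lower _ _ kT) // degD.
have a0k : (0 < a <= pos T k)%N by rewrite a0.
have [j [jT jk ja]] := upper_pivot kT a0k.
have [c [E1 E2]] := select_del_upper mnm_add colm kT jT a0k jk ja.
rewrite /lead_monomial E1 E2 /xcoef (weightX_upper kT jT a0k jk ja) subnDr !degD.
by rewrite -addrA deg_minor ?(subsetP TC) // (addrAC (deg (xm k))) addrCA.
Qed.

Lemma deg_ycoef T k a : T \subset C -> k \in T -> (a < #|T|)%N ->
  deg (lead_monomial T a) = deg (ycoef T k a) + deg (lead_monomial (T :\ k) a).
Proof.
move=> TC kT aT; have [ak|ka] := leqP a (pos T k).
  by rewrite ycoef_upper // /lead_monomial (select_upper _ _ kT) // degD.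
have ka' : (pos T k < a < #|T|)%N by rewrite ka.
have [j [jT kj ja]] := lower_pivot kT ka'.
have [c [E1 E2]] := select_del_lower mnm_add colm kT jT ka' kj ja.
have W := weightY_lower kT jT ka' kj ja.
rewrite /lead_monomial E1 E2 /ycoef (_ : (_ - _ = v j - v k)%N); last by lia.
by rewrite !degD -addrA deg_minor ?(subsetP TC) // (addrC (deg (xm j)))
  (addrAC (deg (ym k))) addrCA.
Qed.

End Degrees.

(* The pair (T, a) stands for the basis vector of the Eagon-Northcott complex given
   by the columns in T and the monomial of index a in the divided power of degree
   #|T| - 2; [scroll_valid] imposes 0 < a < #|T|, and (set0, 0) is the generator of
   the term of rank one. *)
Definition scroll_index := ({set 'I_t} * 'I_t.+1)%type.

Definition scroll_valid (i : nat) (b : scroll_index) : bool :=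
  if i is i'.+1 then [&& b.1 \subset C, #|b.1| == i'.+2 & (0 < b.2 <= i'.+1)%N]
  else b == (set0, ord0).

Definition scroll_basis i : {set scroll_index} := [set b | scroll_valid i b].

Definition sgn T k : K := (-1) ^+ pos T k.

(** For T = {k < l} this is Y_k X_l e^(v l - v k) - X_k Y_l: up to sign, the 2 x 2 minor of the
    columns k and l divided by e^(v k). The expansion along the row of the Y_k parallels the other
    differentials. *)
Definition minor T : KE :=
  \sum_(k in T) sgn T k *: 'X_[(ycoef T k 1 + \sum_(j in T :\ k) xm j)%MM].

(** Deleting a column lowers the index by 1 with X_k and keeps it with Y_k. The lowered index is
    absent from the target basis if a = 1, the kept one if a = #|T| - 1, as for multiplication on
    divided powers. *)
Definition scroll_coef i (b b' : scroll_index) : KE :=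
  if i is i'.+1 then
    \sum_(k in b.1 | b'.1 == b.1 :\ k) sgn b.1 k *:
      ((b.2 == b'.2.+1 :> nat)%:R *: 'X_[xcoef b.1 k b.2] +
       (b.2 == b'.2 :> nat)%:R *: 'X_[ycoef b.1 k b.2])
  else minor b.1.

Lemma sgn_anti T k l : k \in T -> l \in T -> k != l ->
  sgn T k * sgn (T :\ k) l = - (sgn T l * sgn (T :\ l) k).
Proof.
suff lt_anti k1 l1 : k1 \in T -> l1 \in T -> (k1 < l1)%N ->
    sgn T k1 * sgn (T :\ k1) l1 = - (sgn T l1 * sgn (T :\ l1) k1).
  move=> kT lT; rewrite -val_eqE neq_ltn => /orP[|] h; first exact: lt_anti.
  by rewrite (lt_anti l k) // opprK.
move=> kT lT kl; rewrite /sgn !posD1 // kl ltnNge (ltnW kl) subn0 subn1.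
have := pos_ltn kT kl; case: (pos T l1) => // p _.
by rewrite exprS mulN1r mulNr opprK mulrC.
Qed.

Local Notation E j := ('X_[(em *+ j)%MM] : KE).
Local Notation x k := ('X_[(xm k + em *+ v k)%MM] : KE).
Local Notation y k := ('X_[ym k] : KE).

Lemma weight_xcoef T k a : k \in T -> (0 < a)%N ->
  E (weight T a) * 'X_[xcoef T k a] = x k * E (weight (T :\ k) a.-1).
Proof.
move=> kT a0; rewrite -!mpolyXD; congr mpolyX; apply/mnmP => i.
rewrite !(mnmDE, mulmnE) mulnBr mulnDr.
by have := leq_mul (leqnn (em i)) (weightX_le kT a0); rewrite mulnDr; lia.
Qed.

Lemma weight_ycoef T k a : k \in T -> (a < #|T|)%N ->
  E (weight T a) * 'X_[ycoef T k a] = y k * E (weight (T :\ k) a).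
Proof.
move=> kT a0; rewrite -!mpolyXD; congr mpolyX; apply/mnmP => i.
rewrite !(mnmDE, mulmnE) mulnBr.
by have := leq_mul (leqnn (em i)) (weightY_le kT a0); lia.
Qed.

(* Rescaling the basis by powers of the monomial [em] turns the differential into
   that of the Eagon-Northcott complex of the matrix with rows [x] and [y]. *)
Definition rescaled_coef i T a (b' : scroll_index) : KE :=
  if i is i'.+1 then
    \sum_(k in T | b'.1 == T :\ k) sgn T k *:
      ((a == b'.2.+1)%:R *: x k + (a == b'.2)%:R *: y k)
  else \sum_(k in T) sgn T k *: (y k * \prod_(j in T :\ k) x j).

Lemma rescale_coef i b b' : b \in scroll_basis i.+1 -> b' \in scroll_basis i ->
  E (weight b.1 b.2) * scroll_coef i b b' =
  rescaled_coef i b.1 b.2 b' * E (weight b'.1 b'.2).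
Proof.
case: b b' => [T a] [U c]; rewrite !inE /=.
case: i => [|i] /= /and3P[TC /eqP cT /andP[a0 aT]].
  move=> /eqP[-> ->]; have -> : nat_of_ord a = 1%N by lia.
  rewrite {2}/weight /select big_set0 mulm0n mpolyX0 mulr1 mulr_sumr.
  apply: eq_bigr => k kT; rewrite -scalerAr; congr (_ *: _).
  rewrite mpolyXD mulrA weight_ycoef ?cT // -mulrA; congr (_ * _).
  have : #|T :\ k| = 1%N by have := cardsD1 k T; rewrite kT cT; lia.
  case/eqP/cards1P => j ->; rewrite !big_set1 /weight /select big_set1.
  rewrite (_ : pos _ _ = 0%N); last first.
    by apply: pos_min; rewrite ?inE // => l; rewrite inE => /eqP->.
  by rewrite -mpolyXD addmC.
case/and3P => UC /eqP cU /andP[c0 cU'].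
rewrite mulr_sumr mulr_suml; apply: eq_bigr => k /andP[kT /eqP->].
rewrite -scalerAr -scalerAl; congr (_ *: _); rewrite mulrDr mulrDl -!scalerAr -!scalerAl.
congr (_ + _).
  by have [ac|_] := eqVneq; rewrite ?scale0r // weight_xcoef // ac.
have [ac|_] := eqVneq; rewrite ?scale0r // weight_ycoef // ?ac //.
by rewrite cT; lia.
Qed.

(** Only c = a - 1 and c = a contribute; the scalars on the right record whether these indices occur
    in the target basis. *)
Lemma sum_scroll_ord i (a : nat) (h h' : nat -> KE) : (0 < a <= i.+2)%N -> (i.+1 <= t)%N ->
  \sum_(c < t.+1 | (0 < c <= i.+1)%N) ((a == c.+1)%:R *: h c + (a == c)%:R *: h' c) =
  (1 < a)%:R *: h a.-1 + (a < i.+2)%:R *: h' a.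
Proof.
move=> /andP[a0 ai] it; rewrite big_split /=; congr (_ + _).
  have [a1|a1] := ltnP 1 a; last first.
    rewrite scale0r big1 // => c /andP[c0 _].
    by rewrite (_ : (a == c.+1) = false) ?scale0r //; apply/eqP; lia.
  have lt : (a.-1 < t.+1)%N by lia.
  rewrite (bigD1 (Ordinal lt)) /=; last by lia.
  rewrite (_ : a == _) ?big1 ?addr0 //; last by apply/eqP; lia.
  move=> c /andP[_ nc]; rewrite (_ : (a == c.+1) = false) ?scale0r //.
  by apply/negbTE; apply: contraNneq nc => ac; apply/eqP/val_inj => /=; lia.
have [a1|a1] := ltnP a i.+2; last first.
  rewrite scale0r big1 // => c /andP[_ ci].
  by rewrite (_ : (a == c) = false) ?scale0r //; apply/eqP; lia.
have lt : (a < t.+1)%N by lia.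
rewrite (bigD1 (Ordinal lt)) /=; last by lia.
rewrite eqxx big1 ?addr0 // => c /andP[_ nc].
rewrite (_ : (a == c) = false) ?scale0r //.
by apply/negbTE; apply: contraNneq nc => ac; apply/eqP/val_inj.
Qed.

Lemma sum_rescaled i T a (g : {set 'I_t} -> nat -> KE) :
  T \subset C -> #|T| = i.+3 -> (0 < a <= i.+2)%N ->
  \sum_(b in scroll_basis i.+1) rescaled_coef i.+1 T a b * g b.1 b.2 =
  \sum_(k in T) sgn T k *: ((1 < a)%:R *: (x k * g (T :\ k) a.-1) +
    (a < i.+2)%:R *: (y k * g (T :\ k) a)).
Proof.
move=> TC cT ai.
have it : (i.+1 <= t)%N by have := max_card (mem T); rewrite card_ord cT; lia.
under eq_bigr => b _ do rewrite /= mulr_suml.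
rewrite (exchange_big_dep (mem T)) /=; last by move=> b k _ /andP[].
apply: eq_bigr => k kT.
have cU : #|T :\ k| = i.+2 by apply: succn_inj; rewrite -cT (cardsD1 k T) kT.
rewrite (eq_bigl (fun b : scroll_index => (b.1 == T :\ k) && (0 < b.2 <= i.+1)%N)); last first.
  move=> b; rewrite !inE kT /= andbC; have [->|//] := eqVneq b.1 (T :\ k).
  by rewrite cU eqxx /= (subset_trans (subsetDl _ _) TC).
rewrite -(pair_big (fun U => U == T :\ k) (fun c : 'I_t.+1 => (0 < c <= i.+1)%N)
  (fun U c => (sgn T k *: ((a == c.+1)%:R *: x k + (a == c)%:R *: y k)) * g U c)) /=.
rewrite big_pred1_eq -(sum_scroll_ord (fun c => x k * g (T :\ k) c)
  (fun c => y k * g (T :\ k) c)) // scaler_sumr; apply: eq_bigr => c _.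
by rewrite -scalerAl mulrDl -!scalerAl.
Qed.

Lemma scroll_coef_comp i b b'' : b \in scroll_basis i.+2 -> b'' \in scroll_basis i ->
  \sum_(b' in scroll_basis i.+1) scroll_coef i.+1 b b' * scroll_coef i b' b'' = 0.
Proof.
(* A power of e is not a zero divisor, so the claim may be checked on the Eagon-Northcott
   differential. *)
move=> bB b''B; have E0 : E (weight b.1 b.2) != 0 by rewrite -msupp_eq0 msuppX.
apply/eqP; rewrite -(mulrI_eq0 _ (mulfI E0)) mulr_sumr.
rewrite (eq_bigr (fun b' => rescaled_coef i.+1 b.1 b.2 b' *
    rescaled_coef i b'.1 b'.2 b'' * E (weight b''.1 b''.2))); last first.
  by move=> b' b'B; rewrite mulrA (rescale_coef bB b'B) -!mulrA rescale_coef.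
rewrite -mulr_suml mulf_eq0; apply/orP; left; apply/eqP.
have := bB; rewrite inE => /and3P[TC /eqP cT ai].
rewrite (sum_rescaled (fun U c => rescaled_coef i U c b'')) //.
move: (b.1) (nat_of_ord b.2) TC cT ai => T a _ cT /andP[a0 ai] {bB b E0}.
case: i cT ai b''B => [|i] cT ai; rewrite inE /=.
  move=> _; have [a1|a1] := leqP a 1.
    (* For a = 1 the sum is the expansion of a determinant with the row of the y repeated: its terms
       are antisymmetric in the two deleted columns. *)
    rewrite (_ : (a < 2)%N) //; under eq_bigr => k _.
      rewrite scale0r add0r scale1r mulr_sumr scaler_sumr.
      under eq_bigr => l _ do rewrite -scalerAr scalerA mulrA.
      over.
    rewrite -[RHS](sum_antisym (T := T) (P := fun _ _ => true) (g := fun k l =>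
      (sgn T k * sgn (T :\ k) l) *: (y k * y l * \prod_(j in T :\ k :\ l) x j))) //.
      by apply: eq_bigr => k _; apply: eq_bigl => l; rewrite andbT.
    move=> k l kT lT kl _; rewrite -scaleNr sgn_anti // (mulrC (y k)).
    by rewrite !setDDl setUC.
  (* For a = 2 the row of the x is repeated. With l fixed, the monomial does not depend on the
     column k deleted first, and the signs of the two possible k are opposite. *)
  rewrite (_ : (a < 2)%N = false); last by lia.
  under eq_bigr => k _.
    rewrite scale0r addr0 scale1r mulr_sumr scaler_sumr.
    under eq_bigr => l _ do rewrite -scalerAr scalerA mulrCA.
    over.
  rewrite (exchange_big_dep (mem T)) /=; last by move=> k l _; rewrite inE => /andP[].
  rewrite big1 // => l lT.
  have cU : #|T :\ l| = 2%N by apply: succn_inj; rewrite -cT (cardsD1 l T) lT.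
  rewrite (eq_bigr (fun k => sgn (T :\ l) k *: ((- sgn T l) *: (y l * \prod_(j in T :\ l) x j)))).
    rewrite -scaler_suml [X in X *: _](eq_bigl (fun k => k \in T :\ l)); last first.
      by move=> k; rewrite !inE lT andbT andbC eq_sym.
    have /eqP/cards2P[k1 [k2 [k12 eU]]] := cU; set s := sgn (T :\ l).
    rewrite eU big_setU1 ?inE //= big_set1.
    have k1U : k1 \in T :\ l by rewrite eU !inE eqxx.
    have k2U : k2 \in T :\ l by rewrite eU !inE eqxx orbT.
    suff -> : s k1 + s k2 = 0 by rewrite scale0r.
    have := pos_lt k1U; have := pos_lt k2U; rewrite cU.
    have : pos (T :\ l) k1 != pos (T :\ l) k2.
      by apply: contraNneq k12 => /(pos_inj k1U k2U)->.
    rewrite /s /sgn; case: (pos _ k1) => [|[|?]] //; case: (pos _ k2) => [|[|?]] //.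
      by rewrite expr1 expr0 subrr.
    by rewrite expr1 expr0 addNr.
  move=> k /andP[kT]; rewrite in_setD1 lT andbT => lk.
  rewrite scalerA mulrN (mulrC (sgn (T :\ l) k)) -sgn_anti // 1?eq_sym //.
  congr (_ *: (_ * _)).
  have kU : k \in T :\ l by rewrite in_setD1 kT eq_sym lk.
  by rewrite (big_setD1 k kU) /= !setDDl setUC.
case/and3P => UC /eqP cU /andP[c0 ci].
(* The product of the coefficients along the deletion of k and then l. It is symmetric, being x_k
   x_l, x_k y_l + y_k x_l or y_k y_l according as the index drops by 2, 1 or 0, while the signs are
   antisymmetric. *)
pose Gamma k l : KE := (1 < a)%:R *: (x k * ((a.-1 == b''.2.+1)%:R *: x l +
    (a.-1 == b''.2)%:R *: y l)) +
  (a < i.+3)%:R *: (y k * ((a == b''.2.+1)%:R *: x l + (a == b''.2)%:R *: y l)).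
rewrite -[RHS](sum_antisym (T := T) (P := fun k l => b''.1 == T :\ k :\ l)
  (g := fun k l => (sgn T k * sgn (T :\ k) l) *: Gamma k l)).
- apply: eq_bigr => k kT; rewrite !mulr_sumr !scaler_sumr -big_split scaler_sumr.
  apply: eq_bigr => l lT /=; rewrite -scalerA; congr (_ *: _).
  by rewrite -!scalerAr /Gamma scalerDr; congr (_ + _); rewrite !scalerA mulrC.
- by move=> k l; rewrite !setDDl setUC.
move=> k l kT lT kl _; rewrite -scaleNr -(sgn_anti kT lT kl); congr (_ *: _).
rewrite /Gamma (_ : (a.-1 == b''.2.+1) = (a == b''.2.+2)); last by lia.
rewrite (_ : (a.-1 == b''.2) = (a == b''.2.+1)); last by lia.
move: (nat_of_ord b''.2) c0 ci (x k) (x l) (y k) (y l) => c c0 ci X X' Y Y' {Gamma}.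
have [ac|ac2] := eqVneq a c.+2.
  rewrite (_ : (1 < a)%N); last by lia.
  rewrite (_ : (a == c.+1) = false); last by lia.
  rewrite (_ : (a == c) = false); last by lia.
  by rewrite !scale0r !addr0 !mulr0 !scaler0 !addr0 !scale1r mulrC.
have [ac|ac1] := eqVneq a c.+1.
  rewrite (_ : (1 < a)%N); last by lia.
  rewrite (_ : (a < i.+3)%N); last by lia.
  rewrite (_ : (a == c) = false); last by lia.
  by rewrite !scale0r !addr0 !add0r !scale1r addrC !(mulrC X') !(mulrC X).
have [ac|ac0] := eqVneq a c.
  by rewrite !scale0r !addr0 !mulr0 !scaler0 !add0r !scale1r mulrC.
by rewrite !scale0r !addr0 !mulr0 !scaler0.
Qed.

End ScrollComplex.

(** * Leading terms of the scroll complex *)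

Section LeadingScroll.

Variables (K : fieldType) (n t : nat) (C : {set 'I_t}).
Variables (kappa : 'I_n -> option ('I_t * bool)) (v : 'I_t -> nat).
Hypothesis v_mono : forall k l : 'I_t, (k < l)%N -> (v k <= v l)%N.
Hypothesis colm_nonempty : forall k (b : bool), k \in C -> exists i, kappa i = Some (k, b).

Local Notation KE := {mpoly K[n]}.
Implicit Types (T : {set 'I_t}) (j k l : 'I_t) (a : nat) (m : 'X_{1..n}) (b c : scroll_index t).

Local Notation xm := (colm kappa true).
Local Notation ym := (colm kappa false).
Local Notation emon := (em kappa).
Local Notation B := (scroll_basis C).
Local Notation coef := (scroll_coef K kappa v).

(** Different colour classes are disjoint, so their monomials are coprime. *)
Lemma colm_lem_add (b : bool) k (b' : bool) k' m : (b, k) != (b', k') ->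
  (colm kappa b k <= colm kappa b' k' + m)%MM -> (colm kappa b k <= m)%MM.
Proof.
move=> ne /mnm_lepP h; apply/mnm_lepP => i; have := h i.
rewrite mnmDE !mnmE; case: eqP => // ->.
by case: eqP => // -[kk bb]; move: ne; rewrite kk bb eqxx.
Qed.

(** An additive weight that is blind to the Y_k and e and prefers X_k with small k. Only one
    variable of each X_k is counted, so that X_k has weight exactly t - k whatever its number of
    variables. *)
Definition xweight m : nat :=
  (\sum_(k < t) (t - k) * (if [pick i | kappa i == Some (k, true)] is Some i then m i else 0))%N.

Lemma xweightD m m' : xweight (m + m')%MM = (xweight m + xweight m')%N.
Proof.
rewrite -big_split; apply: eq_bigr => k _ /=; rewrite -mulnDr.
by case: pickP => [i _|_] //; rewrite mnmDE.
Qed.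

Lemma xweight_xm k : k \in C -> xweight (xm k) = (t - k)%N.
Proof.
move=> kC; rewrite /xweight (bigD1 k) //= big1 ?addn0.
  case: pickP => [i ki|h]; first by rewrite mnmE ki muln1.
  by have [i ki] := colm_nonempty true kC; have := h i; rewrite ki eqxx.
move=> j jk; case: pickP => [i /eqP ji|_]; last by rewrite muln0.
rewrite mnmE ji; case: eqP => [[kj]|_]; last by rewrite muln0.
by rewrite kj eqxx in jk.
Qed.

Lemma xweight_ym k : xweight (ym k) = 0%N.
Proof.
apply: big1 => j _; case: pickP => [i /eqP ji|_]; last by rewrite muln0.
by rewrite mnmE ji; case: eqP => [[]|_] //; rewrite muln0.
Qed.

Lemma xweight_em d : xweight (emon *+ d)%MM = 0%N.
Proof.
apply: big1 => j _; case: pickP => [i /eqP ji|_]; last by rewrite muln0.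
by rewrite mulmnE mnmE ji muln0.
Qed.

Lemma xweight_xcoef T k a : k \in C -> xweight (xcoef kappa v T k a) = (t - k)%N.
Proof. by move=> kC; rewrite xweightD xweight_em addn0 xweight_xm. Qed.

Lemma xweight_ycoef T k a : xweight (ycoef kappa v T k a) = 0%N.
Proof. by rewrite xweightD xweight_em addn0 xweight_ym. Qed.

(** The least element, obtained from a maximum; on the empty set it takes the value t. *)
Definition minset T : nat := (t - \max_(k in T) (t - k))%N.
Definition maxset T : nat := \max_(k in T) k.

Lemma minset_le T k : k \in T -> (minset T <= k)%N.
Proof.
move=> kT; have : (t - k <= \max_(j in T) (t - j))%N.
  exact: (@leq_bigmax_cond _ (mem T) (fun k : 'I_t => (t - k)%N)).
by rewrite /minset; have := ltn_ord k; lia.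
Qed.

Lemma maxset_ge T k : k \in T -> (k <= maxset T)%N.
Proof. by move=> kT; apply: (@leq_bigmax_cond _ (mem T)). Qed.

Lemma minset_ex T : (0 < #|T|)%N -> exists2 k, k \in T & minset T = k.
Proof.
move=> T0; have [k kT k0] := pos_surj T0; exists k => //.
apply/eqP; rewrite eqn_leq minset_le //= /minset.
suff : (\max_(j in T) (t - j) <= t - k)%N by have := ltn_ord k; lia.
apply/bigmax_leqP => l lT; rewrite leq_sub2l // leqNgt; apply/negP => /(pos_ltn lT).
by rewrite k0.
Qed.

Lemma maxset_ex T : (0 < #|T|)%N -> exists2 k, k \in T & maxset T = k.
Proof.
move=> T0; have [|k kT k0] := @pos_surj _ T #|T|.-1; first by rewrite ltn_predL.
exists k => //; apply/eqP; rewrite eqn_leq maxset_ge // andbT.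
apply/bigmax_leqP => l lT; rewrite leqNgt; apply/negP => /(pos_ltn kT).
by have := pos_lt lT; lia.
Qed.

Lemma maxset_lt T : (maxset T <= t)%N.
Proof. by apply/bigmax_leqP => k _; apply: ltnW. Qed.

Lemma card_setD1_gt0 T k : (1 < #|T|)%N -> (0 < #|T :\ k|)%N.
Proof.
move=> cT; rewrite lt0n; apply: contraTneq cT => e.
by rewrite (cardsD1 k) e addn0; case: (k \in T).
Qed.

Lemma minsetD1 T k : (1 < #|T|)%N -> (minset T <= minset (T :\ k))%N.
Proof.
move=> cT; have [j] := minset_ex (card_setD1_gt0 k cT).
by rewrite in_setD1 => /andP[_ jT] ->; apply: minset_le.
Qed.

(** A lexicographic comparison in base t + 1. The factor 2 decides between two deletions with X:
    deleting k instead of the minimum k0 loses 2 (k - k0) in weight and gains at most k - k0 by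
    keeping k0 in the set. The last digit decides between deletions with Y. *)
Definition rho (b : scroll_index t) m : nat :=
  ((2 * xweight m + (t - minset b.1)) * t.+1 + (t - maxset b.1))%N.

Lemma rho_lt1 b b' m m' :
  (2 * xweight m + (t - minset b.1) < 2 * xweight m' + (t - minset b'.1))%N ->
  (rho b m < rho b' m')%N.
Proof.
rewrite /rho; move: (2 * _ + _)%N (2 * _ + _)%N => p q /leq_mul/(_ (leqnn t.+1)).
by rewrite mulSn; have := leq_subr (maxset b.1) t; lia.
Qed.

Lemma rho_lt2 b b' m m' :
  (2 * xweight m + (t - minset b.1) <= 2 * xweight m' + (t - minset b'.1))%N ->
  (maxset b'.1 < maxset b.1)%N ->
  (rho b m < rho b' m')%N.
Proof.
rewrite /rho; move: (2 * _ + _)%N (2 * _ + _)%N => p q /leq_mul/(_ (leqnn t.+1)).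
by have := maxset_lt b.1; have := maxset_lt b'.1; lia.
Qed.

(** For a > 1 the least column is deleted with its X. For a = 1 the target basis offers no term with
    X, and the greatest column is deleted with its Y. *)
Definition scroll_lead (b : scroll_index t) m (b' : scroll_index t) m' : Prop :=
  exists k, [/\ k \in b.1, b'.1 = b.1 :\ k &
    [/\ (1 < b.2)%N, minset b.1 = k, b.2 = b'.2.+1 :> nat & m' = (xm k + m)%MM] \/
    [/\ b.2 = 1%N :> nat, maxset b.1 = k, b'.2 = 1%N :> nat & m' = (ym k + m)%MM]].

(** Excludes the terms that become leading terms after inserting a column: one to the left of the
    set, whose X divides [m], or, if the index is 1, one to the right of it, whose Y divides [m]. *)
Definition scroll_nonlead (b : scroll_index t) m : bool :=
  [forall k in C, (k < minset b.1)%N ==> ~~ (xm k <= m)%MM] &&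
  ((b.2 == 1%N :> nat) ==> [forall k in C, (maxset b.1 < k)%N ==> ~~ (ym k <= m)%MM]).

Lemma setD1_inj T k l : k \in T -> l \in T -> T :\ k = T :\ l -> k = l.
Proof.
move=> kT lT /setP/(_ k); rewrite !in_setD1 eqxx kT /= andbT.
by move/esym/negbFE/eqP.
Qed.

Lemma scroll_coefE i b (b' : scroll_index t) k : k \in b.1 -> b'.1 = b.1 :\ k ->
  coef i.+1 b b' = sgn K b.1 k *:
    ((b.2 == b'.2.+1 :> nat)%:R *: 'X_[xcoef kappa v b.1 k b.2] +
     (b.2 == b'.2 :> nat)%:R *: 'X_[ycoef kappa v b.1 k b.2]).
Proof.
move=> kb eb; rewrite /= (bigD1 k) /=; last by rewrite kb eb eqxx.
rewrite big1 ?addr0 // => l /andP[/andP[lb /eqP e]]; rewrite eb in e.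
by rewrite (setD1_inj kb lb e) eqxx.
Qed.

Lemma sgn_neq0 T k : sgn K T k != 0.
Proof. by rewrite signr_eq0. Qed.

Lemma mcoeff_XscaleX (c : K) m m1 m' :
  ('X_[m] * (c *: 'X_[m1]) : KE)@_m' = c * ((m + m1)%MM == m')%:R.
Proof. by rewrite -scalerAr -mpolyXD mcoeffZ mcoeffX. Qed.

Lemma scroll_terms i b b' m m' : ('X_[m] * coef i.+1 b b')@_m' != 0 ->
  exists k, [/\ k \in b.1, b'.1 = b.1 :\ k &
    (b.2 = b'.2.+1 :> nat /\ m' = (m + xcoef kappa v b.1 k b.2)%MM) \/
    (b.2 = b'.2 :> nat /\ m' = (m + ycoef kappa v b.1 k b.2)%MM)].
Proof.
have [/existsP[k /andP[kb /eqP eb]]|/existsPn no] :=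
  boolP [exists k, (k \in b.1) && (b'.1 == b.1 :\ k)]; last first.
  rewrite /= big_pred0 ?mulr0 ?mcoeff0 ?eqxx // => k; apply/negbTE/no.
rewrite (scroll_coefE i kb eb) => nz; exists k; split=> //; move: nz.
have [e1|e1] := eqVneq (b.2 : nat) b'.2.+1.
  rewrite e1 eq_sym (gtn_eqF (ltnSn _)) -e1 scale0r addr0 scale1r mcoeff_XscaleX => h; left.
  by split=> //; apply/eqP; rewrite eq_sym; apply: contraNT h => /negPf->; rewrite mulr0.
have [e2|e2] := eqVneq (b.2 : nat) b'.2.
  rewrite scale0r add0r scale1r mcoeff_XscaleX => h; right.
  by split=> //; apply/eqP; rewrite eq_sym; apply: contraNT h => /negPf->; rewrite mulr0.
by rewrite !scale0r addr0 scaler0 mulr0 mcoeff0 eqxx.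
Qed.

Lemma basisP i b : b \in B i.+1 ->
  [/\ b.1 \subset C, #|b.1| = i.+2 & (0 < b.2 <= i.+1)%N].
Proof. by rewrite inE => /and3P[-> /eqP-> ->]. Qed.

(** The deleted column is the first or the last one, so its coefficient is X_k or Y_k without any
    power of e. *)
Lemma scroll_lead_coeff i b b' m m' : b \in B i.+2 -> scroll_lead b m b' m' ->
  ('X_[m] * coef i.+1 b b')@_m' != 0.
Proof.
move=> /basisP[_ cb _] [k [kb eb]]; rewrite (scroll_coefE i kb eb).
case=> [[b1 kmin e ->]|[b1 kmax e ->]].
  rewrite e eqxx (gtn_eqF (ltnSn _)) -e scale0r addr0 scale1r.
  rewrite xcoef_lower // ?mcoeff_XscaleX 1?addmC ?eqxx ?mulr1 ?sgn_neq0 //.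
  by rewrite (pos_min kb) 1?ltnW // => j jb; rewrite -kmin minset_le.
rewrite b1 e /= scale0r add0r scale1r.
rewrite ycoef_upper // ?mcoeff_XscaleX 1?addmC ?eqxx ?mulr1 ?sgn_neq0 //.
by rewrite (pos_max kb) ?cb // => j jb; rewrite -kmax maxset_ge.
Qed.

Lemma scroll_lead_max i b b' m m' c m'' : b \in B i.+2 -> b' \in B i.+1 -> c \in B i.+1 ->
  scroll_lead b m b' m' -> ('X_[m] * coef i.+1 b c)@_m'' != 0 ->
  (c, m'') = (b', m') \/ (rho c m'' < rho b' m')%N.
Proof.
move=> bB b'B cB ld /scroll_terms[k [kb ec]].
have [bC cb _] := basisP bB; have [_ _ /andP[c0 _]] := basisP cB.
case: ld => k0 [k0b eb'] [[b1 kmin e ->]|[b1 kmax e ->]]; case=> [[e' ->]|[e' ->]].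
- have [kk|kk] := eqVneq k k0.
    left; congr (_, _).
      case: b' c {b'B cB c0} eb' e ec e' => U u [W w] /= -> e -> e'.
      by congr (_, _); [rewrite kk | apply: val_inj; rewrite /= -[nat_of_ord w]/(w.+1.-1) -e' e].
    rewrite kk xcoef_lower 1?addmC // (pos_min k0b) 1?ltnW // => j jb.
    by rewrite -kmin minset_le.
  right; apply: rho_lt1; rewrite (xweightD m) (xweightD (xm k0)).
  rewrite xweight_xcoef ?xweight_xm ?(subsetP bC) // eb' ec.
  have k0k : (k0 < k)%N by rewrite ltn_neqAle eq_sym -kmin minset_le // kmin val_eqE kk.
  have : (minset (b.1 :\ k0) <= k)%N by apply: minset_le; rewrite in_setD1 kk.
  have : (k0 <= minset (b.1 :\ k))%N by rewrite -kmin minsetD1 ?cb.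
  have : (minset (b.1 :\ k) <= k0)%N by apply: minset_le; rewrite in_setD1 eq_sym kk.
  by have := ltn_ord k; lia.
- right; apply: rho_lt1; rewrite (xweightD m) (xweightD (xm k0)).
  rewrite xweight_ycoef ?xweight_xm ?(subsetP bC) // eb' ec.
  have : (k0 <= minset (b.1 :\ k))%N by rewrite -kmin minsetD1 ?cb.
  by have := ltn_ord k0; lia.
- by rewrite b1 in e'; lia.
have [kk|kk] := eqVneq k k0.
  left; congr (_, _).
    case: b' c {b'B cB c0} eb' e ec e' => U u [W w] /= -> e -> e'.
    by congr (_, _); [rewrite kk | apply: val_inj; rewrite /= -e' e].
  rewrite kk ycoef_upper 1?addmC // (pos_max k0b) ?cb ?b1 // => j jb.
  by rewrite -kmax maxset_ge.
(* All terms have the same [xweight] here. Deleting the greatest column [k0] keeps the minimum, and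
   it leaves a smaller maximum than deleting [k] does. *)
right; apply: rho_lt2; rewrite ?(xweightD m) ?(xweightD (ym k0)) ?xweight_ycoef ?xweight_ym eb' ec.
  suff : (minset (b.1 :\ k0) <= minset (b.1 :\ k))%N by lia.
  have [j jb jm] : exists2 j, j \in b.1 & minset b.1 = j by apply: minset_ex; rewrite cb.
  apply: leq_trans (minsetD1 _ _); rewrite ?cb // jm; apply: minset_le.
  rewrite in_setD1 jb andbT; apply/eqP => jk.
  have [l lb lk] : exists2 l, l \in b.1 & l != k0.
    have : (0 < #|b.1 :\ k0|)%N by apply: card_setD1_gt0; rewrite cb.
    by rewrite card_gt0 => /set0Pn[l]; rewrite in_setD1 => /andP[? ?]; exists l.
  case/eqP: lk; apply: val_inj; apply/eqP; rewrite /= eqn_leq; apply/andP; split.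
    by rewrite -kmax maxset_ge.
  by rewrite -jk -jm minset_le.
have [|j] := @maxset_ex (b.1 :\ k0); first by apply: card_setD1_gt0; rewrite cb.
rewrite in_setD1 => /andP[jk jb] ->.
apply: leq_trans (_ : k0 <= _)%N; last by apply: maxset_ge; rewrite in_setD1 eq_sym kk.
by rewrite ltn_neqAle val_eqE jk -kmax maxset_ge.
Qed.

Lemma scroll_lead_exists i b m : b \in B i.+2 ->
  exists2 b', b' \in B i.+1 & exists m', scroll_lead b m b' m'.
Proof.
move=> /basisP[bC cb ai].
have valid k (d : nat) : k \in b.1 -> (0 < d <= i.+1)%N -> (b.1 :\ k, inord d) \in B i.+1.
  move=> kb /andP[d0 di]; rewrite inE /= (subset_trans (subsetDl _ _) bC) /=.
  have -> : #|b.1 :\ k| = i.+2 by apply: succn_inj; rewrite -cb (cardsD1 k b.1) kb.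
  rewrite eqxx /=.
  by rewrite inordK ?d0 //; have := ltn_ord b.2; have := max_card (mem b.1);
    rewrite card_ord cb; lia.
have inordE (d : nat) : (d <= i.+1)%N -> (inord d : 'I_t.+1) = d :> nat.
  by move=> di; rewrite inordK //; have := max_card (mem b.1); rewrite card_ord cb; lia.
have [b1|b1] := ltnP 1 b.2.
  have [|k kb kmin] := @minset_ex b.1; first by rewrite cb.
  exists (b.1 :\ k, inord b.2.-1); first by apply: valid => //; lia.
  exists (xm k + m)%MM; exists k; split=> //; left; split=> //=.
  by rewrite inordE; lia.
have [|k kb kmax] := @maxset_ex b.1; first by rewrite cb.
exists (b.1 :\ k, inord 1); first by apply: valid.
exists (ym k + m)%MM; exists k; split=> //; right; split=> //=; first by lia.
by rewrite inordE.
Qed.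

Lemma scroll_lead_onto i b' m' : b' \in B i.+1 -> ~~ scroll_nonlead b' m' ->
  exists2 b, b \in B i.+2 & exists m, scroll_lead b m b' m'.
Proof.
move=> b'B; have [bC cb /andP[a0 ai]] := basisP b'B.
have valid k (d : nat) : k \in C -> k \notin b'.1 -> (0 < d <= i.+2)%N ->
    (k |: b'.1, inord d) \in B i.+2 /\ (inord d : 'I_t.+1) = d :> nat.
  move=> kC kb /andP[d0 di].
  have cU : #|k |: b'.1| = i.+3 by rewrite cardsU1 kb cb.
  have dt : (d < t.+1)%N by have := max_card (mem (k |: b'.1)); rewrite card_ord cU; lia.
  by rewrite inE /= subUset sub1set kC bC cU eqxx inordK // d0 di.
have add_del k : k \notin b'.1 -> b'.1 = (k |: b'.1) :\ k.
  by move=> kb; rewrite setU1K.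
rewrite negb_and => /orP[|].
  case/forall_inPn => k kC; rewrite negb_imply negbK => /andP[kmin km].
  have kb : k \notin b'.1 by apply/negP => /minset_le; rewrite leqNgt kmin.
  have [bB ec] := valid k b'.2.+1 kC kb ltac:(lia).
  exists (k |: b'.1, inord b'.2.+1) => //; exists (m' - xm k)%MM; exists k.
  split; [exact: setU11 | exact: add_del | left; split=> //=; rewrite ?ec //].
    have [|l] := @minset_ex (k |: b'.1); first by rewrite cardsU1 kb cb.
    move=> lU lmin; apply/eqP; rewrite eqn_leq minset_le ?setU11 //=.
    rewrite lmin; move: lU; rewrite in_setU1 => /orP[/eqP-> //|/minset_le h].
    exact: leq_trans (ltnW kmin) h.
  by rewrite addmC submK.
rewrite negb_imply => /andP[/eqP b1] /forall_inPn[k kC].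
rewrite negb_imply negbK => /andP[kmax km].
have kb : k \notin b'.1 by apply/negP => /maxset_ge; rewrite leqNgt kmax.
have [bB ec] := valid k 1%N kC kb isT.
exists (k |: b'.1, inord 1) => //; exists (m' - ym k)%MM; exists k.
split; [exact: setU11 | exact: add_del | right; split=> //=; rewrite ?ec //].
  have [|l] := @maxset_ex (k |: b'.1); first by rewrite cardsU1 kb cb.
  move=> lU lmax; apply/eqP; rewrite eqn_leq maxset_ge ?setU11 // andbT.
  rewrite lmax; move: lU; rewrite in_setU1 => /orP[/eqP-> //|/maxset_ge h].
  exact: leq_trans h (ltnW kmax).
by rewrite addmC submK.
Qed.

(** For two basis vectors leading to the same target, one by deleting its minimum with X and the
    other by deleting its maximum with Y: the first deleted column lies to the left of the second
    set. *)
Lemma lead_crossed T (S : {set 'I_t}) k l : T :\ k = S :\ l -> (1 < #|S|)%N ->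
  minset T = k -> maxset S = l -> (k < minset S)%N.
Proof.
move=> eTS cS kmin lmax; have [|j jS jmin] := @minset_ex S; first exact: ltnW.
have /card_gt0P[p] := card_setD1_gt0 l cS; rewrite in_setD1 => /andP[pl pS].
have jl : j != l.
  rewrite -val_eqE neq_ltn /= -{1}jmin (leq_ltn_trans (minset_le pS)) //.
  by rewrite ltn_neqAle val_eqE pl -lmax maxset_ge.
have : j \in T :\ k by rewrite eTS in_setD1 jl.
rewrite in_setD1 jmin => /andP[jk jT].
by rewrite ltn_neqAle val_eqE eq_sym jk -kmin minset_le.
Qed.

(** If different terms are deleted, coprimality makes the X or Y of one deleted column divide the
    monomial belonging to the other basis vector, on a side where [scroll_nonlead] forbids it. *)
Lemma scroll_lead_inj i b c b' m m1 m' : b \in B i.+2 -> c \in B i.+2 ->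
  scroll_nonlead b m -> scroll_nonlead c m1 ->
  scroll_lead b m b' m' -> scroll_lead c m1 b' m' -> (b, m) = (c, m1).
Proof.
move=> bB cB /andP[/forall_inP nbx nby] /andP[/forall_inP ncx ncy].
have [bC cb _] := basisP bB; have [cC cc _] := basisP cB.
have pair_eq k : k \in b.1 -> k \in c.1 -> b'.1 = b.1 :\ k -> b'.1 = c.1 :\ k ->
    b.2 = c.2 :> nat -> b = c.
  move=> kb kc eb ec e2; rewrite [b]surjective_pairing [c]surjective_pairing.
  by congr (_, _); [rewrite -(setD1K kb) -(setD1K kc) -eb -ec | apply: val_inj].
case=> k [kb eb H] [l [lc ec H']].
have minle T j : j \in T -> (minset T <= j)%N by exact: minset_le.
case: H H' => [[b1 kmin e em']|[b1 kmax e em']] [[c1 lmin e1 em1]|[c1 lmax e1 em1]].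
- have kl : k = l.
    apply: val_inj => /=; case: (ltngtP k l) => // h.
      have := ncx k (subsetP bC k kb); rewrite lmin h /= => /negP[].
      apply: (@colm_lem_add true k true l); first by rewrite xpair_eqE /= -val_eqE ltn_eqF.
      by rewrite -em1 em' lem_addr.
    have := nbx l (subsetP cC l lc); rewrite kmin h /= => /negP[].
    apply: (@colm_lem_add true l true k); first by rewrite xpair_eqE /= -val_eqE ltn_eqF.
    by rewrite -em' em1 lem_addr.
  subst l; congr (_, _); first by apply: (pair_eq k) => //; rewrite e e1.
  by apply: (@addmI _ (xm k)); rewrite -em' -em1.
- have /negP[] : ~~ (xm k <= m1)%MM.
    have := ncx k (subsetP bC k kb); move/implyP; apply.
    by apply: (lead_crossed (T := b.1) (l := l)); rewrite -?eb ?cc.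
  apply: (@colm_lem_add true k false l) => //.
  by rewrite -em1 em' lem_addr.
- have /negP[] : ~~ (xm l <= m)%MM.
    have := nbx l (subsetP cC l lc); move/implyP; apply.
    by apply: (lead_crossed (T := c.1) (l := k)); rewrite -?ec ?cb.
  apply: (@colm_lem_add true l false k) => //.
  by rewrite -em' em1 lem_addr.
have kl : k = l.
  apply: val_inj => /=; case: (ltngtP k l) => // h.
    have := nby; rewrite b1 eqxx /= => /forall_inP/(_ l (subsetP cC l lc)).
    rewrite kmax h /= => /negP[].
    apply: (@colm_lem_add false l false k); first by rewrite xpair_eqE /= -val_eqE gtn_eqF.
    by rewrite -em' em1 lem_addr.
  have := ncy; rewrite c1 eqxx /= => /forall_inP/(_ k (subsetP bC k kb)).
  rewrite lmax h /= => /negP[].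
  apply: (@colm_lem_add false k false l); first by rewrite xpair_eqE /= -val_eqE gtn_eqF.
  by rewrite -em1 em' lem_addr.
subst l; congr (_, _); first by apply: (pair_eq k) => //; rewrite b1 c1.
by apply: (@addmI _ (ym k)); rewrite -em' -em1.
Qed.

Definition minor_lead b m (b' : scroll_index t) m' : Prop :=
  m' = (lead_monomial kappa b.1 1 + m)%MM.

Definition minor_nonlead m : bool :=
  [forall k in C, forall l in C, (k < l)%N ==> ~~ (xm k + ym l <= m)%MM].

Lemma basis0P b : (b \in B 0) = (b == (set0, ord0)).
Proof. by rewrite inE. Qed.

Lemma basis1P b : b \in B 1 -> exists k l,
  [/\ (k < l)%N, k \in C, l \in C & b = ([set k; l], inord 1)].
Proof.
case: b => T a; rewrite inE => /and3P[/= TC /eqP cT /andP[a0 a1]].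
have [k kT k0] : exists2 k, k \in T & pos T k = 0%N by apply: pos_surj; rewrite cT.
have [l lT l1] : exists2 l, l \in T & pos T l = 1%N by apply: pos_surj; rewrite cT.
have kl : (k < l)%N by rewrite ltnNge; apply/negP => /(pos_le lT); rewrite k0 l1.
exists k, l; split; rewrite ?(subsetP TC) //; congr (_, _).
  apply/esym/eqP; rewrite eqEcard subUset !sub1set kT lT cT cards2.
  by rewrite -val_eqE neq_ltn /= kl.
have t1 : (1 < t)%N by have := ltn_ord l; lia.
by apply: val_inj; rewrite /= inordK; lia.
Qed.

Section Pair.

Variables k l : 'I_t.
Hypothesis kl : (k < l)%N.

Lemma pair_neq : (k != l) * (l != k).
Proof. by rewrite -!val_eqE neq_ltn kl [(l : nat) != k]neq_ltn kl orbT. Qed.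

Lemma pair_pos : (pos [set k; l] k = 0%N) * (pos [set k; l] l = 1%N).
Proof.
split; first by apply: pos_min; rewrite ?inE ?eqxx // => j; rewrite !inE =>
  /orP[]/eqP-> //; apply: ltnW.
rewrite (@pos_max _ [set k; l] l) ?cards2 ?pair_neq ?inE ?eqxx ?orbT // => j; rewrite !inE.
by case/orP => /eqP-> //; apply: ltnW.
Qed.

Lemma pair_delk : [set k; l] :\ k = [set l].
Proof. by rewrite setU1K // inE pair_neq. Qed.

Lemma pair_dell : [set k; l] :\ l = [set k].
Proof. by rewrite setUC setU1K // inE pair_neq. Qed.

Lemma pair_lead_monomial : lead_monomial kappa [set k; l] 1 = (xm k + ym l)%MM.
Proof.
by rewrite /lead_monomial /select big_setU1 ?inE ?pair_neq //= big_set1 !pair_pos.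
Qed.

Lemma pair_minset : (minset [set k; l] = k) * (maxset [set k; l] = l).
Proof.
have c2 : (0 < #|[set k; l]|)%N by rewrite cards2 pair_neq.
have lk : (k <= l)%N := ltnW kl.
split.
  have [j jT jm] := minset_ex c2; apply/eqP; rewrite eqn_leq minset_le ?inE ?eqxx //=.
  by rewrite jm; move: jT; rewrite !inE => /orP[]/eqP->.
have [j jT jm] := maxset_ex c2; apply/eqP; rewrite eqn_leq maxset_ge ?inE ?eqxx ?orbT //=.
by rewrite jm; move: jT; rewrite !inE andbT => /orP[]/eqP->.
Qed.

Lemma minor_pair : minor K kappa v [set k; l] =
  'X_[ycoef kappa v [set k; l] k 1 + xm l] - 'X_[xm k + ym l].
Proof.
rewrite /minor big_setU1 ?inE ?pair_neq //= big_set1 /sgn !pair_pos.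
rewrite expr0 expr1 scale1r scaleN1r pair_delk pair_dell !big_set1.
by rewrite (@ycoef_upper _ _ _ _ [set k; l] 1 l) ?pair_pos ?inE ?eqxx ?orbT // [(ym l + _)%MM]addmC.
Qed.

End Pair.

(** The lead monomial X_k Y_l outweighs X_l Y_k e^(v l - v k), since t - k > t - l. *)
Lemma minor_terms b : b \in B 1 -> exists q,
  [/\ minor K kappa v b.1 = 'X_[q] - 'X_[lead_monomial kappa b.1 1] &
  (xweight q < xweight (lead_monomial kappa b.1 1))%N].
Proof.
move=> /basis1P[k [l [kl kC lC ->]]] /=.
rewrite minor_pair // pair_lead_monomial //.
exists (ycoef kappa v [set k; l] k 1 + xm l)%MM; split=> //.
rewrite (xweightD _ (xm l)) (xweightD (xm k)) xweight_ycoef xweight_ym !xweight_xm //.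
by have := ltn_ord l; lia.
Qed.

Lemma minor_lead_coeff b b' m m' : b \in B 1 -> minor_lead b m b' m' ->
  ('X_[m] * coef 0 b b')@_m' != 0.
Proof.
move=> bB ->; have [q [/= -> qlt]] := minor_terms bB.
rewrite mulrBr -!mpolyXD mcoeffB !mcoeffX [(m + lead_monomial _ _ _)%MM]addmC eqxx.
have [e|_] := eqVneq (m + q)%MM (lead_monomial kappa b.1 1 + m)%MM; last first.
  by rewrite sub0r oppr_eq0 oner_eq0.
by move: qlt; rewrite (addIm (etrans (addmC _ _) e)) ltnn.
Qed.

Lemma minor_lead_max b b' m m' c m'' : b \in B 1 -> b' \in B 0 -> c \in B 0 ->
  minor_lead b m b' m' -> ('X_[m] * coef 0 b c)@_m'' != 0 ->
  (c, m'') = (b', m') \/ (rho c m'' < rho b' m')%N.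
Proof.
move=> bB; rewrite !basis0P => /eqP-> /eqP-> ->.
have [q [/= -> qlt]] := minor_terms bB.
rewrite mulrBr -!mpolyXD mcoeffB !mcoeffX [(m + lead_monomial _ _ _)%MM]addmC.
have [<- _|_] := eqVneq (m + q)%MM m''.
  by right; apply: rho_lt1; rewrite /= (xweightD m) (xweightD (lead_monomial _ _ _)); lia.
have [<- _|_] := eqVneq (lead_monomial kappa b.1 1 + m)%MM m''; first by left.
by rewrite subrr eqxx.
Qed.

Lemma minor_lead_onto b' m' : b' \in B 0 -> ~~ minor_nonlead m' ->
  exists2 b, b \in B 1 & exists m, minor_lead b m b' m'.
Proof.
rewrite basis0P => /eqP-> /forall_inPn[k kC /forall_inPn[l lC]].
rewrite negb_imply negbK => /andP[kl km].
exists ([set k; l], inord 1).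
  rewrite inE /= subUset !sub1set kC lC cards2 pair_neq //= inordK //.
  by have := ltn_ord l; lia.
by exists (m' - (xm k + ym l))%MM; rewrite /minor_lead /= pair_lead_monomial // addmC submK.
Qed.

Lemma minor_lead_inj b c b' m m1 m' : b \in B 1 -> c \in B 1 ->
  scroll_nonlead b m -> scroll_nonlead c m1 ->
  minor_lead b m b' m' -> minor_lead c m1 b' m' -> (b, m) = (c, m1).
Proof.
move=> /basis1P[k [l [kl kC lC ->]]] /basis1P[k1 [l1 [kl1 kC1 lC1 ->]]].
have i1 : (inord 1 : 'I_t.+1) = 1%N :> nat by rewrite inordK //; have := ltn_ord l; lia.
rewrite /scroll_nonlead /minor_lead /= i1 eqxx /= !pair_minset // !pair_lead_monomial //.
move=> /andP[/forall_inP nx /forall_inP ny] /andP[/forall_inP nx1 /forall_inP ny1] ->.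
move=> e.
have kk : k = k1.
  apply: val_inj => /=; case: (ltngtP k k1) => // h.
    have := nx1 k kC; rewrite h /= => /negP[].
    apply: (@colm_lem_add true k false l1) => //.
    apply: (@colm_lem_add true k true k1); first by rewrite xpair_eqE /= -val_eqE ltn_eqF.
    by rewrite addmA -e -addmA lem_addr.
  have := nx k1 kC1; rewrite h /= => /negP[].
  apply: (@colm_lem_add true k1 false l) => //.
  apply: (@colm_lem_add true k1 true k); first by rewrite xpair_eqE /= -val_eqE ltn_eqF.
  by rewrite addmA e -addmA lem_addr.
subst k1; move: e; rewrite -!addmA => /addmI e.
have ll : l = l1.
  apply: val_inj => /=; case: (ltngtP l l1) => // h.
    have := ny l1 lC1; rewrite h /= => /negP[].
    apply: (@colm_lem_add false l1 false l); first by rewrite xpair_eqE /= -val_eqE gtn_eqF.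
    by rewrite e lem_addr.
  have := ny1 l lC; rewrite h /= => /negP[].
  apply: (@colm_lem_add false l false l1); first by rewrite xpair_eqE /= -val_eqE gtn_eqF.
  by rewrite -e lem_addr.
by subst l1; rewrite (addmI e).
Qed.

End LeadingScroll.

(** * The scroll complex as a minimal resolution *)

Section ScrollResolution.

Variables (K : fieldType) (H : sgraph) (t : nat) (C : {set 'I_t}).
Variables (kappa : 'I_#|edges H| -> option ('I_t * bool)) (v : 'I_t -> nat).

Local Notation mdegree := (mono_degree (multidegree H)).
Local Notation xm := (colm kappa true).
Local Notation ym := (colm kappa false).
Local Notation LM b := (lead_monomial kappa b.1 b.2).

(* The toric ideal of [H] looks like that of the 2 x 2 minors of the matrix with
   columns (e^(v k) X_k, Y_k) for [k] in [C], divided by powers of e. Here X_k and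
   Y_k are the products of the variables coloured [(k, true)] and [(k, false)], and
   e is the product of the uncoloured ones. *)
Record scroll_data : Prop := ScrollData {
  sd_mono : forall k l : 'I_t, (k < l)%N -> (v k <= v l)%N;
  sd_nonempty : forall k (b : bool), k \in C -> exists i, kappa i = Some (k, b);
  sd_minor : forall k l, k \in C -> l \in C -> (k < l)%N ->
    mdegree (xm k) + mdegree (ym l) =
    mdegree (xm l) + mdegree (ym k) + mdegree (em kappa *+ (v l - v k))%MM;
  sd_fiber : forall m m', mdegree m = mdegree m' -> exists c : 'I_t -> int,
    [/\ \sum_(k in C) c k = 0,
        forall i k, kappa i = Some (k, true) -> (m i)%:Z = (m' i)%:Z + c k,
        forall i k, kappa i = Some (k, false) -> (m i)%:Z = (m' i)%:Z - c k &
        (forall k, k \in C -> c k = 0) -> m = m'] }.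

Hypothesis sd : scroll_data.

Let v_mono := sd_mono sd.
Let colm_nonempty := sd_nonempty sd.

Lemma colm_gt0 k b : k \in C -> exists i, colm kappa b k i = 1%N.
Proof. by case/(colm_nonempty b) => i ki; exists i; rewrite mnmE ki eqxx. Qed.

(** If c is not 0 on [C], its sum being 0 there are k and l in [C] with c k > 0 > c l. Then X_k Y_l
    divides [m] and X_l Y_k divides [m'], and one of these is excluded, depending on the order of k
    and l. Thus the minors form a Groebner basis of the toric ideal. *)
Lemma minor_nonlead_inj m m' : minor_nonlead C kappa m -> minor_nonlead C kappa m' ->
  mdegree m = mdegree m' -> m = m'.
Proof.
have lem2 k l m1 : (xm k <= m1)%MM -> (ym l <= m1)%MM -> (xm k + ym l <= m1)%MM.
  move=> /mnm_lepP h1 /mnm_lepP h2; apply/mnm_lepP => i; have := h1 i; have := h2 i.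
  by rewrite mnmDE !mnmE; case: (kappa i) => [[? []]|]; do ?case: eqP => //; lia.
move=> nm nm' /(sd_fiber sd)[c [c0 ct cf]]; apply.
have pos_lead k : 0 < c k -> (xm k <= m)%MM /\ (ym k <= m')%MM.
  move=> ck; split; apply/mnm_lepP => i; rewrite mnmE; case: eqP => // ki.
    by have := ct i k ki; lia.
  by have := cf i k ki; lia.
have neg_lead k : c k < 0 -> (ym k <= m)%MM /\ (xm k <= m')%MM.
  move=> ck; split; apply/mnm_lepP => i; rewrite mnmE; case: eqP => // ki.
    by have := cf i k ki; lia.
  by have := ct i k ki; lia.
have no k l : k \in C -> l \in C -> 0 < c k -> c l < 0 -> False.
  move=> kC lC ck cl; have [xk yk] := pos_lead k ck; have [yl xl] := neg_lead l cl.
  have [kl|lk|kl] := ltngtP k l.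
  - have := forall_inP (forall_inP nm k kC) l lC.
    by rewrite kl /= lem2.
  - have := forall_inP (forall_inP nm' l lC) k kC.
    by rewrite lk /= lem2.
  by move: cl; rewrite -(val_inj kl) lt_gtF.
have [/exists_inP[l lC cl]|/exists_inPn nneg] := boolP [exists l in C, c l < 0]; last first.
  by apply: psumr_eq0P c0 => k kC; rewrite leNgt nneg.
have [/exists_inP[k kC ck]|/exists_inPn npos] := boolP [exists k in C, 0 < c k].
  by have := no k l kC lC ck cl.
move=> k kC; apply/eqP; rewrite -oppr_eq0; apply/eqP.
apply: (psumr_eq0P (P := mem C) (F := fun k => - c k)) kC => [j jC|].
  by rewrite oppr_ge0 leNgt npos.
by rewrite sumrN c0 oppr0.
Qed.

Section Grading.

Variables (D : nmodType) (w : 'I_#|edges H| -> D).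
Hypothesis w_multidegree : forall m m' : 'X_{1..#|edges H|},
  mdegree m = mdegree m' -> mono_degree w m = mono_degree w m'.

Lemma deg_minor k l : k \in C -> l \in C -> (k < l)%N ->
  mono_degree w (xm k) + mono_degree w (ym l) =
  mono_degree w (xm l) + mono_degree w (ym k) +
  mono_degree w (em kappa *+ (v l - v k))%MM.
Proof.
move=> kC lC kl; rewrite -!mono_degreeD; apply: w_multidegree.
by rewrite !mono_degreeD (sd_minor sd).
Qed.

Definition scroll_free : free_seq K H D := {|
  rk := fun i => #|scroll_basis C i|;
  gdeg := fun i j => mono_degree w (LM (enum_val j));
  bd := fun i => \matrix_(j, k) scroll_coef K kappa v i (enum_val j) (enum_val k);
  aug := fun _ => 1 |}.

Lemma lead_monomial_all (T : {set 'I_t}) a : (#|T| <= a)%N ->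
  lead_monomial kappa T a = (\sum_(k in T) xm k)%MM.
Proof.
move=> Ta; apply: eq_bigr => k kT.
by rewrite (leq_trans (pos_lt kT) Ta).
Qed.

Lemma minor_homog b : b \in scroll_basis C 1 ->
  homog_between w 0 (mono_degree w (LM b)) (minor K kappa v b.1).
Proof.
move=> bB; have [bC cb /andP[a0 a1]] := basisP bB.
have -> : nat_of_ord b.2 = 1%N by apply/eqP; rewrite eqn_leq a1.
apply: homog_sum => k kb; rewrite (deg_ycoef (mono_degreeD w) deg_minor bC kb) ?cb //.
rewrite lead_monomial_all; last by rewrite -ltnS -cb (cardsD1 k b.1) kb.
by rewrite -mono_degreeD -[X in homog_between _ _ X]add0r; apply: homogZX.
Qed.

Lemma scroll_coef_homog i b b' : b \in scroll_basis C i.+1 -> b' \in scroll_basis C i ->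
  homog_between w (mono_degree w (LM b')) (mono_degree w (LM b))
    (scroll_coef K kappa v i b b').
Proof.
case: i => [|i] bB.
  rewrite basis0P => /eqP->; rewrite /= /lead_monomial /select big_set0 mono_degree0.
  exact: minor_homog.
move=> b'B; have [bC cb /andP[a0 ai]] := basisP bB.
apply: homog_sum => k /andP[kb /eqP eb'].
rewrite scalerDr !scalerA; apply: homogD.
  have [e|_] := eqVneq (nat_of_ord b.2) b'.2.+1; last by rewrite mulr0 scale0r; apply: homog0.
  rewrite (deg_xcoef (mono_degreeD w) deg_minor bC kb) // addrC eb' e.
  exact: homogZX.
have [e|_] := eqVneq (nat_of_ord b.2) b'.2; last by rewrite mulr0 scale0r; apply: homog0.
have [_ _ /andP[_ b'i]] := basisP b'B.
have bT : (b.2 < #|b.1|)%N by rewrite cb e ltnS (leq_trans b'i).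
rewrite (deg_ycoef (mono_degreeD w) deg_minor bC kb bT) addrC eb' e.
exact: homogZX.
Qed.

Lemma edge_map_minor b : b \in scroll_basis C 1 ->
  edge_map (minor K kappa v b.1) = 0.
Proof.
case/basis1P => k [l [kl kC lC ->]] /=; rewrite (minor_pair _ _ _ kl) edge_mapB !edge_mapX.
have kT : k \in [set k; l] by rewrite !inE eqxx.
have TC : [set k; l] \subset C by rewrite subUset !sub1set kC lC.
have c2 : (1 < #|[set k; l]|)%N by rewrite cards2 (pair_neq kl).
have minor_multi : forall k l, k \in C -> l \in C -> (k < l)%N ->
    mdegree (xm k) + mdegree (ym l) =
    mdegree (xm l) + mdegree (ym k) + mdegree (em kappa *+ (v l - v k))%MM.
  exact: (sd_minor sd).
rewrite -(pair_lead_monomial _ kl) (deg_ycoef (mono_degreeD _) minor_multi TC kT c2).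
rewrite (pair_delk kl) lead_monomial_all ?cards1 // big_set1 mono_degreeD.
by rewrite subrr.
Qed.

Lemma card_basis0 : #|scroll_basis C 0| = 1%N.
Proof.
rewrite (_ : scroll_basis C 0 = [set (set0, ord0)]) ?cards1 //.
by apply/setP => b; rewrite basis0P inE.
Qed.

Lemma aug_scroll (u : 'rV[{mpoly K[#|edges H|]}]_(rk scroll_free 0)) :
  aug_map (F := scroll_free) u = edge_map (\sum_j u 0 j).
Proof. by rewrite edge_map_sum; apply: eq_bigr => j _; rewrite mulr1. Qed.

(** The monomials in question have pairwise distinct images, so nothing can cancel. *)
Lemma edge_map_nonlead (q : {mpoly K[#|edges H|]}) :
  (forall m, q@_m != 0 -> minor_nonlead C kappa m) -> edge_map q = 0 -> q = 0.
Proof.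
move=> nq q0; apply/mpolyP => m; rewrite mcoeff0; apply/eqP/negbNE/negP => qm.
have := congr1 (mcoeff (vertex_exponent (mdegree m))) q0.
rewrite mcoeff_edge_map mcoeff0 (bigD1_seq m) ?msupp_uniq ?mcoeff_msupp //=.
rewrite eqxx mulr1 big_seq_cond big1 ?addr0; first by move/eqP; rewrite (negPf qm).
move=> m' /andP[]; rewrite mcoeff_msupp => qm' mm.
case: eqP => [/vertex_exponent_inj e|_]; last by rewrite mulr0.
by rewrite (minor_nonlead_inj (nq m' qm') (nq m qm) e) eqxx in mm.
Qed.

Lemma ord_basis0 (j k : 'I_#|scroll_basis C 0|) : j = k.
Proof.
apply: enum_val_inj; have := enum_valP j; have := enum_valP k.
by rewrite !basis0P => /eqP-> /eqP->.
Qed.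

Lemma scroll_free_comp i (u : 'rV[{mpoly K[#|edges H|]}]_(rk scroll_free i.+2)) :
  u *m bd scroll_free i.+1 *m bd scroll_free i = 0.
Proof.
rewrite -mulmxA (_ : bd scroll_free i.+1 *m bd scroll_free i = 0) ?mulmx0 //.
apply/matrixP => j k; rewrite !mxE.
under eq_bigr => l _ do rewrite !mxE.
rewrite -(big_enum_val (fun b => scroll_coef K kappa v i.+1 (enum_val j) b *
  scroll_coef K kappa v i b (enum_val k))).
by apply: scroll_coef_comp; rewrite ?enum_valP.
Qed.

Local Notation leadS i := (fun (j : 'I_(rk scroll_free i.+2)) m (k : 'I_(rk scroll_free i.+1)) m' =>
  scroll_lead kappa (enum_val j) m (enum_val k) m').
Local Notation rhoS i := (fun (k : 'I_(rk scroll_free i)) m => rho kappa (enum_val k) m).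

Lemma scroll_free_lead_coeff i (j : 'I_(rk scroll_free i.+2)) m (k : 'I_(rk scroll_free i.+1)) m' :
  leadS i j m k m' -> ('X_[m] * bd scroll_free i.+1 j k)@_m' != 0.
Proof. by rewrite mxE; apply: scroll_lead_coeff; apply: enum_valP. Qed.

Lemma scroll_free_lead_max i (j : 'I_(rk scroll_free i.+2)) m (k : 'I_(rk scroll_free i.+1)) m' :
  leadS i j m k m' -> forall l m'', ('X_[m] * bd scroll_free i.+1 j l)@_m'' != 0 ->
  (l, m'') = (k, m') \/ (rhoS i.+1 l m'' < rhoS i.+1 k m')%N.
Proof.
move=> ld l m''; rewrite mxE => nz.
have [|lt] := scroll_lead_max colm_nonempty (enum_valP j) (enum_valP k) (enum_valP l) ld nz.
  by case=> /enum_val_inj-> ->; left.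
by right.
Qed.

Lemma scroll_free_minor_coeff (j : 'I_(rk scroll_free 1)) m (k : 'I_(rk scroll_free 0)) m' :
  minor_lead kappa (enum_val j) m (enum_val k) m' -> ('X_[m] * bd scroll_free 0 j k)@_m' != 0.
Proof.
move=> ld; rewrite mxE.
exact: (minor_lead_coeff K v colm_nonempty (enum_valP j) ld).
Qed.

Lemma scroll_free_minor_max (j : 'I_(rk scroll_free 1)) m (k : 'I_(rk scroll_free 0)) m' :
  minor_lead kappa (enum_val j) m (enum_val k) m' ->
  forall l m'', ('X_[m] * bd scroll_free 0 j l)@_m'' != 0 ->
  (l, m'') = (k, m') \/ (rhoS 0 l m'' < rhoS 0 k m')%N.
Proof.
move=> ld l m''; rewrite mxE => nz.
have [|lt] := minor_lead_max colm_nonempty (enum_valP j) (enum_valP k) (enum_valP l) ld nz.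
  by case=> /enum_val_inj-> ->; left.
by right.
Qed.

Lemma scroll_free_reduce i (u : 'rV[{mpoly K[#|edges H|]}]_(rk scroll_free i.+1)) :
  exists u', supported (fun k m => scroll_nonlead C kappa (enum_val k) m)
    (u - u' *m bd scroll_free i.+1).
Proof.
apply: (reduce_nonleading (@scroll_free_lead_coeff i) (@scroll_free_lead_max i)) => k m nk.
have [b bB [m' ld]] := scroll_lead_onto (enum_valP k) nk.
by exists (enum_rank_in bB b), m'; rewrite /= enum_rankK_in.
Qed.

Lemma scroll_free_inject i (u : 'rV[{mpoly K[#|edges H|]}]_(rk scroll_free i.+1)) :
  supported (fun k m => scroll_nonlead C kappa (enum_val k) m) u ->
  u *m bd scroll_free i = 0 -> u = 0.
Proof.
case: i u => [|i] u.
  apply: (nonleading_injective scroll_free_minor_coeff scroll_free_minor_max) => [j m nj|].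
    have b0 : (set0, ord0) \in scroll_basis C 0 by rewrite basis0P.
    by exists (enum_rank_in b0 (set0, ord0)), (lead_monomial kappa (enum_val j).1 1 + m)%MM.
  move=> j m j1 m1 k m' nj nj1 ld ld1.
  have := minor_lead_inj (enum_valP j) (enum_valP j1) nj nj1 ld ld1.
  by case=> /enum_val_inj-> ->.
apply: (nonleading_injective (@scroll_free_lead_coeff i) (@scroll_free_lead_max i)) => [j m nj|].
  have [b bB [m' ld]] := scroll_lead_exists kappa m (enum_valP j).
  by exists (enum_rank_in bB b), m'; rewrite /= enum_rankK_in.
move=> j m j1 m1 k m' nj nj1 ld ld1.
have := scroll_lead_inj (enum_valP j) (enum_valP j1) nj nj1 ld ld1.
by case=> /enum_val_inj-> ->.
Qed.

Lemma scroll_free_reduce0 (u : 'rV[{mpoly K[#|edges H|]}]_(rk scroll_free 0)) :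
  exists u', supported (fun k m => minor_nonlead C kappa m) (u - u' *m bd scroll_free 0).
Proof.
apply: (reduce_nonleading scroll_free_minor_coeff scroll_free_minor_max) => k m nk.
have [b bB [m' ld]] := minor_lead_onto (enum_valP k) nk.
by exists (enum_rank_in bB b), m'; rewrite /= enum_rankK_in.
Qed.

(** Exactness combines two facts: modulo boundaries, a cycle is supported on terms that are not
    leading terms of the incoming differential, and the outgoing map is injective on such
    vectors. *)
Lemma scroll_resolution : resolution w scroll_free.
Proof.
have j0 : 'I_(rk scroll_free 0) by rewrite /= card_basis0; apply: ord0.
have aug_bd (u : 'rV_(rk scroll_free 1)) : aug_map (F := scroll_free) (u *m bd scroll_free 0) = 0.
  rewrite aug_map_mul big1 // => j _; rewrite aug_scroll.
  rewrite (bigD1 j0) //= big1 => [|k]; last by rewrite (ord_basis0 k j0) eqxx.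
  by rewrite addr0 !mxE edge_map_minor ?mulr0 // enum_valP.
split.
- by move=> i j k; rewrite mxE; apply: scroll_coef_homog; apply: enum_valP.
- move=> j; exists 1; rewrite edge_map1; split=> //=.
  have := enum_valP j; rewrite basis0P => /eqP->.
  by rewrite /lead_monomial /select big_set0 mono_degree0; apply: homog1.
- move=> p; split=> [[q ->]|[u ->]]; last by rewrite aug_scroll; exists (\sum_j u 0 j).
  exists (const_mx q); rewrite aug_scroll (bigD1 j0) //= big1 => [|k].
    by rewrite addr0 mxE.
  by rewrite (ord_basis0 k j0) eqxx.
- move=> u; split=> [u0|[u' ->]]; last exact: aug_bd.
  have [u' su'] := scroll_free_reduce0 u; exists u'; apply/eqP; rewrite -subr_eq0; apply/eqP.
  apply/rowP => k; rewrite [RHS]mxE; apply: edge_map_nonlead => [m|]; first exact: su'.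
  have : aug_map (F := scroll_free) (u - u' *m bd scroll_free 0) = 0.
    by rewrite aug_mapB u0 aug_bd subr0.
  rewrite aug_scroll (bigD1 k) //= big1 ?addr0 // => l.
  by rewrite (ord_basis0 l k) eqxx.
move=> i u; split=> [u0|[u' ->]]; last exact: scroll_free_comp.
have [u' su'] := scroll_free_reduce u; exists u'; apply/eqP; rewrite -subr_eq0; apply/eqP.
apply: scroll_free_inject su' _.
by rewrite mulmxBl u0 scroll_free_comp subr0.
Qed.

(** Every term of a coefficient is divisible by some X_k or Y_k with k in [C], and these contain at
    least one variable. *)
Lemma scroll_coef_minimal i b b' : b \in scroll_basis C i.+1 ->
  (scroll_coef K kappa v i b b')@_0%MM = 0.
Proof.
move=> bB; have [bC cb _] := basisP bB.
have colm_add_neq0 bb k m : k \in C -> ((colm kappa bb k + m)%MM == 0%MM) = false.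
  move=> kC; have [i0 ki] := colm_gt0 bb kC; apply/eqP => /mnmP/(_ i0).
  by rewrite mnmDE mnm0E ki.
case: i bB cb => [|i] bB cb; rewrite /= mcoeff_sum big1 // => k.
  move=> kb; rewrite mcoeffZ mcoeffX -addmA colm_add_neq0 ?mulr0 //.
  exact: (subsetP bC).
case/andP => kb _; rewrite mcoeffZ mcoeffD !mcoeffZ !mcoeffX.
by rewrite !colm_add_neq0 ?(subsetP bC) // !mulr0 addr0 mulr0.
Qed.

Lemma scroll_betti i h :
  betti K H w i h = #|[set b in scroll_basis C i | mono_degree w (LM b) == h]|.
Proof.
rewrite (bettiE w_multidegree _ _ scroll_resolution).
rewrite (tor_dim_minimal _ _ scroll_resolution); last first.
  by move=> j k l; rewrite mxE scroll_coef_minimal // enum_valP.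
rewrite -[LHS](card_imset _ enum_val_inj); apply: eq_card => b.
rewrite !inE; apply/imsetP/andP => [[j]|[bB bh]].
  by rewrite inE => jh ->; split=> //; have := enum_valP j; rewrite inE.
have bB' : b \in scroll_basis C i by rewrite inE.
by exists (enum_rank_in bB' b); rewrite ?inE /= enum_rankK_in.
Qed.

End Grading.

End ScrollResolution.

(** * Projective dimension and top support *)

Section ScrollTop.

Variables (K : fieldType) (H : sgraph) (t : nat) (C : {set 'I_t}).
Variables (kappa : 'I_#|edges H| -> option ('I_t * bool)) (v : 'I_t -> nat).
Hypothesis sd : scroll_data C kappa v.

Local Notation mdegree := (mono_degree (multidegree H)).
Local Notation LM b := (lead_monomial kappa b.1 b.2).

Lemma lead_monomialE T a i k b : kappa i = Some (k, b) ->
  lead_monomial kappa T a i = ((k \in T) && ((pos T k < a)%N == b)) :> nat.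
Proof.
move=> ki; rewrite /lead_monomial /select mnm_sumE.
have [kT|kT] /= := boolP (k \in T).
  rewrite (bigD1 k) //= mnmE ki big1 ?addn0.
    by congr nat_of_bool; apply/eqP/eqP => [[->]|->].
  move=> j /andP[_ jk]; rewrite mnmE ki; case: eqP => // -[kj _].
  by rewrite kj eqxx in jk.
rewrite big1 // => j jT; rewrite mnmE ki; case: eqP => // -[kj _].
by rewrite kj jT in kT.
Qed.

(** The exponents of a variable of X_k and of one of Y_k add up to 1 or 0 according as k lies in the
    set or not, and c cancels in this sum; hence the sets agree. *)
Lemma lead_degree_inj i b b' : b \in scroll_basis C i.+1 -> b' \in scroll_basis C i.+1 ->
  mdegree (LM b) = mdegree (LM b') -> b = b'.
Proof.
move=> bB b'B /(sd_fiber sd)[c [c0 ct cf _]].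
have [bC cb /andP[a0 ai]] := basisP bB; have [b'C cb' /andP[a0' ai']] := basisP b'B.
have eT : b.1 = b'.1.
  apply/setP => k; have [kC|kC] := boolP (k \in C); last first.
    by rewrite (contraNF (subsetP bC k) kC) (contraNF (subsetP b'C k) kC).
  have [i1 k1] := sd_nonempty sd true kC; have [i2 k2] := sd_nonempty sd false kC.
  have := ct i1 k k1; have := cf i2 k k2; rewrite !(lead_monomialE _ _ k1) !(lead_monomialE _ _ k2).
  by case: (k \in b.1); case: (k \in b'.1) => //=;
    case: (_ < _)%N => //=; try case: (_ < _)%N => //=; lia.
have cE k : k \in b.1 -> c k = (pos b.1 k < b.2)%N%:Z - (pos b.1 k < b'.2)%N%:Z.
  move=> kb; have [i1 k1] := sd_nonempty sd true (subsetP bC k kb).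
  have := ct i1 k k1; rewrite !(lead_monomialE _ _ k1) -eT kb /= !eqb_id.
  by lia.
have c0' k : k \notin b.1 -> k \in C -> c k = 0.
  move=> kb kC; have [i1 k1] := sd_nonempty sd true kC.
  by have := ct i1 k k1; rewrite !(lead_monomialE _ _ k1) -eT (negPf kb) /=; lia.
suff e2 : b.2 = b'.2 by rewrite [b]surjective_pairing [b']surjective_pairing eT e2.
apply: val_inj => /=; apply/eqP; rewrite -[_ == _]negbK neq_ltn; apply/negP => lt.
(* On the common set, c is the difference of the indicators of two initial segments. It thus has
   constant sign, and sum 0 makes it vanish. *)
have cpos : (forall k, k \in C -> 0 <= c k) \/ (forall k, k \in C -> 0 <= - c k).
  case/orP: lt => lt; [right|left] => k kC;
    have [kb|kb] := boolP (k \in b.1); try (by rewrite (c0' k) ?oppr0);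
    rewrite cE //; have [h|h] := ltnP (pos b.1 k) b.2;
    have [h'|h'] := ltnP (pos b.1 k) b'.2 => //.
    by have := ltn_trans lt (leq_ltn_trans h' h); rewrite ltnn.
  by have := ltn_trans lt (leq_ltn_trans h h'); rewrite ltnn.
have call k : k \in C -> c k = 0.
  case: cpos => cpos kC; first exact: psumr_eq0P c0 k kC.
  apply/eqP; rewrite -oppr_eq0; apply/eqP.
  by apply: (psumr_eq0P (P := mem C) (F := fun k => - c k)) kC => //; rewrite sumrN c0 oppr0.
(* If the indices differed, this column would lie in exactly one of the two initial segments. *)
have [k kb kp] : exists2 k, k \in b.1 & pos b.1 k = minn b.2 b'.2.
  by apply: pos_surj; rewrite cb gtn_min ltnS ai.
have := call k (subsetP bC k kb); rewrite cE // kp !gtn_min !ltnn orbF /=.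
by case/orP: lt => lt; rewrite lt ltnNge (ltnW lt).
Qed.

(** A shorter resolution would have no Betti number in homological degree [p], whereas the basis
    vector (C, 1) produces one. *)
Lemma scroll_pdim p : #|C| = p.+1 -> (0 < p)%N -> is_pdim K H p.
Proof.
move=> cC p0; split.
  exists (scroll_free K C kappa v (multidegree H)); split; first exact: scroll_resolution.
  move=> i pi /=; apply/eqP; rewrite cards_eq0; apply/eqP/setP => b; rewrite in_set0.
  apply/negP; case: i pi => // i pi /basisP[bC cb _].
  by have := subset_leq_card bC; rewrite cb cC; lia.
move=> q [F [rF Fq]]; rewrite leqNgt; apply/negP => qp.
case: p cC p0 qp => // p cC _ qp.
have tp : (1 < t.+1)%N by have := max_card (mem C); rewrite card_ord cC; lia.
pose b := (C, Ordinal tp) : scroll_index t.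
have bB : b \in scroll_basis C p.+1 by rewrite inE /= subxx cC eqxx.
have := scroll_betti K sd (w := multidegree H) (fun m m' e => e) p.+1 (mdegree (LM b)).
rewrite (bettiE _ _ _ rF) // /tor_dim.
have -> : \rank (tor_cycles F p.+1 (mdegree (LM b))) = 0%N.
  by apply/eqP; rewrite -leqn0 -(Fq p.+1 qp) rank_leq_col.
rewrite sub0n => /esym/eqP; rewrite cards_eq0 => /eqP/setP/(_ b).
by rewrite inE bB eqxx inE.
Qed.

Lemma scroll_top_support p h : #|C| = p.+1 -> (0 < p)%N ->
  top_support K h <-> exists2 b, b \in scroll_basis C p & h = mdegree (LM b).
Proof.
move=> cC p0; have pd := scroll_pdim cC p0; split.
  case=> q [[rq mq] /eqP]; have [rp mp] := pd.
  have -> : q = p by apply/eqP; rewrite eqn_leq mq // mp.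
  rewrite (scroll_betti K sd) // -lt0n => /card_gt0P[b]; rewrite inE => /andP[bB /eqP <-].
  by exists b.
case=> b bB ->; exists p; split=> //; apply/eqP.
rewrite (scroll_betti K sd) // -lt0n; apply/card_gt0P; exists b.
by rewrite inE bB eqxx.
Qed.

End ScrollTop.

(** * The structure of compact graphs with at most two big vertices *)

Section Arms.

Variable G : sgraph.
Implicit Types (x y z : G) (p : seq G).

Definition nbrs x : {set G} := [set y | adj x y].
Definition big : {set G} := [set x : G | (2 < degree x)%N].

Hypothesis deg2 : forall x : G, (2 <= degree x)%N.
Hypothesis no_even_cycle : forall c : seq G, is_cycle c -> odd (size c).

Lemma nonbig_nbrs x y z : x \notin big -> adj x y -> adj x z -> y != z ->
  forall a, adj x a = (a == y) || (a == z).
Proof.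
move=> xB xy xz yz a.
have c2 : #|nbrs x| = 2%N.
  by apply/eqP; rewrite eqn_leq deg2 andbT leqNgt; rewrite inE in xB.
have : [set y; z] == nbrs x.
  by rewrite eqEcard subUset !sub1set !inE xy xz c2 cards2 yz.
by move/eqP/setP/(_ a); rewrite !inE => ->.
Qed.

Lemma nonbig_other x y : x \notin big -> adj x y -> exists2 z, adj x z & y != z.
Proof.
move=> xB xy; have : (0 < #|nbrs x :\ y|)%N.
  have := deg2 x; rewrite /degree -/(nbrs x) (cardsD1 y (nbrs x)) inE xy /=.
  by rewrite add1n ltnS.
by case/card_gt0P => z; rewrite !inE => /andP[zy xz]; exists z; rewrite // eq_sym.
Qed.

(* [p] lists the inner vertices of a path from [b] to [b'], or of a cycle through
   [b] if [b' = b]; [arm_simple] then excludes going back along an edge. *)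
Record arm (b : G) p (b' : G) : Prop := Arm {
  arm_big : b \in big;
  arm_big' : b' \in big;
  arm_neq0 : p != [::];
  arm_nonbig : {in p, forall x, x \notin big};
  arm_uniq : uniq p;
  arm_path : path (@adj G) b (rcons p b');
  arm_simple : size p = 1%N -> b != b' }.

Local Notation L b p b' := (b :: rcons p b').

Lemma walk_nbr b p b' i x0 : {in p, forall x, x \notin big} -> uniq p -> b \in big ->
  path (@adj G) b (rcons p b') -> (i < size p)%N ->
  nth x0 (L b p b') i != nth x0 (L b p b') i.+2 ->
  forall y, adj (nth x0 (L b p b') i.+1) y =
    (y == nth x0 (L b p b') i) || (y == nth x0 (L b p b') i.+2).
Proof.
move=> nb up bB pth ip ne; apply: nonbig_nbrs => //.
- by rewrite /= nth_rcons ip nb // mem_nth.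
- rewrite adj_sym; have := pathP x0 pth i; rewrite size_rcons => /(_ (ltnW ip)) /=.
  by [].
by have := pathP x0 pth i.+1; rewrite size_rcons ltnS => /(_ ip).
Qed.

Lemma arm_nbr b p b' i x0 : arm b p b' -> (i < size p)%N ->
  forall y, adj (nth x0 (L b p b') i.+1) y =
    (y == nth x0 (L b p b') i) || (y == nth x0 (L b p b') i.+2).
Proof.
case=> bB b'B p0 nb up pth sp ip; apply: walk_nbr => //.
case: i ip => [|i] ip /=.
  have [p1|p1] := ltnP 1 (size p).
    rewrite nth_rcons p1; apply: contraTneq bB => ->.
    by apply: nb; rewrite mem_nth.
  have e1 : size p = 1%N by lia.
  by rewrite nth_rcons e1 /=; apply: sp.
rewrite !nth_rcons (ltnW ip); case: (ltnP i.+2 (size p)) => ip2.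
  rewrite nth_uniq //; [by rewrite ltn_eqF | exact: ltnW].
have -> : i.+2 = size p by lia.
rewrite eqxx; apply: contraTneq b'B => <-.
by apply: nb; rewrite mem_nth // ltnW.
Qed.

Lemma uniq_size p : uniq p -> (size p <= #|G|)%N.
Proof. by move/card_uniqP<-; apply: max_card. Qed.

(** A walk from a big vertex through other vertices continues until it meets a big vertex again; [n]
    bounds the number of remaining steps. *)
Lemma arm_extend n (b w : G) p : (#|G| < size p + n)%N -> b \in big -> (0 < size p)%N ->
  {in p, forall x, x \notin big} -> uniq p -> path (@adj G) b p ->
  exists s b', arm b (p ++ s) b'.
Proof.
elim: n p => [|n IH] p sn bB p0 nb up pth.
  by have := uniq_size up; rewrite leqNgt; move: sn; rewrite addn0 => ->.
pose x := last b p.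
have lastE a : nth a (b :: p) (size p) = x by rewrite nth_last.
have lastP : nth w p (size p).-1 = x by rewrite -(lastE w) -[in RHS](prednK p0).
have xp : x \in p by rewrite -lastP mem_nth // prednK.
pose prv := nth w (b :: p) (size p).-1.
have xprv : adj x prv.
  rewrite adj_sym -(lastE w) -(prednK p0); apply: (pathP w pth).
  by rewrite prednK.
have [z xz pz] := nonbig_other (nb x xp) xprv.
have pthz : path (@adj G) b (rcons p z) by rewrite rcons_path pth.
have [zB|zB] := boolP (z \in big).
  exists [::], z; rewrite cats0; split=> // [|p1]; first by rewrite -size_eq0 -lt0n.
  by move: pz; rewrite /prv p1.
have zp : z \notin p.
  (* If [z] were on the path already, [x] would be one of the two neighbours that [z] has there.
     Being the last vertex, [x] cannot precede [z], and if it follows [z], then [z] is the vertex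
     from which [x] was reached. *)
  apply/negP => zp; pose j := index z p; have jp : (j < size p)%N by rewrite index_mem.
  have zj : nth w p j = z by apply: nth_index.
  have jlt : (j.+1 < size p)%N.
    rewrite ltn_neqAle jp andbT; apply/eqP => js.
    have : z = x by rewrite -zj -(lastE w) -js.
    by move=> zx; rewrite zx adj_irr in xz.
  have step : nth w (b :: rcons p z) j != nth w (b :: rcons p z) j.+2.
    rewrite [nth _ _ j.+2]/= nth_rcons jlt; case: (j) jlt => [|k] jlt.
      by apply: contraTneq bB => /= ->; apply: nb; rewrite mem_nth.
    rewrite /= nth_rcons (ltn_trans (ltnSn _) (ltn_trans (ltnSn _) jlt)).
    by rewrite nth_uniq ?ltn_eqF // (ltn_trans (ltnSn _) (ltn_trans (ltnSn _) jlt)).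
  have := walk_nbr nb up bB pthz jp step x.
  have -> : nth w (b :: rcons p z) j.+1 = z by rewrite /= nth_rcons jp zj.
  rewrite adj_sym xz => /esym/orP[]/eqP.
    case: (j) jp => [|k] jp /=; first by move=> xb; have := nb x xp; rewrite xb bB.
    rewrite nth_rcons (ltnW jp) -lastP => /eqP.
    by rewrite nth_uniq ?(ltnW jp) ?prednK // => /eqP e; move: jp; rewrite -e prednK // ltnn.
  rewrite /= nth_rcons jlt -lastP => /eqP; rewrite nth_uniq ?prednK // => /eqP e.
  by case/eqP: pz; rewrite /prv e /= zj.
have [||||||s [b' ar]] := IH (rcons p z); rewrite ?size_rcons //.
- by rewrite addSnnS.
- by move=> y; rewrite mem_rcons inE => /predU1P[->|/nb].
- by rewrite rcons_uniq zp up.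
by exists (z :: s), b'; rewrite -cat_rcons.
Qed.

Lemma arm_exists (b w : G) : b \in big -> w \notin big -> adj b w ->
  exists s b', arm b (w :: s) b'.
Proof.
move=> bB wB bw; apply: (@arm_extend #|G| b w [:: w]) => //=.
- by move=> x; rewrite inE => /eqP->.
- by rewrite bw.
Qed.

Lemma arm_rev b p b' : arm b p b' -> arm b' (rev p) b.
Proof.
case=> bB b'B p0 nb up pth sp; split=> //.
- by rewrite -size_eq0 size_rev size_eq0.
- by move=> x; rewrite mem_rev => /nb.
- by rewrite rev_uniq.
- have := rev_path (@adj G) b (rcons p b'); rewrite last_rcons belast_rcons rev_cons => ->.
  by rewrite (eq_path (e' := @adj G)) // => x y; apply: adj_sym.
by rewrite size_rev eq_sym.
Qed.

End Arms.

(** * Arms as components of the graph without its big vertices *)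

Section Components.

Variable G : sgraph.
Implicit Types (x y z w : G) (p : seq G).

Hypothesis deg2 : forall x : G, (2 <= degree x)%N.
Hypothesis no_even_cycle : forall c : seq G, is_cycle c -> odd (size c).
Hypothesis G_connected : forall x y : G, connect (@adj G) x y.
Hypothesis G_odd_cycles : odd_cycle_condition G.
Hypothesis big_gt0 : (0 < #|big G|)%N.
Hypothesis big_le2 : (#|big G| <= 2)%N.

Local Notation B := (big G).

Definition nbadj x y := [&& adj x y, x \notin B & y \notin B].

(** An arm is identified by its vertex set, which is independent of the direction of travel;
    [comp_arm] recovers a list where the order matters. *)
Definition comp w : {set G} := [set y | connect nbadj w y].

Lemma nbadj_sym : connect_sym nbadj.
Proof.
by apply: sym_connect_sym => x y; rewrite /nbadj adj_sym [_ && (_ \notin _)]andbC.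
Qed.

Lemma comp_refl w : w \in comp w.
Proof. by rewrite inE connect0. Qed.

Lemma comp_eq w x : x \in comp w -> comp x = comp w.
Proof.
rewrite inE => wx; apply/setP => y; rewrite !inE.
by rewrite (same_connect nbadj_sym wx).
Qed.

Lemma comp_nonbig w x : w \notin B -> x \in comp w -> x \notin B.
Proof.
move=> wB; rewrite inE => /connectP[p pth ->]; elim: p w wB pth => //= y p IH w wB.
by case/andP => /and3P[_ _ yB]; apply: IH.
Qed.

Lemma comp_adj w x y : w \notin B -> x \in comp w -> adj x y -> y \notin B -> y \in comp w.
Proof.
move=> wB xw xy yB; have xB := comp_nonbig wB xw.
move: xw; rewrite !inE => /connect_trans; apply; apply: connect1.
by rewrite /nbadj xy xB.
Qed.

Lemma arm_closed b p b' x y : arm b p b' -> x \in p -> adj x y -> y \notin B -> y \in p.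
Proof.
move=> ar xp xy yB; have ip : (index x p < size p)%N by rewrite index_mem.
have := arm_nbr deg2 x ar ip y.
have -> : nth x (b :: rcons p b') (index x p).+1 = x by rewrite /= nth_rcons ip nth_index.
rewrite xy => /esym/orP[]/eqP e.
  move: e yB; case: (index x p) ip => [|i] ip /= ->; first by rewrite (arm_big ar).
  by rewrite nth_rcons (ltnW ip) mem_nth // ltnW.
move: e yB; rewrite /= nth_rcons; case: ltnP => [lt -> _|le]; first exact: mem_nth.
have -> : (index x p).+1 == size p by rewrite eqn_leq ip le.
by move=> ->; rewrite (arm_big' ar).
Qed.

Lemma arm_to_big b p b' x z : arm b p b' -> x \in p -> adj x z -> z \in B ->
  (z = b /\ x = nth x p 0) \/ (z = b' /\ x = nth x p (size p).-1).
Proof.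
move=> ar xp xz zB; have ip : (index x p < size p)%N by rewrite index_mem.
have := arm_nbr deg2 x ar ip z.
have xE : nth x (b :: rcons p b') (index x p).+1 = x by rewrite /= nth_rcons ip nth_index.
rewrite xE xz => /esym/orP[]/eqP e; [left|right].
  case: (index x p) ip xE e => [|i] ip xE /= e.
    by split=> //; move: xE; rewrite /= nth_rcons ip.
  by move: zB; rewrite e nth_rcons (ltnW ip) (negPf (arm_nonbig ar _)) // mem_nth // ltnW.
move: e; rewrite /= nth_rcons; case: ltnP => [lt e|le].
  by move: zB; rewrite e (negPf (arm_nonbig ar _)) // mem_nth.
have e : (index x p).+1 = size p by apply/eqP; rewrite eqn_leq ip le.
by rewrite e eqxx => ->; rewrite -e /= nth_index.
Qed.

Lemma arm_comp b p b' x : arm b p b' -> x \in p -> comp x = [set y in p].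
Proof.
move=> ar xp; apply/setP => y; rewrite !inE; apply/idP/idP.
  case/connectP => q pth ->; elim: q x xp pth => //= z q IH x xp /andP[/and3P[xz _ zB] pth].
  by apply: IH pth; apply: arm_closed ar xp xz zB.
case: p ar xp => // w p ar; move: (arm_path ar) (arm_nonbig ar).
rewrite rcons_cons /= => /andP[_]; rewrite rcons_path => /andP[pth _] nb.
have nbp : path nbadj w p.
  elim: p w pth nb {ar} => //= z p IH w /andP[wz pth] nb.
  rewrite /nbadj wz !nb ?inE ?eqxx ?orbT //=; apply: IH => // a ap.
  by apply: nb; rewrite inE ap orbT.
have cw a : a \in w :: p -> connect nbadj w a by apply: path_connect.
by move=> xp yp; apply: connect_trans (cw y yp); rewrite nbadj_sym; apply: cw.
Qed.

(** By connectedness the component has a vertex next to a big one. The arm starting there is closed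
    under nonbig neighbours, so it exhausts the component. *)
Lemma comp_arm w : w \notin B -> exists b p b', arm b p b' /\ comp w = [set y in p].
Proof.
move=> wB; have [/exists_inP[x xw /exists_inP[b bB bx]]|/exists_inPn no] :=
  boolP [exists x in comp w, [exists b in B, adj b x]].
  have [s [b' ar]] := arm_exists deg2 bB (comp_nonbig wB xw) bx.
  exists b, (x :: s), b'; split=> //.
  by rewrite -(comp_eq xw); apply: arm_comp ar _; rewrite mem_head.
have cl : closed (@adj G) (mem (comp w)).
  apply: intro_closed; first by apply: sym_connect_sym; apply: adj_sym.
  move=> x y xy xw; apply: (comp_adj wB xw xy); apply/negP => yB.
  by have /exists_inPn/(_ y yB) := no x xw; rewrite adj_sym xy.
have /card_gt0P[b bB] := big_gt0.
have := closed_connect cl (G_connected w b); rewrite comp_refl => /esym bw.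
by have := comp_nonbig wB bw; rewrite bB.
Qed.

Lemma loop_cycle b p : arm b p b -> is_cycle (b :: p).
Proof.
move=> ar; rewrite /is_cycle /ucycleb /= (arm_path ar) (arm_uniq ar) andbT /=.
have pb : b \notin p by apply: contraTN (arm_big ar); apply: arm_nonbig ar _.
rewrite pb andbT ltnS; case: p ar {pb} => [|x [|y p]] ar //.
  by have := arm_neq0 ar.
by have := arm_simple ar (erefl _); rewrite eqxx.
Qed.

Lemma chord_cycle b p b' : arm b p b' -> b != b' -> adj b b' -> is_cycle (b :: rcons p b').
Proof.
move=> ar bb' abb'; rewrite /is_cycle /ucycleb /= size_rcons ltnS rcons_path.
rewrite (arm_path ar) last_rcons adj_sym abb' mem_rcons inE (negPf bb') /= rcons_uniq.
rewrite (arm_uniq ar) andbT !ltnS.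
have -> : b \notin p by apply: contraTN (arm_big ar); apply: arm_nonbig ar _.
have -> : b' \notin p by apply: contraTN (arm_big' ar); apply: arm_nonbig ar _.
by rewrite /= andbT lt0n size_eq0 (arm_neq0 ar).
Qed.

Lemma theta_cycle b p q b' : arm b p b' -> arm b q b' -> b != b' ->
  (forall x, x \in p -> x \in q -> False) ->
  is_cycle (b :: p ++ b' :: rev q).
Proof.
move=> ap aq bb' dpq.
have nb (r : seq G) z : arm b r b' -> z \in B -> z \notin r.
  by move=> ar zB; apply: contraTN zB; apply: arm_nonbig ar _.
rewrite /is_cycle /ucycleb /= size_cat /= size_rev; apply/andP; split.
  by rewrite addnS !ltnS addn_gt0 lt0n size_eq0 (arm_neq0 ap).
rewrite rcons_cat cat_path /= -cat_rcons; apply/andP; split.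
  have := arm_path ap; rewrite rcons_path => /andP[-> /= ->] /=.
  exact: arm_path (arm_rev aq).
rewrite cat_rcons mem_cat in_cons mem_rev (negPf bb') !negb_or !nb ?(arm_big ap) // cat_uniq /=.
rewrite (arm_uniq ap) rev_uniq (arm_uniq aq) mem_rev nb ?(arm_big' aq) //= !andbT.
rewrite negb_or nb ?(arm_big' ap) //=; apply/hasPn => x; rewrite mem_rev => xq.
by apply/negP => /= xp; apply: dpq xp xq.
Qed.

End Components.

(** * Adjacency of the big vertices and the colouring of the edges *)

Section Colouring.

Variable G : sgraph.
Implicit Types (x y z w : G) (p : seq G).

Hypothesis deg2 : forall x : G, (2 <= degree x)%N.
Hypothesis no_even_cycle : forall c : seq G, is_cycle c -> odd (size c).
Hypothesis G_connected : forall x y : G, connect (@adj G) x y.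
Hypothesis G_odd_cycles : odd_cycle_condition G.
Hypothesis big_le2 : (#|big G| <= 2)%N.

Local Notation B := (big G).

Lemma big_pair u v : u \in B -> v \in B -> u != v -> B = [set u; v].
Proof.
move=> uB vB uv; apply/esym/eqP; rewrite eqEcard subUset !sub1set uB vB.
by rewrite cards2 uv.
Qed.

Lemma arm_disjoint b p q x y z1 z2 : arm b (x :: p) z1 -> arm b (y :: q) z2 ->
  x != y -> z1 != b -> forall z, z \in x :: p -> z \in y :: q -> False.
Proof.
move=> ap aq xy z1b z zp zq.
have /setP/(_ y) := etrans (esym (arm_comp deg2 ap zp)) (arm_comp deg2 aq zq).
rewrite !inE eqxx /= => yp.
have yb : adj y b by rewrite adj_sym; have := arm_path aq; case/andP.
have [[_ e]|[e _]] := arm_to_big deg2 ap yp yb (arm_big ap).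
  by rewrite e /= eqxx in xy.
by rewrite e eqxx in z1b.
Qed.

(** Three arms start at [u], as all its neighbours are nonbig. If they all ended at [v], two of them
    would have lengths of the same parity and form an even cycle. *)
Lemma loop_exists u v : u \in B -> v \in B -> u != v -> ~~ adj u v ->
  exists p, arm u p u.
Proof.
move=> uB vB uv auv; have BE := big_pair uB vB uv.
have nbN x : adj u x -> x \notin B.
  move=> ux; rewrite BE !inE negb_or; apply/andP; split.
    by apply: contraTneq ux => ->; rewrite adj_irr.
  by apply: contraNneq auv => <-.
have armN x : adj u x -> exists s b', arm u (x :: s) b'.
  by move=> ux; apply: arm_exists => //; apply: nbN.
have enumN : (2 < size (enum (nbrs u)))%N by rewrite -cardE; rewrite inE in uB.
have uniqN := enum_uniq (nbrs u).
have memN x : x \in enum (nbrs u) -> adj u x by rewrite mem_enum inE.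
case: (enum _) enumN uniqN memN => [|x1 [|x2 [|x3 r]]] // _ uN memN.
have [s1 [b1 a1]] := armN x1 (memN x1 (mem_head _ _)).
have [|s2 [b2 a2]] := armN x2; first by apply: memN; rewrite !inE eqxx orbT.
have [|s3 [b3 a3]] := armN x3; first by apply: memN; rewrite !inE eqxx !orbT.
have endE x s b : arm u (x :: s) b -> (exists p, arm u p u) \/ b = v.
  move=> a; have := arm_big' a; rewrite BE !inE => /orP[]/eqP e; [left|right] => //.
  by exists (x :: s); rewrite -{2}e.
have [//|e1] := endE _ _ _ a1; have [//|e2] := endE _ _ _ a2.
have [//|e3] := endE _ _ _ a3; subst b1 b2 b3.
have vu : v != u by rewrite eq_sym.
have par x s y r' : arm u (x :: s) v -> arm u (y :: r') v -> x != y ->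
    odd (size s) != odd (size r').
  move=> ax ay xy; apply/negP => /eqP e.
  have := no_even_cycle (theta_cycle ax ay uv (arm_disjoint ax ay xy vu)).
  by rewrite /= size_cat /= size_rev /= !addnS /= !negbK oddD e addbb.
move: uN => /= /and4P[]; rewrite !inE !negb_or => /and3P[x12 x13 _] /andP[x23 _] _ _.
have := par _ _ _ _ a1 a2 x12; have := par _ _ _ _ a1 a3 x13; have := par _ _ _ _ a2 a3 x23.
by case: (odd _) (odd _) (odd _) => [] [] [].
Qed.

Lemma loop_odd b p : arm b p b -> odd_cycle (b :: p).
Proof. by move=> ar; rewrite /odd_cycle (loop_cycle ar) (no_even_cycle (loop_cycle ar)). Qed.

(** Otherwise there are loops at [u] and at [v]. They are odd cycles which neither meet nor are
    joined by an edge, against the odd cycle condition. *)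
Lemma big_adj u v : u \in B -> v \in B -> u != v -> adj u v.
Proof.
move=> uB vB uv; apply/negPn/negP => auv.
have [p ap] := loop_exists uB vB uv auv.
have [||q aq] := loop_exists vB uB; [by rewrite eq_sym | by rewrite adj_sym |].
have no_p x : x \in p -> adj x v -> False.
  move=> xp xv; case: (arm_to_big deg2 ap xp xv vB) => [[e _]|[e _]];
    by rewrite e eqxx in uv.
have no_q x : x \in q -> adj x u -> False.
  move=> xq xu; case: (arm_to_big deg2 aq xq xu uB) => [[e _]|[e _]];
    by rewrite e eqxx in uv.
have no_pq x : x \in p -> x \in q -> False.
  move=> xp xq.
  have e := etrans (esym (arm_comp deg2 ap xp)) (arm_comp deg2 aq xq).
  case: q aq {no_q xq} e => [|y q] aq e; first by have := arm_neq0 aq.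
  have yp : y \in p by move/setP/(_ y): e; rewrite !inE eqxx.
  by apply: (no_p y yp); rewrite adj_sym; have := arm_path aq; case/andP.
have [x [y [xc yd]]] := G_odd_cycles (loop_odd ap) (loop_odd aq).
have nup : {in p, forall x, x \notin B} := arm_nonbig ap.
have nuq : {in q, forall x, x \notin B} := arm_nonbig aq.
move: xc yd; rewrite !inE => /predU1P[->|xp] /predU1P[->|yq].
- by rewrite (negPf uv) (negPf auv).
- case/predU1P => [e|]; first by have := nuq y yq; rewrite -e uB.
  by rewrite adj_sym => /(no_q y yq).
- case/predU1P => [e|/(no_p x xp)//]; first by have := nup x xp; rewrite e vB.
case/predU1P => [e|xy]; first by apply: (no_pq x) => //; rewrite e.
by apply: (no_pq y) => //; apply: (arm_closed deg2 ap xp xy (nuq y yq)).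
Qed.

(** The arm closes up to an odd cycle, by itself if it is a loop and by the edge between the two big
    vertices otherwise. *)
Lemma arm_parity b p b' : arm b p b' -> odd (size p) = (b != b').
Proof.
move=> ar; have [e|ne] := eqVneq b b'.
  subst b'; have := no_even_cycle (loop_cycle ar); rewrite /=.
  by case: (odd _).
have := no_even_cycle (chord_cycle ar ne (big_adj (arm_big ar) (arm_big' ar) ne)).
by rewrite /= size_rcons /= negbK.
Qed.

Variable u : G.
Hypothesis uB : u \in B.

Lemma big_other v v' : v \in B -> v' \in B -> v != u -> v' != u -> v = v'.
Proof.
move=> vB v'B vu v'u; have := v'B; rewrite (big_pair uB vB) 1?eq_sym // !inE.
by rewrite (negPf v'u) => /eqP.
Qed.

(** The last condition orients the arm: it starts at [u] as soon as one of its ends is attached to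
    [u]. *)
Definition comp_arm_spec (k : {set G}) (a : G * seq G * G) : Prop :=
  let: (b, p, b') := a in [/\ arm b p b', k = [set y in p] & b' = u -> b = u].

Definition arm_of (k : {set G}) : G * seq G * G :=
  epsilon (inhabits (u, [::], u)) (comp_arm_spec k).

Lemma arm_ofP w : w \notin B -> comp_arm_spec (comp w) (arm_of (comp w)).
Proof.
move=> wB; apply: (epsilon_spec (inhabits (u, [::], u)) (comp_arm_spec (comp w))).
have B0 : (0 < #|B|)%N by apply/card_gt0P; exists u.
have [b [p [b' [ar e]]]] := comp_arm deg2 G_connected B0 wB.
have [b'u|b'u] := eqVneq b' u.
  exists (b', rev p, b); split=> //; first exact: arm_rev.
  by rewrite e; apply/setP => y; rewrite !inE mem_rev.
by exists (b, p, b'); split=> // e'; rewrite e' eqxx in b'u.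
Qed.

(* The edges of an arm are coloured alternately, according to the position of their
   first vertex. The shift makes [true] the colour of the edges at [u] and [false]
   that of the edges at the other big vertex. *)
Definition edge_colour (A : {set G}) : option ({set G} * bool) :=
  if [pick x in A | x \notin B] is Some x then
    let: (b, p, _) := arm_of (comp x) in
    Some (comp x, odd (find (mem A) (b :: p)) (+) (b == u))
  else None.

Lemma edge_colour_big x y : x \in B -> y \in B -> edge_colour [set x; y] = None.
Proof.
move=> xB yB; rewrite /edge_colour; case: pickP => // z.
by rewrite !inE => /andP[/orP[]/eqP->]; rewrite ?inE in xB yB *; rewrite ?xB ?yB.
Qed.

(** If both ends of the edge are nonbig they lie in one component, so it does not matter which of
    them is picked. *)
Lemma edge_colour_nonbig x y : x \notin B -> adj x y ->
  let: (b, p, _) := arm_of (comp x) in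
  edge_colour [set x; y] =
    Some (comp x, odd (find (mem [set x; y]) (b :: p)) (+) (b == u)).
Proof.
move=> xB xy; rewrite /edge_colour; case: pickP => [z|/(_ x)]; last first.
  by rewrite !inE eqxx /=; rewrite inE in xB; rewrite xB.
move=> /andP[]; rewrite in_set2 => /orP[]/eqP-> yB; last first.
  have -> : comp y = comp x.
    by apply: comp_eq; apply: (comp_adj xB (comp_refl x) xy yB).
  by case: (arm_of _) => [[]].
by case: (arm_of _) => [[]].
Qed.

(** [find] returns the position of the first end of the edge. The only exception is the last edge of
    a loop, whose end [b] is found at position 0 instead of [size p]; both are even by
    [arm_parity]. *)
Lemma find_step b p b' i x0 : arm b p b' -> (i <= size p)%N ->
  odd (find (mem [set nth x0 (b :: rcons p b') i; nth x0 (b :: rcons p b') i.+1]) (b :: p))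
  = odd i.
Proof.
move=> ar ip; set A := [set _; _].
have lE j : (j <= size p)%N -> nth x0 (b :: rcons p b') j = nth x0 (b :: p) j.
  by case: j => //= j jp; rewrite nth_rcons jp.
have ubp : uniq (b :: p).
  by rewrite /= (arm_uniq ar) andbT; apply: contraTN (arm_big ar); apply: (arm_nonbig ar).
have iA : nth x0 (b :: p) i \in A by rewrite -lE // !inE eqxx.
have hA : has (mem A) (b :: p).
  by apply/hasP; exists (nth x0 (b :: p) i); rewrite // mem_nth.
have fi : (find (mem A) (b :: p) <= i)%N.
  by rewrite leqNgt; apply/negP => /(before_find x0)/=; rewrite iA.
have := nth_find x0 hA; move: fi; set j := find _ _ => ji /=.
have [-> //|nij] := eqVneq j i; have ltji : (j < i)%N by rewrite ltn_neqAle nij.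
rewrite !inE lE // nth_uniq //=; last by rewrite ltnS (leq_trans ji).
rewrite (negPf nij) /= => /eqP e.
have [lt|le] := ltnP i (size p).
  move: e; rewrite nth_rcons lt => /eqP; rewrite -[nth x0 p i]/(nth x0 (b :: p) i.+1).
  by rewrite nth_uniq //= ?ltnS ?(leq_trans ji) // => /eqP e; move: ltji; rewrite e ltnNge leqnSn.
have ei : i = size p by apply/eqP; rewrite eqn_leq ip le.
move: e; rewrite nth_rcons ei ltnn eqxx => e.
case: (j) ltji e {nij ji} => [|j1] ltji /= e; last first.
  have jp : (j1 < size p)%N by rewrite -ei ltnW.
  by have := arm_nonbig ar (mem_nth x0 jp); rewrite e (arm_big' ar).
by rewrite (arm_parity ar) e eqxx.
Qed.

End Colouring.

Section ColourDegrees.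

Variable G : sgraph.
Implicit Types (x y z w : G) (p : seq G).

Hypothesis deg2 : forall x : G, (2 <= degree x)%N.
Hypothesis no_even_cycle : forall c : seq G, is_cycle c -> odd (size c).
Hypothesis G_connected : forall x y : G, connect (@adj G) x y.
Hypothesis G_odd_cycles : odd_cycle_condition G.
Hypothesis big_le2 : (#|big G| <= 2)%N.
Variable u : G.
Hypothesis uB : u \in big G.

Local Notation B := (big G).
Local Notation colour x y := (edge_colour u [set x; y]).

Let aP := arm_ofP deg2 G_connected uB.
Let step := find_step deg2 no_even_cycle G_odd_cycles big_le2.

Lemma colour_alternate w y : w \notin B -> adj w y -> exists b : bool,
  forall z, adj w z -> colour w z = Some (comp w, b (+) (y != z)).
Proof.
move=> wB wy; have := aP wB; case E : (arm_of u (comp w)) => [[b p] b'] [ar eC ob].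
have wp : w \in p by have := comp_refl w; rewrite eC inE.
have ip : (index w p < size p)%N by rewrite index_mem.
have nbr := arm_nbr deg2 w ar ip.
have wE : nth w (b :: rcons p b') (index w p).+1 = w by rewrite /= nth_rcons ip nth_index.
have st1 := step w ar (ltnW ip); have st2 := step w ar ip.
move: nbr st1 st2; rewrite wE [odd _.+1]/=; move: (nth w _ (index w p)) (nth w _ (index w p).+2).
move: (odd (index w p)) => o y1 y2 nbr st1 st2.
have y12 : y1 != y2.
  have [z wz] := nonbig_other deg2 wB wy; apply: contraNneq => e.
  by move: wz wy; rewrite !nbr e !orbb => /eqP-> /eqP->.
have C z : adj w z -> colour w z = Some (comp w, (o (+) (z == y2)) (+) (b == u)).
  move=> wz; have := edge_colour_nonbig u wB wz; rewrite E => ->.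
  move: wz; rewrite nbr => /orP[]/eqP ->.
    by rewrite (negPf y12) addbF setUC; congr (Some (_, _ (+) _)).
  by rewrite eqxx addbT -st2.
exists ((o (+) (y == y2)) (+) (b == u)) => z wz; rewrite (C z wz); congr (Some (_, _)).
have y21 : (y2 == y1) = false by rewrite eq_sym (negPf y12).
suff -> : (z == y2) = (y == y2) (+) (y != z).
  by case: o {st1 st2 C}; case: (y == y2); case: (y != z); case: (b == u).
move: wy wz; rewrite !nbr => /orP[]/eqP-> /orP[]/eqP->;
  by rewrite ?eqxx ?(negPf y12) ?y21.
Qed.

(** The first and the last edge of an arm have positions 0 and [size p]. By [arm_parity] their
    colours agree for a loop and differ otherwise; the shift by b == u fixes which is which. *)
Lemma colour_big w v : w \notin B -> v \in B -> adj w v ->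
  colour w v = Some (comp w, v == u).
Proof.
move=> wB vB wv; have := aP wB; case E : (arm_of u (comp w)) => [[b p] b'] [ar eC ob].
have wp : w \in p by have := comp_refl w; rewrite eC inE.
have := edge_colour_nonbig u wB wv; rewrite E => ->; congr (Some (_, _)).
have par := arm_parity deg2 no_even_cycle G_odd_cycles big_le2 ar.
have [[vb e]|[vb e]] := arm_to_big deg2 ar wp wv vB.
  have := step w ar (leq0n _); rewrite [nth _ _ 0]/= [nth w (b :: rcons p b') 1]/= nth_rcons.
  rewrite lt0n size_eq0 (arm_neq0 ar) -e -vb setUC => ->.
  by [].
have := step w ar (leqnn _).
have pn : (0 < size p)%N by rewrite lt0n size_eq0 (arm_neq0 ar).
rewrite [nth w (b :: rcons p b') (size p).+1]/= nth_rcons ltnn eqxx.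
have -> : nth w (b :: rcons p b') (size p) = w.
  by rewrite -(prednK pn) /= nth_rcons prednK // leqnn -e.
rewrite vb par => ->; have [b'u|b'u] := eqVneq b' u; first by rewrite (ob b'u) b'u eqxx.
have [bu|bu] := eqVneq b u; first by rewrite bu eq_sym b'u.
by rewrite (big_other big_le2 uB (arm_big ar) (arm_big' ar) bu b'u) eqxx.
Qed.

Definition attach (v : G) (k : {set G}) : nat := #|[set x in k | adj v x]|.

(** An arm has two end edges. For a loop they start at distinct vertices, by [arm_simple], so
    counting vertices counts both. *)
Lemma attach_sum w : w \notin B -> (\sum_(v in B) attach v (comp w))%N = 2%N.
Proof.
move=> wB; have := aP wB; case: (arm_of u (comp w)) => [[b p] b'] [ar eC ob].
have par := arm_parity deg2 no_even_cycle G_odd_cycles big_le2 ar.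
have pn : (0 < size p)%N by rewrite lt0n size_eq0 (arm_neq0 ar).
pose x0 := nth w p 0; pose x1 := nth w p (size p).-1.
have x0p : x0 \in p by rewrite mem_nth.
have x1p : x1 \in p by rewrite mem_nth // prednK.
have x0b : adj x0 b.
  have := pathP w (arm_path ar) 0; rewrite size_rcons nth_rcons pn adj_sym.
  exact.
have x1b' : adj x1 b'.
  have := pathP w (arm_path ar) (size p); rewrite size_rcons => /(_ (ltnSn _)).
  rewrite nth_rcons ltnn eqxx.
  by rewrite (_ : nth w (b :: rcons p b') (size p) = x1) // -(prednK pn) /= nth_rcons prednK // leqnn.
have attE v : v \in B -> [set x in comp w | adj v x] =
    [set x | (v == b) && (x == x0) || (v == b') && (x == x1)].
  move=> vB; apply/setP => x; rewrite in_set eC !in_set.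
  apply/andP/orP => [[xp]|[]/andP[/eqP-> /eqP->]]; rewrite adj_sym; last first.
  - by rewrite x1p.
  - by rewrite x0p.
  move=> xv; case: (arm_to_big deg2 ar xp xv vB) => [[-> e]|[-> e]]; [left|right].
    by rewrite eqxx [x]e /x0 (set_nth_default w) ?eqxx.
  by rewrite eqxx [x]e /x1 (set_nth_default w) ?eqxx // prednK.
have [bb|bb] := eqVneq b b'.
  subst b'; rewrite (bigD1 b) ?(arm_big ar) //= /attach attE ?(arm_big ar) //.
  rewrite (_ : [set x | _] = [set x0; x1]) ?big1 ?addn0; first last.
  - by apply/setP => x; rewrite !inE eqxx.
  - move=> v /andP[vB vb]; rewrite attE // (_ : [set x | _] = set0) ?cards0 //.
    by apply/setP => x; rewrite !inE (negPf vb).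
  rewrite cards2 /x0 /x1 nth_uniq ?(arm_uniq ar) ?prednK //.
  have : size p != 1%N by apply/eqP => /(arm_simple ar); rewrite eqxx.
  by case: (size p) pn => [|[]].
have bB := arm_big ar; have b'B := arm_big' ar.
rewrite (big_pair big_le2 bB b'B bb) big_setU1 ?inE //= big_set1 /attach !attE //.
rewrite (_ : [set x | _] = [set x0]); last first.
  by apply/setP => x; rewrite !inE eqxx (negPf bb) /= orbF.
rewrite (_ : [set x | _] = [set x1]) ?cards1 //.
by apply/setP => x; rewrite !inE eqxx eq_sym (negPf bb).
Qed.

End ColourDegrees.

(** * Edge labellings with sum 0 at every vertex *)

Section Balance.

Variable G : sgraph.
Implicit Types (x y z w v : G) (k : {set G}).

Hypothesis deg2 : forall x : G, (2 <= degree x)%N.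
Hypothesis no_even_cycle : forall c : seq G, is_cycle c -> odd (size c).
Hypothesis G_connected : forall x y : G, connect (@adj G) x y.
Hypothesis G_odd_cycles : odd_cycle_condition G.
Hypothesis big_le2 : (#|big G| <= 2)%N.
Variable u : G.
Hypothesis uB : u \in big G.

Local Notation B := (big G).
Local Notation colour x y := (edge_colour u [set x; y]).

Let alternate := colour_alternate deg2 no_even_cycle G_connected G_odd_cycles big_le2 uB.
Let colour_bigE := colour_big deg2 no_even_cycle G_connected G_odd_cycles big_le2 uB.
Let attach2 := attach_sum deg2 no_even_cycle G_connected G_odd_cycles big_le2 uB.

Definition comps : {set {set G}} := [set comp w | w in ~: B].

Lemma comp_in_comps w : w \notin B -> comp w \in comps.
Proof. by move=> wB; apply: imset_f; rewrite inE. Qed.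

Lemma compsP k : reflect (exists2 w, w \notin B & k = comp w) (k \in comps).
Proof.
by apply: (iffP imsetP) => -[w wB ->]; exists w => //; move: wB; rewrite in_setC.
Qed.

Lemma mem_comps k w : k \in comps -> (w \in k) = (w \notin B) && (comp w == k).
Proof.
case/compsP => w0 w0B ->; apply/idP/andP => [h|[wB /eqP <-]]; last exact: comp_refl.
by rewrite (comp_nonbig w0B h) (comp_eq h).
Qed.

Lemma comps_neq0 k : k \in comps -> exists2 w, w \notin B & w \in k.
Proof. by case/compsP => w wB ->; exists w; rewrite ?comp_refl. Qed.

Definition star (V : nmodType) (f : {set G} -> V) x : V :=
  \sum_(y | adj x y) f [set x; y].

Lemma star_nonbig (V : nmodType) (f : {set G} -> V) w y z : w \notin B -> adj w y ->
  adj w z -> y != z -> star f w = f [set w; y] + f [set w; z].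
Proof.
move=> wB wy wz yz; rewrite /star (bigD1 y) //= (bigD1 z) /=; last by rewrite wz eq_sym.
rewrite big1 ?addr0 // => a /andP[/andP[]].
by rewrite (nonbig_nbrs deg2 wB wy wz yz) => /orP[]-> //; rewrite andbF.
Qed.

Lemma star_big (V : nmodType) (f : {set G} -> V) v :
  star f v = \sum_(w | adj v w && (w \notin B)) f [set v; w] +
             \sum_(w | adj v w && (w \in B)) f [set v; w].
Proof. by rewrite /star (bigID (mem B)) /= addrC. Qed.

Lemma big_star_single (V : nmodType) (F : G -> V) v : B = [set v] ->
  \sum_(w | adj v w && (w \in B)) F w = 0.
Proof.
move=> BE; rewrite big_pred0 // => w; rewrite BE inE.
by case: eqP => [->|]; rewrite ?adj_irr ?andbF.
Qed.

Lemma big_star_pair (V : nmodType) (F : G -> V) v v' : v \in B -> v' \in B -> v != v' ->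
  \sum_(w | adj v w && (w \in B)) F w = F v'.
Proof.
move=> vB v'B vv'; rewrite (big_pred1 v') // => w.
rewrite (big_pair big_le2 vB v'B vv') !inE.
have [->|wv'] := eqVneq w v'.
  by rewrite orbT andbT (big_adj deg2 no_even_cycle G_odd_cycles big_le2).
by rewrite orbF; case: eqP => [->|]; rewrite ?adj_irr ?andbF.
Qed.

Lemma sum_attach (V : nmodType) (g : {set G} -> V) v :
  \sum_(w | adj v w && (w \notin B)) g (comp w) = \sum_(k in comps) g k *+ attach v k.
Proof.
rewrite (partition_big (@comp G) (mem comps)) => [|w /andP[_]]; last exact: comp_in_comps.
apply: eq_bigr => k kC; rewrite (eq_bigr (fun=> g k)) => [|w /andP[_ /eqP-> //]].
rewrite sumr_const; congr (_ *+ _); apply: eq_card => w.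
rewrite in_set (mem_comps _ kC) unfold_in /=.
by case: (adj v w); case: (w \in B); case: (comp w == k).
Qed.

Lemma colour_nonbig x y k (b : bool) : x \notin B -> adj x y ->
  colour x y = Some (k, b) -> k = comp x.
Proof.
move=> xB xy e; have [b' h] := alternate xB xy.
by have := h y xy; rewrite e => -[].
Qed.

Lemma colour_bigl v w : v \in B -> w \notin B -> adj v w ->
  colour v w = Some (comp w, v == u).
Proof. by move=> vB wB vw; rewrite setUC colour_bigE // adj_sym. Qed.

Lemma colour_degree_nonbig x k (b : bool) : x \notin B ->
  star (fun A => nat_of_bool (edge_colour u A == Some (k, b))) x = (comp x == k) :> nat.
Proof.
move=> xB; have /card_gt0P[y] : (0 < #|nbrs x|)%N by apply: leq_trans (deg2 x).
rewrite inE => xy; have [z xz yz] := nonbig_other deg2 xB xy.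
have [b' h] := alternate xB xy.
rewrite (star_nonbig _ xB xy xz yz) (h y xy) (h z xz) eqxx yz addbF addbT.
rewrite !(inj_eq Some_inj) !xpair_eqE; case: (comp x == k) => //=.
by case: b' b {h} => [] [].
Qed.

Lemma colour_degree_big v k (b : bool) : v \in B -> k \in comps ->
  star (fun A => nat_of_bool (edge_colour u A == Some (k, b))) v =
  (((v == u) == b) * attach v k)%N.
Proof.
move=> vB kC; rewrite star_big [X in _ + X]big1 => [|w /andP[_ wB]]; last first.
  by rewrite edge_colour_big.
rewrite addr0 (eq_bigr (fun w => (((v == u) == b) && (comp w == k))%:R : nat)); last first.
  move=> w /andP[vw wB]; rewrite colour_bigl // (inj_eq Some_inj) xpair_eqE andbC.
  by case: (_ && _).
rewrite (sum_attach (fun k' => (((v == u) == b) && (k' == k))%:R)) (bigD1 k) //= big1 => [|k' /andP[_ nk]].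
  by rewrite addr0 eqxx andbT natmulE; case: eqP.
by rewrite (negPf nk) andbF mul0rn.
Qed.

Lemma colourless_degree x :
  star (fun A => nat_of_bool (edge_colour u A == None)) x = ((x \in B) * #|B|.-1)%N.
Proof.
have [xB|xB] := boolP (x \in B); last first.
  rewrite /star big1 // => y xy; have [b h] := alternate xB xy.
  by rewrite h.
rewrite star_big big1 => [|w /andP[xw wB]]; last by rewrite colour_bigl.
rewrite add0r (eq_bigr (fun=> 1%N)) => [|w /andP[_ wB]]; last by rewrite edge_colour_big.
have [B1|] := eqVneq #|B| 1%N.
  have [v BE] := cards1P (introT eqP B1); have xv : x = v by move: xB; rewrite BE inE => /eqP.
  by rewrite (big_star_single _ (v := x)) ?B1 // xv.
move=> B1; have B2 : #|B| = 2%N.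
  apply/eqP; rewrite eqn_leq big_le2 ltn_neqAle eq_sym B1 /=.
  by apply/card_gt0P; exists x.
have /card_gt0P[v] : (0 < #|B :\ x|)%N by have := cardsD1 x B; rewrite xB B2 add1n => /succn_inj<-.
rewrite !in_setD1 => /andP[vx vB].
by rewrite (big_star_pair _ xB vB) 1?eq_sym // B2.
Qed.

(** At a nonbig vertex the labels of the two edges are opposite, so [delta] is c k or - c k along
    the arm k, according to colour. The equations at the big vertices then constrain c and determine
    the label of the edge joining them. *)
Lemma balanced (delta : {set G} -> int) : (forall x, star delta x = 0) ->
  exists c : {set G} -> int, [/\ \sum_(k in comps) c k = 0,
    forall x y k (b : bool), adj x y -> colour x y = Some (k, b) ->
      delta [set x; y] = if b then c k else - c k &
    (forall k, k \in comps -> c k = 0) -> forall x y, adj x y -> delta [set x; y] = 0].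
Proof.
(* For a nonbig [w], the sum has a single term: the label of the edge at [w] with colour [true]. *)
move=> bal; pose cw w := \sum_(y | adj w y && (colour w y == Some (comp w, true))) delta [set w; y].
have cwE w y k (b : bool) : w \notin B -> adj w y -> colour w y = Some (k, b) ->
    delta [set w; y] = if b then cw w else - cw w.
  move=> wB wy ck; have [b' h] := alternate wB wy.
  have eb : b' = b by have := h y wy; rewrite ck eqxx addbF => -[].
  have [z wz yz] := nonbig_other deg2 wB wy.
  have := bal w; rewrite (star_nonbig _ wB wy wz yz) => /eqP.
  rewrite addr_eq0 => /eqP dyz.
  have nbr := nonbig_nbrs deg2 wB wy wz yz.
  have cy : colour w y == Some (comp w, true) = b.
    by rewrite (h y wy) (inj_eq Some_inj) xpair_eqE eqxx /= eqxx addbF eb; case: (b).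
  have cz : colour w z == Some (comp w, true) = ~~ b.
    by rewrite (h z wz) (inj_eq Some_inj) xpair_eqE eqxx /= yz addbT eb; case: (b).
  case: b ck eb cy cz => ck eb cy cz.
    rewrite /cw (big_pred1 y) // => a; rewrite nbr.
    have [->|ay] := eqVneq a y; first by rewrite /= cy eqxx.
    by rewrite /= (negPf ay); have [->|] := eqVneq a z; rewrite ?cz.
  rewrite /cw (big_pred1 z) // => a; rewrite nbr.
  have [->|az] := eqVneq a z; first by rewrite /= orbT cz eqxx.
  by rewrite /= orbF (negPf az); have [->|] := eqVneq a y; rewrite ?cy.
have cw_adj w w' : nbadj w w' -> cw w = cw w'.
  case/and3P => ww' wB w'B; have w'w : adj w' w by rewrite adj_sym.
  have [b h] := alternate wB ww'; have e := h w' ww'; rewrite eqxx addbF in e.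
  have e' := e; rewrite setUC in e'.
  have := cwE w w' _ _ wB ww' e; rewrite setUC (cwE w' w _ _ w'B w'w e').
  by case: b {h e e'} => // /oppr_inj.
have cw_comp w w' : w' \in comp w -> cw w = cw w'.
  rewrite inE => /connectP[p]; elim: p w => [|a p IH] w /=; first by move=> _ ->.
  by case/andP => wa pth e; rewrite (cw_adj w a wa); apply: IH.
pose c k := if [pick w in k] is Some w then cw w else 0.
have cE w : c (comp w) = cw w.
  rewrite /c; case: pickP => [w' /cw_comp-> //|/(_ w)].
  by rewrite comp_refl.
exists c.
have colouredE x y k (b : bool) : adj x y -> colour x y = Some (k, b) ->
    delta [set x; y] = if b then c k else - c k.
  move=> xy ck; have [xB|xB] := boolP (x \in B); last first.
    by rewrite (cwE x y k b xB xy ck) (colour_nonbig xB xy ck) cE.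
  have [yB|yB] := boolP (y \in B); first by rewrite edge_colour_big in ck.
  have yx : adj y x by rewrite adj_sym.
  rewrite setUC in ck *.
  by rewrite (cwE y x k b yB yx ck) (colour_nonbig yB yx ck) cE.
have bigsum v : v \in B -> (if v == u then 1 else -1) * (\sum_(k in comps) c k *+ attach v k) +
    \sum_(w | adj v w && (w \in B)) delta [set v; w] = 0.
  move=> vB; rewrite -[RHS](bal v) star_big; congr (_ + _).
  rewrite -(sum_attach c) mulr_sumr; apply: eq_bigr => w /andP[vw wB].
  rewrite (colouredE v w (comp w) (v == u)) ?colour_bigl //.
  by case: eqP; rewrite ?mul1r ?mulN1r.
have B_cases : B = [set u] \/ exists2 v, v \in B & v != u.
  have [/exists_inP[v vB vu]|/exists_inPn h] := boolP [exists v in B, v != u].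
    by right; exists v.
  left; apply/eqP; rewrite eqEsubset sub1set uB andbT; apply/subsetP => v vB.
  by rewrite inE; have := h v vB; rewrite negbK.
split=> //.
  (* With two big vertices u and v, the sums of c k times the numbers of attachments to u and to v
     are opposite, both being equal up to sign to the label of the edge uv. Adding them gives each
     arm multiplicity 2. *)
  have sum2 : \sum_(k in comps) c k *+ 2 = 0.
    case: B_cases => [BE|[v vB vu]].
      have := bigsum u uB; rewrite eqxx mul1r big_star_single // addr0 => su.
      rewrite -[RHS]su.
      apply: eq_bigr => k /compsP[w wB ->]; have := attach2 wB.
      by rewrite BE big_set1 => ->.
    have uv : u != v by rewrite eq_sym.
    have su := bigsum u uB; have sv := bigsum v vB; move: su sv.
    rewrite eqxx (negPf vu) mul1r mulN1r (big_star_pair _ uB vB uv) (big_star_pair _ vB uB vu).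
    rewrite (setUC [set v]) => su sv.
    rewrite (eq_bigr (fun k => c k *+ attach u k + c k *+ attach v k)); last first.
      move=> k /compsP[w wB ->]; rewrite -mulrnDr; congr (_ *+ _).
      by rewrite -(attach2 wB) (big_pair big_le2 uB vB uv) big_setU1 ?inE //= big_set1.
    rewrite big_split /=; apply/eqP; rewrite addr_eq0; apply/eqP.
    by apply: (addIr (delta [set u; v])); rewrite su sv.
  by move: sum2; rewrite sumrMnl => /eqP; rewrite mulrn_eq0 => /eqP.
move=> c0 x y xy; have [xB|xB] := boolP (x \in B); last first.
  have [b h] := alternate xB xy; rewrite (colouredE x y _ _ xy (h y xy)) c0 ?comp_in_comps //.
  by rewrite oppr0 if_same.
have [yB|yB] := boolP (y \in B); last first.
  rewrite (colouredE x y _ _ xy (colour_bigl xB yB xy)) c0 ?comp_in_comps //.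
  by rewrite oppr0 if_same.
have xy' : x != y by apply: contraTneq xy => ->; rewrite adj_irr.
have := bigsum x xB; rewrite (big_star_pair _ xB yB xy') big1 ?mulr0 ?add0r // => k kC.
by rewrite c0 // mul0rn.
Qed.

End Balance.

(** * Minimal cycles and compact induced subgraphs *)

Section InducedCycles.

Variable X : sgraph.
Implicit Types (x y : X) (c : seq X) (W : {set X}).

Definition cycle_set W : Prop := exists c : seq X,
  [/\ is_cycle c, W = [set x in c] &
      {in W &, forall x y, adj x y = (y == next c x) || (x == next c y)}].

Lemma is_cycleP c : is_cycle c -> [/\ (2 < size c)%N, cycle (@adj X) c & uniq c].
Proof. by case/andP => ? /andP[]. Qed.

Lemma next_next_neq c x : (2 < size c)%N -> uniq c -> x \in c -> next c (next c x) != x.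
Proof.
move=> sc uc xc; have [i q e] := rot_to xc; rewrite -!(next_rot i uc) e.
move: sc uc; rewrite -(size_rot i) -(rot_uniq i) e.
case: q {e} => [|y [|z q]] //= _ /and3P[]; rewrite !inE !negb_or => /and3P[xy xz _] _ _.
by rewrite eqxx (eq_sym y) (negPf xy) eqxx (eq_sym z).
Qed.

Lemma next_prev_neq c x : (2 < size c)%N -> uniq c -> x \in c -> next c x != prev c x.
Proof.
move=> sc uc xc; apply/eqP => e; have := next_next_neq sc uc xc.
by rewrite e next_prev // eqxx.
Qed.

Lemma cycle_neighbours c x : is_cycle c -> x \in c ->
  [set next c x; prev c x] \subset nbrs x :&: [set y in c].
Proof.
case/is_cycleP => sc cc uc xc; rewrite subUset !sub1set !inE mem_next mem_prev xc !andbT.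
by rewrite next_cycle // adj_sym prev_cycle.
Qed.

Lemma card_cycle_neighbours c x : is_cycle c -> x \in c -> #|[set next c x; prev c x]| = 2%N.
Proof. by case/is_cycleP => sc cc uc xc; rewrite cards2 next_prev_neq. Qed.

Lemma cycle_setI c : is_cycle c ->
  (forall x, x \in c -> (#|nbrs x :&: [set y in c]| <= 2)%N) -> cycle_set [set x in c].
Proof.
move=> cc deg; have [sc _ uc] := is_cycleP cc; exists c; split=> // x y; rewrite !inE => xc yc.
have : [set next c x; prev c x] == nbrs x :&: [set y in c].
  by rewrite eqEcard cycle_neighbours // card_cycle_neighbours // deg.
move/eqP/setP/(_ y); rewrite !inE yc andbT => <-; congr (_ || _).
by rewrite eq_sym (can2_eq (next_prev uc) (prev_next uc)).
Qed.

(** A vertex has only two neighbours in [W], and two on the smaller cycle; these coincide. Hence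
    [W'] is closed under [next c] and is all of [W]. *)
Lemma cycle_set_sub W W' : cycle_set W -> cycle_set W' -> W' \subset W -> W' = W.
Proof.
move=> [c [cc WE cW]] [c' [cc' W'E cW']] sub.
have [sc _ uc] := is_cycleP cc; have [sc' _ uc'] := is_cycleP cc'.
have in_c x : x \in c' -> x \in c.
  by move=> xc'; have := subsetP sub x; rewrite W'E WE !inE; apply.
have nextW' x : x \in c' -> next c x \in c'.
  move=> xc'; have xc := in_c x xc'.
  have : [set next c' x; prev c' x] == [set next c x; prev c x].
    rewrite eqEcard !card_cycle_neighbours // leqnn andbT; apply/subsetP => y.
    move/(subsetP (cycle_neighbours cc' xc')); rewrite !inE => /andP[xy /in_c yc].
    have := cW x y; rewrite WE !inE xc yc xy => /(_ isT isT)/esym/orP[->//|/eqP->].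
    by rewrite prev_next // eqxx orbT.
  move/eqP/setP/(_ (next c x)); rewrite !inE eqxx /= => /orP[]/eqP->.
    by rewrite mem_next.
  by rewrite mem_prev.
apply/eqP; rewrite eqEsubset sub /=; apply/subsetP => y; rewrite WE W'E !inE => yc.
have [x xc'] : exists x, x \in c'.
  by case: c' sc' {cc' W'E cW' uc' in_c nextW'} => // x c' _; exists x; rewrite mem_head.
have := connect_cycle (cycle_next uc) (in_c x xc') yc.
case/connectP => p + ->; elim: p x xc' => [|z p IH] x xc' //= /andP[/eqP <- pth].
by apply: IH pth; apply: nextW'.
Qed.

End InducedCycles.

Section InducedSubgraph.

Variables (X : sgraph) (W : {set X}).

Local Notation sub := {x : X | x \in W}.

Lemma lift_seq (c : seq X) : {subset c <= W} -> exists c' : seq sub, map val c' = c.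
Proof.
elim: c => [|x c IH] h; first by exists [::].
have [|c' e] := IH; first by move=> y yc; apply: h; rewrite inE yc orbT.
by exists (Sub x (h x (mem_head _ _)) :: c'); rewrite /= e.
Qed.

Lemma is_cycle_val (c : seq (induced W)) : is_cycle (map val c : seq X) = is_cycle c.
Proof.
rewrite /is_cycle size_map /ucycleb (map_inj_uniq val_inj) cycle_map.
by congr (_ && (_ && _)); apply: eq_cycle.
Qed.

Lemma cycle_set_val (W' : {set induced W}) : cycle_set W' <-> cycle_set (val @: W').
Proof.
split=> [[c [cc -> cW]]|[c [cc WE cW]]].
  have [_ _ uc] := is_cycleP cc.
  exists (map val c); split; first by rewrite is_cycle_val.
    apply/setP => x; rewrite inE; apply/imsetP/mapP => -[y yc ->]; exists y => //.
      by rewrite inE in yc.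
    by rewrite inE.
  move=> _ _ /imsetP[x xc ->] /imsetP[y yc ->].
  by rewrite !(next_map val_inj uc) !(inj_eq val_inj) -(cW x y xc yc).
have [|c' e] := @lift_seq c.
  by move=> x xc; have : x \in val @: W' by [rewrite WE inE]; case/imsetP => y _ ->; apply: valP.
have cc' : is_cycle (c' : seq (induced W)) by rewrite -is_cycle_val e.
have [_ _ uc'] := is_cycleP cc'.
exists c'; split=> // [|x y xW yW].
  apply/setP => x; rewrite inE -(mem_imset _ _ val_inj) WE inE -e mem_map //.
  exact: val_inj.
have := cW (val x) (val y) (imset_f _ xW) (imset_f _ yW).
by rewrite -e !(next_map val_inj uc') !(inj_eq val_inj) => <-.
Qed.

Lemma is_cycle_graphP : reflect (cycle_set W) (is_cycle_graph (induced W)).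
Proof.
apply: (iffP idP) => [/existsP[c /andP[cc /forallP cW]]|].
  have [_ _ uc] := is_cycleP cc.
  have -> : W = val @: [set x in (c : seq (induced W))].
    apply/setP => x; apply/idP/imsetP => [xW|[y _ ->]]; last exact: valP.
    exists (Sub x xW) => //; rewrite inE.
    have : [set y in (c : seq (induced W))] == setT.
      by rewrite eqEcard subsetT cardsT cardsE (card_uniqP uc) size_tuple leqnn.
    by move/eqP/setP/(_ (Sub x xW)); rewrite !inE.
  apply/cycle_set_val; exists c; split=> // x y _ _.
  by have /forallP/(_ y)/eqP := cW x.
move=> cW; have := cW; case=> c0 [_ WE0 _].
have /cycle_set_val[c [cc WE cW']] : cycle_set (val @: [set: induced W]).
  rewrite (_ : val @: _ = W) //; apply/setP => x; apply/imsetP/idP => [[y _ ->]|xW].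
    exact: valP.
  by exists (Sub x xW).
have [_ _ uc] := is_cycleP cc.
have sz : size c == #|induced W|.
  by rewrite -(card_uniqP uc) -cardsE -WE cardsT.
apply/existsP; exists (Tuple sz); rewrite cc /=.
by apply/forallP => x; apply/forallP => y; apply/eqP; apply: cW'; rewrite inE.
Qed.

End InducedSubgraph.

(** * Compact induced subgraphs as unions of minimal cycles *)

Section CompactSubgraphs.

Variable G : sgraph.
Implicit Types (x y z w v : G) (k : {set G}) (W : {set G}) (S : {set {set G}}).

Hypothesis deg2 : forall x : G, (2 <= degree x)%N.
Hypothesis no_even_cycle : forall c : seq G, is_cycle c -> odd (size c).
Hypothesis G_connected : forall x y : G, connect (@adj G) x y.
Hypothesis G_odd_cycles : odd_cycle_condition G.
Hypothesis big_le2 : (#|big G| <= 2)%N.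
Hypothesis big_gt0 : (0 < #|big G|)%N.

Local Notation B := (big G).
Local Notation comps := (comps G).

Let badj := big_adj deg2 no_even_cycle G_odd_cycles big_le2.

(* An arm between two distinct big vertices is closed by the edge joining them. *)
Definition cyc k : {set G} := k :|: [set v in B | (0 < attach v k)%N].

Lemma mem_cyc k x : k \in comps -> (x \in cyc k) =
  if x \in B then (0 < attach x k)%N else comp x == k.
Proof.
move=> kC; rewrite in_setU in_set (mem_comps _ kC).
by case: (x \in B); rewrite ?orbF.
Qed.

Lemma attach_gt0 v k : (0 < attach v k)%N = [exists x in k, adj v x].
Proof.
apply/card_gt0P/exists_inP => [[x]|[x xk vx]]; last by exists x; rewrite inE xk.
by rewrite inE => /andP[xk vx]; exists x.
Qed.

(** There are no chords: a nonbig vertex has degree 2, and a big one meets the arm only at its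
    ends. *)
Lemma cyc_cycle_set k : k \in comps -> cycle_set (cyc k).
Proof.
move=> kC; have [w wB kE] := compsP _ kC.
have [b [p [b' [ar eC]]]] := comp_arm deg2 G_connected big_gt0 wB.
rewrite -{}kE in eC; have bB := arm_big ar; have b'B := arm_big' ar.
have nbp : {in p, forall x, x \notin B} := arm_nonbig ar.
have pn : (0 < size p)%N by rewrite lt0n size_eq0 (arm_neq0 ar).
have kp x : (x \in k) = (x \in p) by rewrite eC inE.
pose x0 := nth w p 0; pose x1 := nth w p (size p).-1.
have to_big x v : x \in p -> adj v x -> v \in B -> v = b /\ x = x0 \/ v = b' /\ x = x1.
  move=> xp vx vB; rewrite adj_sym in vx.
  case: (arm_to_big deg2 ar xp vx vB) => [[-> ->]|[-> ->]]; [left|right]; split=> //;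
    by rewrite /x0 /x1 (set_nth_default w) ?prednK.
have attb : (0 < attach b k)%N.
  rewrite attach_gt0; apply/exists_inP; exists x0; first by rewrite kp mem_nth.
  by have := pathP w (arm_path ar) 0; rewrite size_rcons nth_rcons pn; apply.
have attb' : (0 < attach b' k)%N.
  rewrite attach_gt0; apply/exists_inP; exists x1; first by rewrite kp mem_nth ?prednK.
  rewrite adj_sym; have := pathP w (arm_path ar) (size p); rewrite size_rcons => /(_ (ltnSn _)).
  rewrite nth_rcons ltnn eqxx.
  by rewrite (_ : nth w (b :: rcons p b') (size p) = x1) // -(prednK pn) /= nth_rcons prednK // leqnn.
have deg_nonbig (c : seq G) x : x \notin B -> (#|nbrs x :&: [set y in c]| <= 2)%N.
  move=> xB; apply: leq_trans (subset_leq_card (subsetIl _ _)) _.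
  by rewrite leqNgt; move: xB; rewrite inE.
have le2 (a1 a2 : G) (A : {set G}) : A \subset [set a1; a2] -> (#|A| <= 2)%N.
  by move/subset_leq_card/leq_trans; apply; rewrite cards2; case: (_ != _).
have memc x : (x \in cyc k) = [|| x == b, x == b' | x \in p].
  rewrite in_setU kp [x \in [set v in B | _]]in_set orbC orbA; congr (_ || _).
  apply/andP/orP => [[xB]|[]/eqP->]; [|by rewrite bB|by rewrite b'B].
  rewrite attach_gt0 => /exists_inP[y]; rewrite kp => yp xy.
  by case: (to_big y x yp xy xB) => [[-> _]|[-> _]]; [left|right].
have [bb|bb] := eqVneq b b'.
  subst b'; have -> : cyc k = [set x in b :: p].
    by apply/setP => x; rewrite memc [RHS]in_set in_cons orbA orbb.
  apply: cycle_setI; first exact: loop_cycle.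
  move=> x xc; have [xB|] := boolP (x \in B); last exact: deg_nonbig.
  apply: (le2 x0 x1); apply/subsetP => y; rewrite !in_set in_cons => /andP[xy yc].
  have yp : y \in p.
    case/predU1P: yc => // yb; move: xc; rewrite in_cons => /predU1P[xb|/nbp]; last by rewrite xB.
    by rewrite xb yb adj_irr in xy.
  by rewrite !in_set1; case: (to_big y x yp xy xB) => [[_ ->]|[_ ->]]; rewrite eqxx ?orbT.
have abb' : adj b b' by apply: badj.
have -> : cyc k = [set x in b :: rcons p b'].
  by apply/setP => x; rewrite memc [RHS]in_set in_cons mem_rcons in_cons.
apply: cycle_setI; first exact: chord_cycle.
move=> x xc; have [xB|] := boolP (x \in B); last exact: deg_nonbig.
have xbb : (x == b) || (x == b') by rewrite (big_pair big_le2 bB b'B bb) !inE in xB.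
have [xb|xb] := eqVneq x b.
  apply: (le2 x0 b'); apply/subsetP => y; rewrite !in_set !in_set1 in_cons mem_rcons in_cons.
  case/andP => xy /or3P[/eqP yb|->|yp]; rewrite ?orbT //.
    by rewrite xb yb adj_irr in xy.
  case: (to_big y x yp xy xB) => [[_ ->]|[e _]]; rewrite ?eqxx //.
  by rewrite -e xb eqxx in bb.
have xb' : x = b' by move: xbb; rewrite (negPf xb) => /eqP.
apply: (le2 x1 b); apply/subsetP => y; rewrite !in_set !in_set1 in_cons mem_rcons in_cons.
case/andP => xy /or3P[->|/eqP yb|yp]; rewrite ?orbT //.
  by rewrite xb' yb adj_irr in xy.
case: (to_big y x yp xy xB) => [[e _]|[_ ->]]; rewrite ?eqxx //.
by rewrite e eqxx in xb.
Qed.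

Lemma cyc_closed W w : w \notin B -> w \in W ->
  (forall x y, x \in W -> x \notin B -> adj x y -> y \in W) -> cyc (comp w) \subset W.
Proof.
move=> wB wW cl; have kW x : x \in comp w -> x \in W.
  rewrite inE => /connectP[p]; elim: p w wB wW => [|a p IH] w' w'B w'W /=; first by move=> _ ->.
  by case/andP => /and3P[wa _ aB] pth e; apply: (IH a) => //; apply: (cl w').
apply/subsetP => x; rewrite in_setU => /orP[/kW //|]; rewrite in_set => /andP[xB].
rewrite attach_gt0 => /exists_inP[y yk xy]; apply: (cl y); first exact: kW.
  exact: comp_nonbig yk.
by rewrite adj_sym.
Qed.

(** With at least three vertices and at most two big ones, the cycle passes through a nonbig vertex.
    It then contains both neighbours of each of its nonbig vertices, hence the minimal cycle of that
    arm, and equals it. *)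
Lemma cycle_set_cyc W : cycle_set W -> exists2 k, k \in comps & W = cyc k.
Proof.
move=> cW; have [c [cc WE _]] := cW; have [sc _ uc] := is_cycleP cc.
have [w wc wB] : exists2 w, w \in c & w \notin B.
  have /subsetPn[w] : ~~ ([set x in c] \subset B).
    apply/negP => /subset_leq_card; rewrite cardsE (card_uniqP uc) => le.
    by have := leq_trans sc (leq_trans le big_le2).
  by rewrite in_set => wc wB; exists w.
exists (comp w); first exact: comp_in_comps.
apply/esym; apply: cycle_set_sub => //; first by apply: cyc_cycle_set; apply: comp_in_comps.
apply: cyc_closed => // [|x y]; first by rewrite WE inE.
rewrite WE !in_set => xc xB xy.
have : [set next c x; prev c x] == nbrs x.
  rewrite eqEcard card_cycle_neighbours //.
  rewrite (subset_trans (cycle_neighbours cc xc) (subsetIl _ _)) /=.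
  by rewrite leqNgt.
move/eqP/setP/(_ y); rewrite [RHS]in_set xy in_set2 => /orP[]/eqP->.
  by rewrite mem_next.
by rewrite mem_prev.
Qed.

Lemma cyc_subset k k' : k \in comps -> k' \in comps -> cyc k \subset cyc k' -> k = k'.
Proof.
move=> kC k'C /subsetP h; have [w wB wk] := comps_neq0 kC.
have := h w; rewrite !mem_cyc // (negPf wB); move: wk; rewrite mem_comps // => /andP[_ wk].
by rewrite wk => /(_ isT)/eqP <-; rewrite (eqP wk).
Qed.

Lemma num_minimal_cyclesE W :
  num_minimal_cycles (induced W) = #|[set k in comps | cyc k \subset W]|.
Proof.
rewrite /num_minimal_cycles -(card_imset _ (imset_inj val_inj)).
rewrite -[RHS](card_in_imset (f := cyc)); last first.
  move=> k k'; rewrite !inE => /andP[kC _] /andP[k'C _] e.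
  by apply: cyc_subset => //; rewrite e.
apply: eq_card => W'; apply/imsetP/imsetP => [[W0]|[k]].
  rewrite inE => /is_cycle_graphP/cycle_set_val/cycle_set_cyc[k kC e] ->.
  exists k => //; rewrite inE kC -e; apply/subsetP => x /imsetP[y _ ->]; exact: valP.
rewrite inE => /andP[kC /subsetP kW] ->.
have e : cyc k = val @: [set x : induced W | val x \in cyc k].
  apply/setP => x; apply/idP/imsetP => [xk|[y]]; last by rewrite inE => h ->.
  by exists (Sub x (kW x xk)); rewrite // inE.
exists [set x : induced W | val x \in cyc k] => //; rewrite inE.
by apply/is_cycle_graphP/cycle_set_val; rewrite -e; apply: cyc_cycle_set.
Qed.

Definition union_cyc S : {set G} := \bigcup_(k in S) cyc k.

Lemma union_cycK S : S \subset comps -> [set k in comps | cyc k \subset union_cyc S] = S.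
Proof.
move=> SC; apply/setP => k; rewrite in_set; apply/andP/idP => [[kC /subsetP h]|kS]; last first.
  by split; [exact: (subsetP SC) | exact: (bigcup_sup k)].
have [w wB wk] := comps_neq0 kC; move: wk; rewrite mem_comps // => /andP[_ wk].
have /bigcupP[k' k'S] : w \in union_cyc S by apply: h; rewrite mem_cyc // (negPf wB).
rewrite mem_cyc ?(subsetP SC) // (negPf wB) => wk'.
by rewrite -(eqP wk) (eqP wk').
Qed.

Lemma degree_induced W (x : induced W) : degree x = #|nbrs (val x) :&: W|.
Proof.
rewrite /degree -(card_imset _ val_inj); apply: eq_card => y.
rewrite !inE; apply/imsetP/andP => [[z]|[xy yW]]; first by rewrite inE => xz ->; split=> //; apply: valP.
by exists (Sub y yW); rewrite // inE.
Qed.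

Lemma big_in_cyc k : k \in comps -> exists2 v, v \in B & v \in cyc k.
Proof.
move=> kC; have [u uB] := card_gt0P big_gt0.
have [w wB kE] := compsP _ kC.
have := attach_sum deg2 no_even_cycle G_connected G_odd_cycles big_le2 uB wB.
rewrite -kE => s2; have [/exists_inP[v vB av]|/exists_inPn h] := boolP [exists v in B, 0 < attach v k]%N.
  by exists v; rewrite // mem_cyc // vB.
by move: s2; rewrite big1 // => v vB; apply/eqP; rewrite -leqn0 leqNgt h.
Qed.

(** Each cycle is connected and contains a big vertex, and big vertices are adjacent, whence
    connectedness. The conditions on cycles are inherited from [G]. The union is not itself an
    induced cycle, as it would then be the cycle of a single arm. *)
Lemma compact_union S : S \subset comps -> (1 < #|S|)%N -> compact (induced (union_cyc S)).
Proof.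
move=> SC cS; set W := union_cyc S.
have kC k : k \in S -> k \in comps by apply: (subsetP SC).
have kW k : k \in S -> cyc k \subset W by move=> kS; apply: (bigcup_sup k).
have cyc_conn k (x y : induced W) : k \in S -> val x \in cyc k -> val y \in cyc k ->
    connect (@adj (induced W)) x y.
  move=> kS xk yk; have [c [cc cE _]] := cyc_cycle_set (kC k kS).
  have [|c' e] := @lift_seq _ W c.
    by move=> z zc; apply: (subsetP (kW k kS)); rewrite cE inE.
  have ic' : is_cycle (c' : seq (induced W)) by rewrite -is_cycle_val e.
  have [_ cyc' _] := is_cycleP ic'.
  apply: (connect_cycle cyc'); rewrite -(mem_map val_inj) e.
    by move: xk; rewrite cE inE.
  by move: yk; rewrite cE inE.
have conn (x y : induced W) : connect (@adj (induced W)) x y.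
  have /bigcupP[k kS xk] := valP x; have /bigcupP[k' k'S yk'] := valP y.
  have [v vB vk] := big_in_cyc (kC k kS); have [v' v'B v'k'] := big_in_cyc (kC k' k'S).
  pose sv : induced W := Sub v (subsetP (kW k kS) v vk).
  pose sv' : induced W := Sub v' (subsetP (kW k' k'S) v' v'k').
  apply: connect_trans (cyc_conn k x sv kS xk vk) _.
  apply: connect_trans (cyc_conn k' sv' y k'S v'k' yk').
  have [e|ne] := eqVneq v v'; first by rewrite (_ : sv = sv') ?connect0 //; apply: val_inj.
  by apply: connect1; apply: badj.
split.
- split=> //; have [k kS] : exists k, k \in S by apply/card_gt0P; apply: ltnW.
  have [v vB vk] := big_in_cyc (kC k kS); apply/card_gt0P.
  by exists (Sub v (subsetP (kW k kS) v vk)).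
- move=> x; rewrite degree_induced; have /bigcupP[k kS xk] := valP x.
  have [c [cc cE _]] := cyc_cycle_set (kC k kS).
  have xc : val x \in c by move: xk; rewrite cE inE.
  rewrite -(card_cycle_neighbours cc xc); apply: subset_leq_card.
  by apply: subset_trans (cycle_neighbours cc xc) _; rewrite setIS // -cE kW.
- by move=> c cc; rewrite -(size_map val); apply: no_even_cycle; rewrite is_cycle_val.
- move=> c d /andP[cc oc] /andP[dc od].
  have [||x [y [xc yd h]]] := G_odd_cycles (c := map val c) (d := map val d).
  + by rewrite /odd_cycle is_cycle_val cc size_map.
  + by rewrite /odd_cycle is_cycle_val dc size_map.
  have [x' x'c ex] := mapP xc; have [y' y'd ey] := mapP yd.
  exists x', y'; split=> //; move: h; rewrite ex ey (inj_eq val_inj).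
  by [].
case=> /is_cycle_graphP/cycle_set_cyc[k0 k0C WE] _.
have := cS; rewrite -(union_cycK SC) -/W WE (_ : [set k in comps | _] = [set k0]) ?cards1 //.
apply/setP => k; rewrite in_set in_set1; apply/andP/eqP => [[kC' h]|-> //].
exact: cyc_subset.
Qed.

(** Degree at least 2 forces both neighbours of a nonbig vertex of [W] into [W], hence the whole
    cycle of its arm. A big vertex of [W] has at most one big neighbour, so it also has a nonbig one
    in [W]. *)
Lemma compact_induced W : compact (induced W) ->
  W = union_cyc [set k in comps | cyc k \subset W].
Proof.
case=> _ degW _ _ _; apply/eqP; rewrite eqEsubset; apply/andP; split; last first.
  by apply/bigcupsP => k; rewrite inE => /andP[].
have cl x y : x \in W -> x \notin B -> adj x y -> y \in W.
  move=> xW xB xy; have := degW (Sub x xW); rewrite degree_induced /= => le2.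
  have : nbrs x :&: W == nbrs x.
    rewrite eqEcard subsetIl /= (leq_trans _ le2) //.
    by rewrite leqNgt; move: xB; rewrite inE.
  by move/eqP/setP/(_ y); rewrite !inE xy.
have key w : w \in W -> w \notin B -> cyc (comp w) \subset
    union_cyc [set k in comps | cyc k \subset W].
  move=> wW wB; apply: (bigcup_sup (comp w)) => //.
  by rewrite in_set comp_in_comps // cyc_closed.
apply/subsetP => x xW; have [xB|xB] := boolP (x \in B); last first.
  by apply: (subsetP (key x xW xB)); rewrite mem_cyc ?comp_in_comps // (negPf xB).
have [y yW /andP[xy yB]] : exists2 y, y \in W & adj x y && (y \notin B).
  have := degW (Sub x xW); rewrite degree_induced /= => le2.
  have /subsetPn[y] : ~~ (nbrs x :&: W \subset B :\ x).
    apply/negP => /subset_leq_card/(leq_trans le2).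
    by have := big_le2; rewrite (cardsD1 x) xB; case: #|_| => [|[]].
  rewrite !inE => /andP[xy yW]; rewrite negb_and negbK => /orP[/eqP e|yB].
    by rewrite e adj_irr in xy.
  by exists y; rewrite // xy inE.
apply: (subsetP (key y yW yB)); rewrite mem_cyc ?comp_in_comps // xB attach_gt0.
by apply/exists_inP; exists y; rewrite ?comp_refl.
Qed.

End CompactSubgraphs.

(** * The scroll resolution of the edge ring *)

Section Columns.

Variable G : sgraph.
Implicit Types (x y z w : G) (k : {set G}).

Hypothesis deg2 : forall x : G, (2 <= degree x)%N.
Hypothesis no_even_cycle : forall c : seq G, is_cycle c -> odd (size c).
Hypothesis G_connected : forall x y : G, connect (@adj G) x y.
Hypothesis G_odd_cycles : odd_cycle_condition G.
Hypothesis big_le2 : (#|big G| <= 2)%N.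
Variable u : G.
Hypothesis uB : u \in big G.

Local Notation B := (big G).
Local Notation comps := (comps G).

Let alternate := colour_alternate deg2 no_even_cycle G_connected G_odd_cycles big_le2 uB.

(** The exponent of e attached to the arm; as a sum it is 0 when [u] is the only big vertex. *)
Definition attach_other k : nat := (\sum_(v in B :\ u) attach v k)%N.

Lemma attach_otherE k : k \in comps -> (attach u k + attach_other k)%N = 2%N.
Proof.
move=> kC; have [w wB ->] := compsP _ kC.
rewrite -(attach_sum deg2 no_even_cycle G_connected G_odd_cycles big_le2 uB wB).
rewrite (bigD1 u) //=; congr (_ + _)%N; apply: eq_bigl => v.
by rewrite in_setD1 andbC.
Qed.

Lemma attach_other_big k v : v \in B -> v != u -> attach_other k = attach v k.
Proof.
move=> vB vu; rewrite /attach_other (big_pred1 v) // => x.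
rewrite in_setD1; apply/andP/eqP => [[xu xB]|->//].
exact: (big_other big_le2 uB).
Qed.

Lemma cyc_nbr w y : w \notin B -> adj w y -> y \in cyc (comp w).
Proof.
move=> wB wy; rewrite mem_cyc ?comp_in_comps //; have [yB|yB] := boolP (y \in B).
  by rewrite attach_gt0; apply/exists_inP; exists w; rewrite ?comp_refl // adj_sym.
by apply/eqP; apply: comp_eq; exact: (comp_adj wB (comp_refl w) wy).
Qed.

Lemma edge_colour_cyc x y k (b : bool) : adj x y -> edge_colour u [set x; y] = Some (k, b) ->
  k \in comps /\ y \in cyc k.
Proof.
move=> xy e; have [xB|xB] := boolP (x \in B); last first.
  by rewrite (colour_nonbig deg2 no_even_cycle G_connected G_odd_cycles big_le2 uB xB xy e)
    comp_in_comps // cyc_nbr.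
have [yB|yB] := boolP (y \in B); first by rewrite edge_colour_big in e.
rewrite setUC in e; rewrite adj_sym in xy.
rewrite (colour_nonbig deg2 no_even_cycle G_connected G_odd_cycles big_le2 uB yB xy e).
by rewrite comp_in_comps // mem_cyc ?comp_in_comps // (negPf yB).
Qed.

Lemma sorted_columns : exists col : 'I_#|comps| -> {set G},
  [/\ injective col, codom col =i comps &
      forall j l : 'I_#|comps|, (j < l)%N -> (attach_other (col j) <= attach_other (col l))%N].
Proof.
pose le k k' := (attach_other k <= attach_other k')%N; pose s := sort le (enum comps).
have sz : size s = #|comps| by rewrite size_sort -cardE.
have us : uniq s by rewrite sort_uniq enum_uniq.
have ss : sorted le s by apply: sort_sorted => k k'; apply: leq_total.
exists (fun j => nth set0 s j); split.
- by move=> j l /eqP; rewrite nth_uniq ?sz // => /eqP/val_inj.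
- have ms : s =i comps by move=> k; rewrite mem_sort mem_enum.
  move=> k; apply/codomP/idP => [[j ->]|]; first by rewrite -ms mem_nth ?sz.
  rewrite -ms => ks.
  have ik : (index k s < #|comps|)%N by rewrite -sz index_mem.
  by exists (Ordinal ik); rewrite nth_index.
move=> j l jl; apply: (sorted_ltn_nth _ set0 ss) => //; rewrite ?inE ?sz //.
by move=> k1 k2 k3; apply: leq_trans.
Qed.

End Columns.

(** * Edge labellings along an induced embedding *)

Section Pushforward.

Variables (G H : sgraph) (f : H -> G).
Hypothesis f_inj : injective f.
Hypothesis f_adj : forall x y : H, adj (f x) (f y) = adj x y.

Local Notation image i := (f @: (enum_val i : {set H})).

Lemma edge_valP (i : 'I_#|edges H|) : exists x y : H, adj x y /\ enum_val i = [set x; y].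
Proof.
have := enum_valP i; rewrite inE => /existsP[x /existsP[y /andP[xy /eqP e]]].
by exists x, y.
Qed.

Lemma edge_index (x y : H) : adj x y -> exists i : 'I_#|edges H|, enum_val i = [set x; y].
Proof.
move=> xy; have e : [set x; y] \in edges H.
  by rewrite inE; apply/existsP; exists x; apply/existsP; exists y; rewrite xy eqxx.
by exists (enum_rank_in e [set x; y]); rewrite enum_rankK_in.
Qed.

Lemma imset_pair (x y : H) : f @: [set x; y] = [set f x; f y].
Proof. by rewrite imsetU !imset_set1. Qed.

Lemma image_inj : injective (fun i : 'I_#|edges H| => image i).
Proof. by move=> i j /(imset_inj f_inj)/enum_val_inj. Qed.

(** Extension by 0 of an edge labelling from [H] to [G], so that statements about the arms of [G]
    apply to the edges of [H]. *)
Definition push (V : nmodType) (d : 'I_#|edges H| -> V) (A : {set G}) : V :=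
  \sum_(i | image i == A) d i.

Lemma push_image (V : nmodType) (d : 'I_#|edges H| -> V) i : push d (image i) = d i.
Proof. by rewrite /push (big_pred1 i) // => j; rewrite (inj_eq image_inj). Qed.

Lemma push_outside (V : nmodType) (d : 'I_#|edges H| -> V) x y :
  (forall a, f a <> x) -> push d [set x; y] = 0.
Proof.
move=> xf; rewrite /push big_pred0 // => i; apply/negP => /eqP/setP/(_ x).
by rewrite set21 => /imsetP[a _ xa]; apply: (xf a).
Qed.

Lemma star_push (V : nmodType) (d : 'I_#|edges H| -> V) (z : G) :
  star (push d) z = \sum_(i | z \in image i) d i.
Proof.
rewrite /star /push (exchange_big_dep xpredT) //= [RHS]big_mkcond; apply: eq_bigr => i _.
have [x [y [xy e]]] := edge_valP i.
have fxy : f x != f y by rewrite (inj_eq f_inj); apply: contraTneq xy => ->; rewrite adj_irr.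
have adj_fxy : adj (f x) (f y) by rewrite f_adj.
rewrite e imset_pair in_set2.
have [zx|zx] := eqVneq z (f x).
  rewrite {z}zx orTb (big_pred1 (f y)) // => y'; apply/andP/eqP => [[_ /eqP/setP/(_ (f y))]|->].
    by rewrite set22 in_set2 eq_sym (negPf fxy) => /esym/eqP.
  by rewrite adj_fxy eqxx.
have [zy|zy] := eqVneq z (f y).
  rewrite {z zx}zy orbT (big_pred1 (f x)) // => y'; apply/andP/eqP => [[_ /eqP/setP/(_ (f x))]|->].
    by rewrite set21 in_set2 (negPf fxy) => /esym/eqP.
  by rewrite adj_sym adj_fxy setUC eqxx.
rewrite big_pred0 // => y'; apply/negP => /andP[_ /eqP/setP/(_ z)].
by rewrite set21 in_set2 (negPf zx) (negPf zy).
Qed.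

Lemma star_push_im (V : nmodType) (d : 'I_#|edges H| -> V) (x : H) :
  star (push d) (f x) = \sum_(i | x \in (enum_val i : {set H})) d i.
Proof. by rewrite star_push; apply: eq_bigl => i; rewrite mem_imset. Qed.

Lemma mdegree_push (m : 'X_{1..#|edges H|}) (x : H) :
  mono_degree (multidegree H) m x = star (push (fun i => m i)) (f x).
Proof.
rewrite star_push_im mdegreeE [RHS]big_mkcond; apply: eq_bigr => i _.
by case: (x \in _); rewrite ?mul1n ?mul0n.
Qed.

Lemma push_edge (V : nmodType) (g : {set G} -> V) x y : adj x y ->
  (g [set x; y] <> 0 -> exists a b, x = f a /\ y = f b) ->
  push (fun i => g (image i)) [set x; y] = g [set x; y].
Proof.
move=> xy h; have [g0|/eqP/h[a [b [xa yb]]]] := eqVneq (g [set x; y]) 0.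
  by rewrite g0 /push big1 // => i /eqP->.
subst x y; have [i e] := edge_index (etrans (esym (f_adj a b)) xy).
by rewrite -imset_pair -e push_image.
Qed.

Lemma mdegree_colour (m : 'X_{1..#|edges H|}) (g : {set G} -> nat) (x : H) :
  (forall i, m i = g (image i)) ->
  (forall y, adj (f x) y -> g [set f x; y] <> 0%N -> exists b, y = f b) ->
  mono_degree (multidegree H) m x = star g (f x).
Proof.
move=> mg h; rewrite mdegree_push /star; apply: eq_bigr => y xy.
rewrite /push (eq_bigr (fun i => g (image i))) // -/(push _ _) push_edge //.
by move=> /(h y xy)[b yb]; exists x, b.
Qed.

End Pushforward.

(** * Scroll data of an embedded subgraph *)

Section EmbeddedScroll.

Variable G : sgraph.
Implicit Types (x y z w : G) (k : {set G}).

Hypothesis deg2 : forall x : G, (2 <= degree x)%N.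
Hypothesis no_even_cycle : forall c : seq G, is_cycle c -> odd (size c).
Hypothesis G_connected : forall x y : G, connect (@adj G) x y.
Hypothesis G_odd_cycles : odd_cycle_condition G.
Hypothesis big_le2 : (#|big G| <= 2)%N.
Variable u : G.
Hypothesis uB : u \in big G.

Local Notation B := (big G).
Local Notation comps := (comps G).

Variables (t : nat) (col : 'I_t -> {set G}).
Hypothesis col_inj : injective col.
Hypothesis col_codom : codom col =i comps.
Hypothesis col_mono : forall j l : 'I_t, (j < l)%N ->
  (attach_other u (col j) <= attach_other u (col l))%N.

Variables (H : sgraph) (f : H -> G).
Hypothesis f_inj : injective f.
Hypothesis f_adj : forall x y : H, adj (f x) (f y) = adj x y.

Local Notation image i := (f @: (enum_val i : {set H})).
Local Notation mdegree := (mono_degree (multidegree H)).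

Definition column (i : 'I_#|edges H|) : option ('I_t * bool) :=
  if edge_colour u (image i) is Some (k, b) then
    if [pick j | col j == k] is Some j then Some (j, b) else None
  else None.

Lemma col_comps j : col j \in comps.
Proof. by rewrite -col_codom codom_f. Qed.

Let colour_cyc := edge_colour_cyc deg2 no_even_cycle G_connected G_odd_cycles big_le2 uB.
Let degree_nonbig := colour_degree_nonbig deg2 no_even_cycle G_connected G_odd_cycles big_le2 uB.
Let degree_big := colour_degree_big deg2 no_even_cycle G_connected G_odd_cycles big_le2 uB.

Lemma columnE i : if edge_colour u (image i) is Some (k, b) then
  exists2 j, k = col j & column i = Some (j, b) else column i = None.
Proof.
rewrite /column; have [x [y [xy e]]] := edge_valP i.
rewrite e imset_pair; rewrite -f_adj in xy.
case ce: (edge_colour _ _) => [[k b]|//]; have [kC _] := colour_cyc xy ce.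
rewrite -col_codom in kC; have /codomP[j ->] := kC; exists j => //.
by case: pickP => [j' /eqP/col_inj->//|/(_ j)]; rewrite eqxx.
Qed.

Lemma column_Some i j b : (column i == Some (j, b)) = (edge_colour u (image i) == Some (col j, b)).
Proof.
have := columnE i; case: (edge_colour _ _) => [[k b'] [j' -> ->]|->//].
by rewrite !(inj_eq Some_inj) !xpair_eqE (inj_eq col_inj).
Qed.

Lemma column_None i : (column i == None) = (edge_colour u (image i) == None).
Proof. by have := columnE i; case: (edge_colour _ _) => [[k b'] [j' -> ->]|->]. Qed.

Variable C : {set 'I_t}.
Hypothesis C_cyc : forall j x, j \in C -> x \in cyc (col j) -> exists a, x = f a.
Hypothesis C_image : forall a j, f a \notin B -> comp (f a) = col j -> j \in C.

Lemma colm_degree j b (x : H) : j \in C -> mdegree (colm column b j) x =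
  star (fun A => (edge_colour u A == Some (col j, b)) : nat) (f x).
Proof.
move=> jC; apply: mdegree_colour => //.
  by move=> i; rewrite mnmE column_Some.
move=> y xy; case: eqP => // ce _; have [_ yc] := colour_cyc xy ce.
exact: C_cyc yc.
Qed.

Lemma em_degree (x : H) : {subset B <= codom f} -> mdegree (em column) x =
  star (fun A => (edge_colour u A == None) : nat) (f x).
Proof.
move=> Bf; apply: mdegree_colour => //.
  by move=> i; rewrite mnmE column_None.
move=> y xy; case: eqP => // ce _; apply/codomP/Bf.
apply: contraT => yB; move: ce.
have yx : adj y (f x) by rewrite adj_sym.
have [b hb] := colour_alternate deg2 no_even_cycle G_connected G_odd_cycles big_le2 uB yB yx.
by rewrite setUC hb.
Qed.

(** At a nonbig vertex, both colour classes of an arm have the same degree. At [u] only the X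
    contribute and at the other big vertex only the Y; the discrepancy is the difference of the
    exponents at either vertex, because an arm has two attachments in all. *)
Lemma embedded_minor (k l : 'I_t) : k \in C -> l \in C -> (k < l)%N ->
  mdegree (colm column true k) + mdegree (colm column false l) =
  mdegree (colm column true l) + mdegree (colm column false k) +
  mdegree (em column *+ (attach_other u (col l) - attach_other u (col k)))%MM.
Proof.
move=> kC lC kl; apply/ffunP => x; rewrite !ffunE !colm_degree //.
set d := (_ - _)%N; have dE : (attach_other u (col l) = attach_other u (col k) + d)%N.
  by rewrite subnKC // col_mono.
have ek := attach_otherE deg2 no_even_cycle G_connected G_odd_cycles big_le2 uB (col_comps k).
have el := attach_otherE deg2 no_even_cycle G_connected G_odd_cycles big_le2 uB (col_comps l).
have -> : mdegree (em column *+ d)%MM x = ((f x \in B) * #|B|.-1 * d)%N.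
  have -> : mdegree (em column *+ d)%MM x = (mdegree (em column) x * d)%N.
    rewrite !mdegreeE big_distrl; apply: eq_bigr => i _.
    by rewrite mulmnE mulnA.
  have [->|d0] := eqVneq d 0%N; first by rewrite !muln0.
  rewrite em_degree ?(colourless_degree deg2 no_even_cycle G_connected G_odd_cycles big_le2 uB) //.
  move=> y yB; apply/codomP; have [->|yu] := eqVneq y u.
    apply: (C_cyc kC); rewrite mem_cyc ?col_comps // uB.
    by lia.
  apply: (C_cyc lC); rewrite mem_cyc ?col_comps // yB.
  by rewrite -(attach_other_big big_le2 uB _ yB yu) dE; lia.
have [xB|xB] := boolP (f x \in B); last first.
  by rewrite !degree_nonbig // !mul0n [RHS]addr0 addrC.
rewrite !degree_big ?col_comps //.
have [xu|xu] := eqVneq (f x) u; rewrite ?mul1n ?mul0n ?addr0 ?add0r.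
  have [B1|B1] := eqVneq #|B| 1%N.
    have [v0 BE] := cards1P (introT eqP B1).
    have z j : attach_other u (col j) = 0%N.
      apply: big1 => v; rewrite in_setD1; move: uB; rewrite BE !in_set1 => /eqP->.
      by case: eqP.
    rewrite xu B1 !mul0n !addr0; move: ek el; rewrite !z; lia.
  have -> : #|B| = 2%N.
    by apply/eqP; rewrite eqn_leq big_le2 ltn_neqAle eq_sym B1; apply/card_gt0P; exists u.
  rewrite xu mul1n natrDE; lia.
have -> : #|B| = 2%N.
  apply/eqP; rewrite eqn_leq big_le2 (cardsD1 u) uB (cardsD1 (f x)).
  by rewrite in_setD1 xu xB.
rewrite -!(attach_other_big big_le2 uB _ xB xu) dE mul1n.
by [].
Qed.

Lemma cyc_neighbour j w y : j \in C -> w \in col j -> adj w y ->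
  exists i : 'I_#|edges H|, image i = [set w; y].
Proof.
move=> jC; rewrite mem_comps ?col_comps // => /andP[wB /eqP cw] wy.
have [a wa] : exists a, w = f a.
  by apply: (C_cyc jC); rewrite mem_cyc ?col_comps // (negPf wB) cw.
have [b yb] : exists b, y = f b by apply: (C_cyc jC); rewrite -cw cyc_nbr.
have [i e] : exists i : 'I_#|edges H|, enum_val i = [set a; b].
  by apply: edge_index; rewrite -f_adj -wa -yb.
by exists i; rewrite e imset_pair wa yb.
Qed.

Lemma embedded_nonempty j b : j \in C -> exists i, column i = Some (j, b).
Proof.
move=> jC; have [w wB wj] := comps_neq0 (col_comps j).
have cw : comp w = col j by move: wj; rewrite mem_comps ?col_comps // wB => /eqP.
have /card_gt0P[y] : (0 < #|nbrs w|)%N by apply: leq_trans (deg2 w).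
rewrite inE => wy; have [z wz yz] := nonbig_other deg2 wB wy.
have [b' h] := colour_alternate deg2 no_even_cycle G_connected G_odd_cycles big_le2 uB wB wy.
have [i ei] := cyc_neighbour jC wj wy; have [i' ei'] := cyc_neighbour jC wj wz.
have [bb|bb] := eqVneq b b'.
  by exists i; apply/eqP; rewrite column_Some ei (h y wy) eqxx addbF cw bb.
exists i'; apply/eqP; rewrite column_Some ei' (h z wz) yz addbT cw.
by case: b b' bb {h} => [] [].
Qed.

(** The difference of the exponents, pushed forward to [G], has sum 0 at every vertex, so [balanced]
    applies. Its c vanishes on the arms outside [C], whose edges are not in the image. *)
Lemma embedded_fiber m m' : mdegree m = mdegree m' -> exists c : 'I_t -> int,
  [/\ \sum_(j in C) c j = 0,
      forall i j, column i = Some (j, true) -> (m i)%:Z = (m' i)%:Z + c j,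
      forall i j, column i = Some (j, false) -> (m i)%:Z = (m' i)%:Z - c j &
      (forall j, j \in C -> c j = 0) -> m = m'].
Proof.
move=> mm'; pose d i : int := (m i)%:Z - (m' i)%:Z; pose delta := push f d.
have image0 (z : G) : (forall a, f a <> z) -> forall y, delta [set z; y] = 0.
  by move=> zf y; apply: push_outside.
have [|c [c0 cE cz]] := balanced deg2 no_even_cycle G_connected G_odd_cycles big_le2 uB (delta := delta).
  move=> z; have [/codomP[x ->]|zf] := boolP (z \in codom f); last first.
    rewrite /star big1 // => y _; apply: image0 => a e.
    by rewrite -e codom_f in zf.
  rewrite /delta star_push_im //; have := congr1 (fun h : {ffun H -> nat} => h x) mm'.
  rewrite !mdegreeE => e; rewrite /d sumrB; apply/eqP; rewrite subr_eq0; apply/eqP.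
  have sumE (n : 'X_{1..#|edges H|}) : \sum_(i | x \in (enum_val i : {set H})) (n i)%:Z =
      (\sum_(i < #|edges H|) (x \in (enum_val i : {set H})) * n i)%N%:Z.
    rewrite (big_morph Posz PoszD (erefl _)) big_mkcond; apply: eq_bigr => i _.
    by case: (x \in _); rewrite ?mul1n ?mul0n.
  by rewrite !sumE e.
have dE i j b : column i = Some (j, b) -> d i = if b then c (col j) else - c (col j).
  move/eqP; rewrite column_Some; have [x [y [xy e]]] := edge_valP i.
  rewrite -(push_image f_inj d i) e imset_pair => /eqP; apply: cE.
  by rewrite f_adj.
have cC j : j \notin C -> c (col j) = 0.
  move=> jC; have [w wB wj] := comps_neq0 (col_comps j).
  have cw : comp w = col j by move: wj; rewrite mem_comps ?col_comps // wB => /eqP.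
  have wf a : f a <> w by move=> e; case/negP: jC; apply: (C_image (a := a)); rewrite e.
  have /card_gt0P[y] : (0 < #|nbrs w|)%N by apply: leq_trans (deg2 w).
  rewrite inE => wy.
  have [b h] := colour_alternate deg2 no_even_cycle G_connected G_odd_cycles big_le2 uB wB wy.
  have := cE w y _ _ wy (h y wy); rewrite image0 // cw eqxx addbF.
  by case: (b) => // /esym/eqP; rewrite oppr_eq0 => /eqP.
exists (c \o col); split.
- have cols : comps = col @: [set: 'I_t].
    by apply/setP => k; rewrite -col_codom; apply/codomP/imsetP => -[j]; exists j.
  rewrite -[RHS]c0 cols big_imset /=; last by move=> ? ? _ _ /col_inj.
  rewrite big_mkcond [RHS]big_mkcond; apply: eq_bigr => j _; rewrite in_setT.
  by case: ifPn => // /cC->.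
- by move=> i j /dE /= <-; rewrite addrC subrK.
- by move=> i j /dE /= e; rewrite -e addrC subrK.
move=> cj; apply/mnmP => i; have [x [y [xy e]]] := edge_valP i.
apply/eqP; rewrite -eqz_nat -subr_eq0; apply/eqP; rewrite -/(d i).
rewrite -(push_image f_inj d i) e imset_pair; apply: cz; last by rewrite f_adj.
move=> k; rewrite -col_codom => /codomP[j ->].
by have [/cj|/cC] := boolP (j \in C).
Qed.

Lemma embedded_scroll_data : scroll_data C column (fun j => attach_other u (col j)).
Proof.
by split; [|exact: embedded_nonempty|exact: embedded_minor|exact: embedded_fiber].
Qed.

End EmbeddedScroll.

(** * Top supports of the compact induced subgraphs *)

Section Supports.

Variables (K : fieldType) (G : sgraph).
Implicit Types (x y z w : G) (k : {set G}).

Hypothesis deg2 : forall x : G, (2 <= degree x)%N.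
Hypothesis no_even_cycle : forall c : seq G, is_cycle c -> odd (size c).
Hypothesis G_connected : forall x y : G, connect (@adj G) x y.
Hypothesis G_odd_cycles : odd_cycle_condition G.
Hypothesis big_le2 : (#|big G| <= 2)%N.
Variable u : G.
Hypothesis uB : u \in big G.

Local Notation B := (big G).
Local Notation comps := (comps G).

Variables (t : nat) (col : 'I_t -> {set G}).
Hypothesis col_inj : injective col.
Hypothesis col_codom : codom col =i comps.
Hypothesis col_mono : forall j l : 'I_t, (j < l)%N ->
  (attach_other u (col j) <= attach_other u (col l))%N.

Let big_gt0 : (0 < #|B|)%N.
Proof. by apply/card_gt0P; exists u. Qed.

Let colour_cyc := edge_colour_cyc deg2 no_even_cycle G_connected G_odd_cycles big_le2 uB.
Let colC := col_comps col_codom.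
Let scroll_embedded := embedded_scroll_data deg2 no_even_cycle G_connected G_odd_cycles
  big_le2 uB col_inj col_codom col_mono.

(** The lead monomial as a labelling of the edges of [G], independent of the subgraph in which it is
    formed. *)
Definition lead_colour (T : {set 'I_t}) a (A : {set G}) : nat :=
  (\sum_(j in T) (edge_colour u A == Some (col j, (pos T j < a)%N)))%N.

Lemma lead_colour_cyc T a x y : adj x y -> lead_colour T a [set x; y] <> 0%N ->
  exists2 j, j \in T & x \in cyc (col j) /\ y \in cyc (col j).
Proof.
move=> xy /eqP; rewrite sum_nat_eq0 negb_forall => /existsP[j].
rewrite negb_imply => /andP[jT]; rewrite eqb0 negbK => /eqP ce; exists j => //.
have [_ yc] := colour_cyc xy ce; split=> //.
by rewrite setUC in ce; rewrite adj_sym in xy; have [] := colour_cyc xy ce.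
Qed.

Lemma lead_degree (H : sgraph) (f : H -> G) (T : {set 'I_t}) a (x : H) :
  injective f -> (forall x y : H, adj (f x) (f y) = adj x y) ->
  (forall j y, j \in T -> y \in cyc (col j) -> exists b, y = f b) ->
  mono_degree (multidegree H) (lead_monomial (column u col f) T a) x =
  star (lead_colour T a) (f x).
Proof.
move=> f_inj f_adj Tf; apply: mdegree_colour => // [i|y xy].
  rewrite /lead_monomial /select mnm_sumE; apply: eq_bigr => j jT; rewrite mnmE.
  by rewrite (column_Some deg2 no_even_cycle G_connected G_odd_cycles big_le2 uB col_inj col_codom f_adj).
by move/(lead_colour_cyc xy) => [j jT [_ yj]]; apply: Tf yj.
Qed.

(** Both sides are the vertex sums of the same labelling [lead_colour T a], which vanishes on edges
    outside the cycles of [T]. *)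
Lemma extend_lead_degree (W : {set G}) (T : {set 'I_t}) a :
  (forall j, j \in T -> cyc (col j) \subset W) ->
  extend (mono_degree (multidegree (induced W)) (lead_monomial
    (column u col (val : induced W -> G)) T a)) =
  mono_degree (multidegree G) (lead_monomial (column u col id) T a).
Proof.
move=> TW; apply/ffunP => x; rewrite ffunE (@lead_degree G id) //; last by move=> j y; exists y.
case: insubP => [x' xW ex|xW].
  rewrite (@lead_degree (induced W) val) ?ex //; first exact: val_inj.
  by move=> j y jT yj; exists (Sub y (subsetP (TW j jT) y yj)).
apply/esym/big1 => y xy; apply/eqP; apply: contraNT xW => /eqP/(lead_colour_cyc xy)[j jT [xj _]].
exact: (subsetP (TW j jT)).
Qed.

Lemma scroll_data_whole :
  scroll_data setT (column u col (id : G -> G)) (fun j => attach_other u (col j)).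
Proof. by apply: scroll_embedded => // [j x _ _|a j _ _]; [exists x | rewrite in_setT]. Qed.

Lemma scroll_data_induced (W : {set G}) (C : {set 'I_t}) : W = union_cyc (col @: C) ->
  scroll_data C (column u col (val : induced W -> G)) (fun j => attach_other u (col j)).
Proof.
move=> WE; apply: scroll_embedded => //; first exact: val_inj.
  move=> j x jC xj; have xW : x \in W by rewrite WE; apply/bigcupP; exists (col j); rewrite ?imset_f.
  by exists (Sub x xW).
move=> a j aB aj; have : val a \in union_cyc (col @: C) by rewrite -WE; apply: valP.
case/bigcupP => k /imsetP[l lC ->].
by rewrite mem_cyc ?colC // (negPf aB) aj => /eqP/col_inj->.
Qed.

(** A compact [W] with i + 1 minimal cycles corresponds to the set [C] of their columns, and the top
    of its resolution is indexed by the pairs (C, a). Since [T] has i + 1 elements, each basis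
    vector (T, a) in homological degree i for [G] arises from exactly the [W] given by C = T. *)
Lemma support_setE i a : (0 < i)%N -> support_set K i a <->
  exists2 b, b \in scroll_basis [set: 'I_t] i &
    a = mono_degree (multidegree G) (lead_monomial (column u col id) b.1 b.2).
Proof.
move=> i0; have cyc_sub (C : {set 'I_t}) j : j \in C -> cyc (col j) \subset union_cyc (col @: C).
  by move=> jC; apply: (bigcup_sup (col j)) => //; apply: imset_f.
have nE := num_minimal_cyclesE deg2 no_even_cycle G_connected G_odd_cycles big_le2 big_gt0.
split=> [[W [cW nW [h [ts ->]]]]|[b bb ->]].
  pose C : {set 'I_t} := [set j | cyc (col j) \subset W].
  have SC : [set k in comps | cyc k \subset W] = col @: C.
    apply/setP => k; rewrite in_set -col_codom; apply/andP/imsetP => [[/codomP[j ->] jW]|[j]].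
      by exists j; rewrite // inE.
    by rewrite inE => jW ->; rewrite codom_f.
  have WE : W = union_cyc (col @: C) by rewrite -SC; apply: compact_induced.
  have cC : #|C| = i.+1 by rewrite -nW nE SC card_imset.
  have [b bb ->] := (scroll_top_support K (scroll_data_induced WE) h cC i0).1 ts.
  case: i i0 bb {nW cC} => // i _ bb; have [bC cb bi] := basisP bb.
  exists b; first by rewrite inE /= subsetT cb eqxx.
  rewrite extend_lead_degree // => j jb; rewrite WE cyc_sub //.
  exact: (subsetP bC).
have cb : #|b.1| = i.+1 /\ b \in scroll_basis b.1 i.
  case: i i0 bb => // i _ bb; have [_ cb bi] := basisP bb.
  by rewrite inE /= subxx cb eqxx.
case: cb => cb bb1; set W := union_cyc (col @: b.1).
have SC : col @: b.1 \subset comps by apply/subsetP => k /imsetP[j _ ->].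
exists W; split.
- by apply: compact_union => //; rewrite card_imset // cb.
- by rewrite nE union_cycK // card_imset.
exists (mono_degree (multidegree (induced W))
  (lead_monomial (column u col (val : induced W -> G)) b.1 b.2)); split.
  by apply/(scroll_top_support K (scroll_data_induced (erefl W)) _ cb i0); exists b.
by rewrite extend_lead_degree // => j; apply: cyc_sub.
Qed.

End Supports.

Lemma standard_degreeE (G : sgraph) (m : 'X_{1..#|edges G|}) :
  mono_degree (standard_degree G) m = (\sum_(i < #|edges G|) m i)%N%:Z.
Proof.
rewrite (big_morph Posz PoszD (erefl _)); apply: eq_bigr => i _.
by rewrite -natz.
Qed.

Lemma total_mdegree (G : sgraph) (m : 'X_{1..#|edges G|}) :
  total_degree (mono_degree (multidegree G) m) = (2 * \sum_(i < #|edges G|) m i)%N.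
Proof.
rewrite /total_degree; under eq_bigr => x _ do rewrite mdegreeE.
rewrite exchange_big big_distrr; apply: eq_bigr => i _ /=.
rewrite -big_distrl -big_mkcond sum1_card; congr (_ * _)%N.
have [x [y [xy ->]]] := edge_valP i; rewrite cards2.
by have [e|] := eqVneq x y; rewrite // e adj_irr in xy.
Qed.

Lemma standard_multidegree (G : sgraph) (m m' : 'X_{1..#|edges G|}) :
  mono_degree (multidegree G) m = mono_degree (multidegree G) m' ->
  mono_degree (standard_degree G) m = mono_degree (standard_degree G) m'.
Proof.
move/(congr1 (@total_degree G)); rewrite !total_mdegree !standard_degreeE => e.
by congr Posz; lia.
Qed.

Theorem corollary6p3 (K : fieldType) (G : sgraph)
    (hG : compact_type G 1 \/ compact_type G 2)
    (i : nat) (hi : (1 <= i <= num_minimal_cycles G - 1)%N) :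
  (forall a : {ffun G -> nat}, edge_ring (vmonomial K a) ->
     (support_set K i a -> betti K G (multidegree G) i a = 1%N) /\
     (~ support_set K i a -> betti K G (multidegree G) i a = 0%N)) /\
  (forall j : int,
     has_cardinality
       (fun a : {ffun G -> nat} =>
          support_set K i a /\ (total_degree a)%:Z = 2 * j)
       (betti K G (standard_degree G) i j)).
Proof.
have [cG b0 b2] : [/\ compact G, (0 < #|big G|)%N & (#|big G| <= 2)%N].
  by rewrite /big; case: hG => -[cG ->].
have [[_ conn] deg2 odd_cycles occ _] := cG; have /andP[i0 _] := hi.
have [u uB] := card_gt0P b0.
have [col [col_inj col_codom col_mono]] := sorted_columns u.
have sd := scroll_data_whole deg2 odd_cycles conn occ b2 uB col_inj col_codom col_mono.
have supp := support_setE K deg2 odd_cycles conn occ b2 uB col_inj col_codom col_mono _ i0.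
set LM := lead_monomial _ in supp.
have inj : {in scroll_basis [set: 'I_#|comps G|] i &, injective
    (fun b : scroll_index #|comps G| => mono_degree (multidegree G) (LM b.1 b.2))}.
  by move=> b b'; rewrite -(prednK i0) => bb bb'; exact: (lead_degree_inj sd bb bb').
split=> [a _|j].
  (* At most one basis vector has a given multidegree, by [inj]. *)
  rewrite (scroll_betti K sd) //; split=> [/supp[b bb ->]|na].
    rewrite (_ : [set _ in _ | _] = [set b]) ?cards1 //; apply/setP => b'.
    rewrite in_set in_set1; apply/andP/eqP => [[b'b /eqP/inj-> //]|->].
    by rewrite bb eqxx.
  apply/eqP; rewrite cards_eq0; apply/set0Pn => -[b]; rewrite in_set => /andP[bb /eqP e].
  by apply: na; apply/supp; exists b.
rewrite (scroll_betti K sd) //; last exact: standard_multidegree.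
set S := [set _ in _ | _]; pose deg (b : scroll_index #|comps G|) :=
  mono_degree (multidegree G) (LM b.1 b.2).
have degE b : ((total_degree (deg b))%:Z = 2 * j) <->
    mono_degree (standard_degree G) (LM b.1 b.2) = j.
  have n2 : (2 : int) != 0 by [].
  rewrite total_mdegree standard_degreeE PoszM; split=> [e|<-//].
  exact: (mulfI n2 e).
(* The multidegree embeds the basis vectors of standard degree [j] into the support; its total is 2
   j because every edge has two ends. *)
exists [seq deg b | b <- enum S]; split.
- rewrite map_inj_in_uniq ?enum_uniq // => b b'; rewrite !mem_enum.
  by move=> /setIdP[bb _] /setIdP[b'b _]; apply: inj.
- by rewrite size_map -cardE.
move=> a; split=> [/mapP[b]|[/supp[b bb ->] /degE e]].
  rewrite mem_enum => /setIdP[bb /eqP e] ->; split; last exact/degE.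
  by apply/supp; exists b.
by apply: map_f; rewrite mem_enum; apply/setIdP; split=> //; apply/eqP.
Qed.
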